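(* For undirected unweighted graphs, ANSC $\lesssim^{sprs}_{n^2}$ APSP, and ANSC can be computed in $\tilde O(n^{\omega})$ time, where $\omega$ is the matrix multiplication exponent.
   Context: ANSC (all nodes shortest cycles): given a graph $G=(V,E)$, compute for every vertex $v\in V$ the weight (here: length) of a shortest cycle passing through $v$. APSP: given a graph, compute the shortest path distances for all pairs of vertices together with an $n\times n$ matrix $Last_G$ whose $(x,y)$ entry is the predecessor of $y$ on a shortest path from $x$ to $y$. Sparse reductions: for graph problems $P,Q$, we write $P\lesssim^{sprs}_{f(m,n)} Q$ if, given an algorithm for $Q$ running in time $T_Q(m,n)$ on graphs with $n$ vertices and $m$ edges, one can solve $P$ on graphs with $n$ vertices and $m$ edges in time $\tilde O(T_Q(m,n)+f(m,n))$, making polylogarithmically many oracle calls to $Q$ on graphs with $\tilde O(n)$ vertices and $\tilde O(m)$ edges; $\tilde O$ hides polylogarithmic factors. *)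

(* Defs.v *)
From mathcomp Require Import all_boot all_order all_algebra.
From mathcomp Require Import boolp classical_sets reals exp.

Set Implicit Arguments.
Unset Strict Implicit.
Unset Printing Implicit Defensive.

Import Order.TTheory GRing.Theory Num.Theory.

(** * Machine model

   A logarithmic-cost random access machine, presented as a structured
   language.  The memory consists of arrays of natural numbers; the array names
   are fixed in the program, the indices are computed.  A scalar variable is an
   array used at index 0.  Every value that is computed, every address and
   every word copied is charged its bit length, so that up to polylogarithmic
   factors the cost is the running time on a RAM with words of O(log n) bits as
   long as the values are polynomially bounded, and there is no benefit from
   arithmetic on huge numbers.  One program handles inputs of every size. *)

Definition bits (v : nat) : nat := (trunc_log 2 v).+1.

Definition mem := nat -> seq nat.

Definition upd (m : mem) (a : nat) (s : seq nat) : mem :=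
  fun b => if b == a then s else m b.

Inductive binop := Add | Sub | Mul | Div | Leq.

Definition eval_binop (o : binop) : nat -> nat -> nat :=
  match o with
  | Add => addn | Sub => subn | Mul => muln | Div => divn
  | Leq => fun x y => nat_of_bool (x <= y)
  end.

Inductive expr :=
  | Const of nat
  | Get of nat & expr          (* Get a e  is  a[e]; 0 out of bounds *)
  | Len of nat
  | Bin of binop & expr & expr.

Fixpoint eval (m : mem) (e : expr) : nat :=
  match e with
  | Const c => c
  | Get a e1 => nth 0 (m a) (eval m e1)
  | Len a => size (m a)
  | Bin o e1 e2 => eval_binop o (eval m e1) (eval m e2)
  end.

Fixpoint expr_cost (m : mem) (e : expr) : nat :=
  bits (eval m e) +
  match e with
  | Const _ | Len _ => 0
  | Get _ e1 => expr_cost m e1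
  | Bin _ e1 e2 => expr_cost m e1 + expr_cost m e2
  end.

(* [Call p a b] runs [p] on the contents of [a], in a fresh local memory, and
   stores its output in [b]; [Query a b] does the same with the oracle. *)
Inductive cmd :=
  | Skip
  | Assign of nat & expr & expr   (* Assign a i e  is  a[i] := e *)
  | Seq of cmd & cmd
  | If of expr & cmd & cmd        (* nonzero means true *)
  | While of expr & cmd
  | Call of cmd & nat & nat
  | Query of nat & nat.

Definition copy_cost (s : seq nat) : nat := (\sum_(v <- s) bits v).+1.

(* Array 0 holds the input, array 1 holds the output, and all the arrays
   other than the input are initially empty. *)
Definition load (s : seq nat) : mem := upd (fun=> [::]) 0 s.

(* [exec O c m m' t q]: with oracle [O], the program [c] started in memory [m]
   halts in memory [m'], at cost [t], having made the list [q] of queries.  A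
   query is charged only for writing the question and reading the answer. *)
Inductive exec (O : seq nat -> seq nat) :
    cmd -> mem -> mem -> nat -> seq (seq nat) -> Prop :=
  | ExecSkip m : exec O Skip m m 1 [::]
  | ExecAssign m a i e :
      exec O (Assign a i e) m
        (upd m a (set_nth 0 (m a) (eval m i) (eval m e)))
        (expr_cost m i + expr_cost m e) [::]
  | ExecSeq c1 c2 m1 m2 m3 t1 t2 q1 q2 :
      exec O c1 m1 m2 t1 q1 -> exec O c2 m2 m3 t2 q2 ->
      exec O (Seq c1 c2) m1 m3 (t1 + t2) (q1 ++ q2)
  | ExecIfT e c1 c2 m1 m2 t q :
      eval m1 e != 0 -> exec O c1 m1 m2 t q ->
      exec O (If e c1 c2) m1 m2 (expr_cost m1 e + t) q
  | ExecIfF e c1 c2 m1 m2 t q :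
      eval m1 e = 0 -> exec O c2 m1 m2 t q ->
      exec O (If e c1 c2) m1 m2 (expr_cost m1 e + t) q
  | ExecWhileF e c m :
      eval m e = 0 -> exec O (While e c) m m (expr_cost m e) [::]
  | ExecWhileT e c m1 m2 m3 t1 t2 q1 q2 :
      eval m1 e != 0 -> exec O c m1 m2 t1 q1 ->
      exec O (While e c) m2 m3 t2 q2 ->
      exec O (While e c) m1 m3 (expr_cost m1 e + t1 + t2) (q1 ++ q2)
  | ExecCall p a b m m1 t q :
      exec O p (load (m a)) m1 t q ->
      exec O (Call p a b) m (upd m b (m1 1))
        (copy_cost (m a) + copy_cost (m1 1) + t) q
  | ExecQuery a b m :
      exec O (Query a b) m (upd m b (O (m a)))
        (copy_cost (m a) + copy_cost (O (m a))) [:: m a].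

Definition oracle_runs (O : seq nat -> seq nat) (c : cmd)
    (s out : seq nat) (t : nat) (q : seq (seq nat)) : Prop :=
  exists m, exec O c (load s) m t q /\ m 1 = out.

Fixpoint oracle_free (c : cmd) : bool :=
  match c with
  | Skip | Assign _ _ _ => true
  | Seq c1 c2 | If _ c1 c2 => oracle_free c1 && oracle_free c2
  | While _ c1 | Call c1 _ _ => oracle_free c1
  | Query _ _ => false
  end.

(* For oracle-free programs; the oracle supplied is then irrelevant. *)
Definition runs (c : cmd) (s out : seq nat) (t : nat) : Prop :=
  oracle_runs (fun=> [::]) c s out t [::].

(* [inline A c]: the program [c] with its oracle implemented by [A]. *)
Fixpoint inline (A c : cmd) : cmd :=
  match c with
  | Skip | Assign _ _ _ => c
  | Seq c1 c2 => Seq (inline A c1) (inline A c2)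
  | If e c1 c2 => If e (inline A c1) (inline A c2)
  | While e c1 => While e (inline A c1)
  | Call p a b => Call (inline A p) a b
  | Query a b => Call A a b
  end.

(** * Graphs and graph problems *)

(* Finite simple undirected unweighted graphs with a nonempty vertex set. *)
Record ugraph := UGraph {
  nv : nat;
  nv_gt0 : 0 < nv;
  adj : rel 'I_nv;
  adj_sym : symmetric adj;
  adj_irr : irreflexive adj }.

Definition ne (G : ugraph) : nat :=
  #|[set p : 'I_(nv G) * 'I_(nv G) | (p.1 < p.2) && adj p.1 p.2]|.

(* [s] is n, m, followed by a list of the m edges in which every edge occurs
   exactly once, in an arbitrary orientation and an arbitrary order. *)
Definition encodes (G : ugraph) (s : seq nat) : Prop :=
  exists es : seq ('I_(nv G) * 'I_(nv G)),
    [/\ s = nv G :: ne G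
              :: flatten [seq [:: nat_of_ord p.1; nat_of_ord p.2] | p <- es],
        size es = ne G
      & forall u v, adj u v = ((u, v) \in es) || ((v, u) \in es)].

(* The admissible outputs on each graph. *)
Definition graph_problem := ugraph -> seq nat -> Prop.

Definition rowmajor (T : Type) (n : nat) (F : 'I_n -> 'I_n -> T) : seq T :=
  [seq F i j | i <- enum 'I_n, j <- enum 'I_n].

(* [None] stands for an infinite or undefined value, written as 0. *)
Definition code (o : option nat) : nat := if o is Some d then d.+1 else 0.

Section GraphProblems.
Variable G : ugraph.
Implicit Types (x y z v : 'I_(nv G)) (p c : seq 'I_(nv G)).

(* [x :: p] is a shortest path from [x] to [y]; its length is [size p]. *)
Definition shortest_path x y p : Prop :=
  [/\ path (@adj G) x p, last x p = y
    & forall p', path (@adj G) x p' -> last x p' = y -> size p <= size p'].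

Definition is_distance x y (o : option nat) : Prop :=
  if o is Some d then exists2 p, shortest_path x y p & size p = d
  else ~ exists2 p, path (@adj G) x p & last x p = y.

(* The predecessor of [y] on a shortest path from [x] to [y]; it is undefined
   when [x = y] or [y] is not reachable from [x]. *)
Definition is_last x y (o : option 'I_(nv G)) : Prop :=
  if o is Some z then
    exists2 p, shortest_path x y (rcons p y) & last x p = z
  else x = y \/ ~ exists2 p, path (@adj G) x p & last x p = y.

Definition cycle_through v c : Prop :=
  [/\ 2 < size c, uniq c, cycle (@adj G) c & v \in c].

Definition is_shortest_cycle_length v (o : option nat) : Prop :=
  if o is Some d then
    (exists2 c, cycle_through v c & size c = d) /\
    (forall c, cycle_through v c -> d <= size c)
  else ~ exists c, cycle_through v c.

End GraphProblems.

Definition ANSC : graph_problem := fun G out =>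
  exists L : 'I_(nv G) -> option nat,
    out = [seq code (L v) | v <- enum 'I_(nv G)] /\
    forall v, is_shortest_cycle_length v (L v).

(* The distance matrix followed by the matrix Last_G. *)
Definition APSP : graph_problem := fun G out =>
  exists (D : 'I_(nv G) -> 'I_(nv G) -> option nat)
         (Last : 'I_(nv G) -> 'I_(nv G) -> option 'I_(nv G)),
    [/\ out = rowmajor (fun x y => code (D x y)) ++
              rowmajor (fun x y => code (omap (@nat_of_ord _) (Last x y))),
        forall x y, is_distance x y (D x y)
      & forall x y, is_last x y (Last x y)].

(** * Time bounds *)

Local Open Scope ring_scope.

(* log n up to rounding, and at least 1. *)
Definition lg (n : nat) : nat := (trunc_log 2 n).+1.

Section Time.
Variable R : realType.

Definition polylog (C : R) (k n : nat) : R := C * (lg n)%:R ^+ k.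

(* Bounds on graphs are functions of m and n, in this order.  As m < n ^ 2 in
   a simple graph, polylogarithmic factors may be taken in n. *)
Definition solves_within (A : cmd) (P : graph_problem) (T : nat -> nat -> R) :
    Prop :=
  oracle_free A /\
  forall G s, encodes G s ->
    exists out t,
      [/\ runs A s out t, P G out & t%:R <= T (ne G) (nv G)].

Definition solves_Otilde (A : cmd) (P : graph_problem) (T : nat -> nat -> R) :
    Prop :=
  exists (C : R) (k : nat), solves_within A P (fun m n => polylog C k n * T m n).

Definition solvable_Otilde (P : graph_problem) (T : nat -> nat -> R) : Prop :=
  exists A, solves_Otilde A P T.

(* T(m', n') = O~(T(m, n)) whenever m' = O~(m) and n' = O~(n): the condition
   under which calls on graphs of size (O~(m), O~(n)) cost O~(T(m, n)). *)
Definition polylog_stable (T : nat -> nat -> R) : Prop :=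
  forall (C : R) (k : nat), exists (C' : R) (k' : nat),
  forall m n m' n' : nat,
    (0 < n)%N -> (0 < n')%N ->
    m'%:R <= polylog C k n * m%:R -> n'%:R <= polylog C k n * n%:R ->
    T m' n' <= polylog C' k' n * T m n.

(* A single oracle program M such that
   - with any correct oracle for Q, M solves P with O~(f) work of its own and
     polylogarithmically many queries on graphs with O~(n) vertices and O~(m)
     edges;
   - for any algorithm A that solves Q in time T, M with A as a subroutine
     solves P in time O~(T + f). *)
Definition sparse_reduces (f : nat -> nat -> R) (P Q : graph_problem) : Prop :=
  exists M : cmd,
    (exists (C : R) (k : nat), forall O : seq nat -> seq nat,
      (forall G s, encodes G s -> Q G (O s)) ->
      forall G s, encodes G s ->
      exists out t q,
        [/\ oracle_runs O M s out t q, P G out,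
            t%:R <= polylog C k (nv G) * f (ne G) (nv G),
            (size q)%:R <= polylog C k (nv G)
          & forall s', s' \in q -> exists H,
              [/\ encodes H s',
                  (nv H)%:R <= polylog C k (nv G) * (nv G)%:R
                & (ne H)%:R <= polylog C k (nv G) * (ne G)%:R]]) /\
    (forall (A : cmd) (T : nat -> nat -> R),
      polylog_stable T -> solves_within A Q T ->
      solves_Otilde (inline A M) P (fun m n => T m n + f m n)).

(** * Matrix multiplication *)

(* Integer matrices with entries in [0, n].  Larger polynomially bounded
   entries, and signs, only cost a constant number of such products. *)
Definition multiplies_within (A : cmd) (T : nat -> R) : Prop :=
  oracle_free A /\
  forall (n : nat) (X Y : 'M[nat]_n), (0 < n)%N ->
    (forall i j, X i j <= n)%N -> (forall i j, Y i j <= n)%N ->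
    exists t,
      runs A (n :: rowmajor X ++ rowmajor Y) (rowmajor (X *m Y)) t /\
      t%:R <= T n.

Local Open Scope classical_set_scope.

Definition mm_exponents : set R :=
  [set tau | exists A (C : R),
     multiplies_within A (fun n => C * n%:R `^ tau)].

Definition omega : R := inf mm_exponents.

Definition mm_Otilde (tau : R) : Prop :=
  exists A (C : R) (k : nat),
    multiplies_within A (fun n => polylog C k n * n%:R `^ tau).

End Time.

(* Main.v *)
(** ANSC. For a set [S] of vertices let [G_S] consist of a copy of [G] and of
   an independent set of vertices [z'], with [z'] adjacent to the copies of the
   neighbours of [z] in [S]: distances from [z'] in [G_S] are lengths of
   shortest walks from [z] whose first hop lies in [S]. For the [i]-th bit of
   the vertex names, let [D_0(z, u)] and [D_1(z, u)] be these lengths for the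
   vertices with [i]-th bit 0 and 1. Then the length of a shortest cycle through
   [z] is the minimum of [D_0(z, u) + D_1(z, u)] over all [i] and [u <> z] with
   [|D_0(z, u) - D_1(z, u)| <= 1]. Indeed two such walks have distinct first
   hops and are too short to come back to [z], so they close up in [G - z] to a
   cycle that is no longer. Conversely, choose a shortest path from [z] to every
   vertex; along a shortest cycle through [z] the first hop of the chosen path
   changes on some edge, whose end farther from [z] is a suitable [u], with [i]
   a bit in which the two hops differ. This takes O(log n) distance
   computations on graphs with 2n vertices and O(m) edges, and O(n^2 log n)
   further operations.

   Matrix multiplication. Distances in unweighted graphs are computed by
   Seidel's algorithm with O(log n) matrix products; unreachable pairs are coded
   by 0, which makes connectedness unnecessary. Writing the product of two
   all-ones matrices shows that any exponent is at least 2, so that the O(n^2)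
   overheads are harmless, and the infimum [omega] is approached from a nonempty
   set of exponents because of the schoolbook algorithm. *)

Require Import Defs.
From mathcomp Require Import all_boot all_order all_algebra.
From mathcomp Require Import boolp classical_sets reals exp.
From mathcomp Require Import sequences.
From mathcomp Require Import zify ring lra.

Set Implicit Arguments.
Unset Strict Implicit.
Unset Printing Implicit Defensive.

(** Both programs, the one for ANSC and Seidel's, are verified as oracle programs; algorithms enter
    only by substitution. Runs are deterministic, so a solver yields an oracle function together
    with a cost function, and inlining it adds up the costs of the queries actually made. The bound
    by matrix multiplication does this twice: a multiplier inside [seidel], and the result inside
    [ansc_prog]. The two sides meet in the problem [DIST], which asks for a distance matrix followed
    by an arbitrary short tail, so that both an APSP answer and the output of [seidel] are
    acceptable.

    The obstacle is that every operation is charged by bit length. It is met by a single invariant: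
    with [B = (n + 2) ^ 4], no array is longer than [B] and no entry exceeds [B]. One traversal of a
    fixed program text then costs O(log n), and a running time is bounded by counting loop rounds
    and transferred words alone. This is why the programs contain counted loops only. *)

(** * Determinism, inlining of an oracle, and the cost of producing output *)

Lemma exec_det O c m m1 t1 q1 : exec O c m m1 t1 q1 ->
  forall m2 t2 q2, exec O c m m2 t2 q2 -> [/\ m1 = m2, t1 = t2 & q1 = q2].
Proof.
elim=> {c m m1 t1 q1}; intros;
  match goal with H : exec _ _ _ _ _ _ |- [/\ _, _ & _] => inversion H; subst end => //;
  repeat match goal with
  | H : is_true (eval ?m ?e != 0), H' : eval ?m ?e = 0 |- _ => by rewrite H' in H
  | IH : (forall m2 t2 q2, exec _ ?c ?m m2 t2 q2 -> _), H : exec _ ?c ?m _ _ _ |- _ =>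
      case: (IH _ _ _ H) => ? ? ?; subst; clear H
  end => //.
Qed.

(** The answer and the cost of a program are thereby functions of its input, which is what turns a
    solver into an oracle. *)
Lemma runs_det c s o1 t1 o2 t2 :
  runs c s o1 t1 -> runs c s o2 t2 -> o1 = o2 /\ t1 = t2.
Proof.
move=> [m1 [E1 <-]] [m2 [E2 <-]].
by have [-> -> _] := exec_det E1 E2.
Qed.

(** [Query] and [Call] are charged the same copying cost, so replacing a query by a run of [A] adds
    exactly the time [tau] of that run. [A] has to agree with [O] only on the queries made, which
    lets [O] be arbitrary on sequences that encode nothing. *)
Lemma exec_inline A O tau c m m' t q :
  exec O c m m' t q -> (forall s, s \in q -> runs A s (O s) (tau s)) ->
  exec (fun=> [::]) (inline A c) m m' (t + \sum_(s <- q) tau s) [::].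
Proof.
elim=> {c m m' t q} /=.
- by move=> m _; rewrite big_nil addn0; constructor.
- by move=> m a i e _; rewrite big_nil addn0; constructor.
- move=> c1 c2 m1 m2 m3 t1 t2 q1 q2 _ IH1 _ IH2 Hq.
  rewrite big_cat /= addnACA.
  apply: (ExecSeq (q1 := [::]) (q2 := [::]) (IH1 _) (IH2 _)) => s Hs; apply: Hq;
    by rewrite mem_cat Hs ?orbT.
- by move=> e c1 c2 m1 m2 t q He _ IH Hq; rewrite -addnA; apply: ExecIfT He (IH Hq).
- by move=> e c1 c2 m1 m2 t q He _ IH Hq; rewrite -addnA; apply: ExecIfF He (IH Hq).
- by move=> e c m He _; rewrite big_nil addn0; apply: ExecWhileF.
- move=> e c m1 m2 m3 t1 t2 q1 q2 He _ IH1 _ IH2 Hq.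
  rewrite big_cat /= -[expr_cost _ _ + t1 + _]addnA -addnA [t1 + t2 + _]addnACA addnA.
  apply: (ExecWhileT (q1 := [::]) (q2 := [::]) He (IH1 _) (IH2 _)) => s Hs; apply: Hq;
    by rewrite mem_cat Hs ?orbT.
- by move=> p a b m m1 t q _ IH Hq; rewrite -addnA; apply: ExecCall (IH Hq).
- move=> a b m Hq; rewrite big_seq1.
  have [m1 [E <-]] := Hq _ (mem_head _ _).
  exact: ExecCall.
Qed.

Lemma oracle_free_inline A c : oracle_free A -> oracle_free (inline A c).
Proof.
by move=> HA; elim: c => //= [c1 -> c2 ->|e c1 -> c2 ->].
Qed.

Lemma oracle_runs_inline A O tau c s out t q :
  oracle_runs O c s out t q ->
  (forall s', s' \in q -> runs A s' (O s') (tau s')) ->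
  runs (inline A c) s out (t + \sum_(s' <- q) tau s').
Proof. by move=> [m [E Em]] Hq; exists m; split => //; apply: exec_inline E Hq. Qed.

Lemma expr_cost_gt0 m e : 0 < expr_cost m e.
Proof. by case: e => *; rewrite /= /bits addSn. Qed.

Lemma size_le_copy_cost s : size s <= copy_cost s.
Proof.
rewrite /copy_cost; elim: s => [|v s IH] //=; rewrite big_cons.
by move: IH; rewrite /bits; lia.
Qed.

(* Only [Call] and [Query] write many entries at once, and they pay for it:
   [set_nth] pads with zeros. *)
Lemma exec_count_nonzero O c m m' t q b : exec O c m m' t q ->
  count (predC1 0) (m' b) <= count (predC1 0) (m b) + t.
Proof.
move=> E; elim: E b => {c m m' t q} /=.
- by move=> m b; rewrite leq_addr.
- move=> m a i e b; rewrite /upd; case: eqP => [->|_]; last by rewrite leq_addr.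
  rewrite count_set_nth /= ?mul0n ?addn0 (leq_trans (leq_subr _ _)) // leq_add2l.
  by have := expr_cost_gt0 m e; case: (_ != _) => /=; lia.
- by move=> c1 c2 m1 m2 m3 t1 t2 q1 q2 _ IH1 _ IH2 b; move: (IH1 b) (IH2 b); lia.
- by move=> e c1 c2 m1 m2 t q _ _ IH b; move: (IH b); lia.
- by move=> e c1 c2 m1 m2 t q _ _ IH b; move: (IH b); lia.
- by move=> e c m _ b; rewrite leq_addr.
- by move=> e c m1 m2 m3 t1 t2 q1 q2 _ _ IH1 _ IH2 b; move: (IH1 b) (IH2 b); lia.
- move=> p a b' m m1 t q _ _ b; rewrite /upd; case: eqP => _; last by rewrite leq_addr.
  by apply: leq_trans (leq_trans (count_size _ _) (size_le_copy_cost _)) _; lia.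
- move=> a b' m b; rewrite /upd; case: eqP => _; last by rewrite leq_addr.
  by apply: leq_trans (leq_trans (count_size _ _) (size_le_copy_cost _)) _; lia.
Qed.

Lemma oracle_runs_count_nonzero O c s out t q :
  oracle_runs O c s out t q -> count (predC1 0) out <= t.
Proof. by move=> [m [E <-]]; have := exec_count_nonzero 1 E. Qed.

(** * A program logic with running times *)

Definition bnd B (m : Defs.mem) :=
  forall a, (size (m a) <= B) && all (fun v => v <= B) (m a).

Definition sv (m : Defs.mem) x := nth 0 (m x) 0.

Lemma updE m a s b : upd m a s b = if b == a then s else m b.
Proof. by []. Qed.

Lemma sv_set m x v : sv (upd m x (set_nth 0 (m x) 0 v)) x = v.
Proof. by rewrite /sv updE eqxx nth_set_nth. Qed.

Lemma bnd_size B m a : bnd B m -> size (m a) <= B.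
Proof. by move/(_ a)/andP=> []. Qed.

Lemma bnd_nth B m a i : bnd B m -> nth 0 (m a) i <= B.
Proof.
move/(_ a)/andP=> [_ /allP H]; case: (ltnP i (size (m a))) => Hi.
  by apply: H; apply: mem_nth.
by rewrite nth_default.
Qed.

Lemma bnd_upd B m a s :
  bnd B m -> size s <= B -> all (fun v => v <= B) s -> bnd B (upd m a s).
Proof. by move=> Hm H1 H2 b; rewrite /upd; case: eqP => // _; rewrite H1. Qed.

Lemma bnd_set B m a i v :
  bnd B m -> i < B -> v <= B -> bnd B (upd m a (set_nth 0 (m a) i v)).
Proof.
move=> Hm Hi Hv; apply: bnd_upd => //.
  by rewrite size_set_nth geq_max Hi (bnd_size a Hm).
apply/(all_nthP 0) => j _; rewrite nth_set_nth /=; case: eqP => // _.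
exact: bnd_nth.
Qed.

(** The measure is made for the bound [B ^ esz e] on values: a constant [c] weighs [c.+1] since
    [c < B ^ c], and an operation adds one so that a sum fits as well as a product, by
    [2 * B ^ s <= B ^ s.+1]. *)
Fixpoint esz (e : expr) : nat :=
  match e with
  | Const c => c.+1
  | Get _ e1 => (esz e1).+1
  | Len _ => 1
  | Bin _ e1 e2 => (esz e1 + esz e2).+1
  end.

(* [csz c] bounds the cost, in words, of one traversal of the text of [c]. *)
Fixpoint csz (c : cmd) : nat :=
  match c with
  | Skip => 1
  | Assign _ i e => esz i ^ 2 + esz e ^ 2
  | Seq c1 c2 => csz c1 + csz c2
  | If e c1 c2 => esz e ^ 2 + csz c1 + csz c2
  | While e c => esz e ^ 2 + csz c
  | Call p _ _ => csz p + 3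
  | Query _ _ => 1
  end.

Fixpoint mods (c : cmd) : seq nat :=
  match c with
  | Skip => [::]
  | Assign a _ _ => [:: a]
  | Seq c1 c2 => mods c1 ++ mods c2
  | If _ c1 c2 => mods c1 ++ mods c2
  | While _ c => mods c
  | Call _ _ b => [:: b]
  | Query _ b => [:: b]
  end.

Lemma esz_gt0 e : 0 < esz e. Proof. by case: e. Qed.

Lemma eval_bound B m e : 1 < B -> bnd B m -> eval m e <= B ^ esz e.
Proof.
move=> HB Hm; have HB0 : 0 < B by lia.
elim: e => [c|a e IH|a|o e1 IH1 e2 IH2] /=.
- exact: leq_trans (ltnW (ltn_expl c HB)) (leq_pexp2l HB0 (leqnSn c)).
- apply: leq_trans (bnd_nth a _ Hm) _; rewrite -{1}[B]expn1.
  exact: leq_pexp2l.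
- by rewrite expn1; exact: bnd_size.
- have := esz_gt0 e1; have := esz_gt0 e2 => H2 H1.
  set x := eval m e1 in IH1 *; set y := eval m e2 in IH2 *.
  have L1 : B ^ esz e1 <= B ^ (esz e1 + esz e2) by rewrite leq_pexp2l // leq_addr.
  have L2 : B ^ esz e2 <= B ^ (esz e1 + esz e2) by rewrite leq_pexp2l // leq_addl.
  have L3 : 2 * B ^ (esz e1 + esz e2) <= B ^ (esz e1 + esz e2).+1.
    by rewrite expnS leq_mul2r HB orbT.
  have L4 : 0 < B ^ (esz e1 + esz e2) by rewrite expn_gt0 HB0.
  have L5 := leq_mul IH1 IH2; rewrite -expnD in L5.
  have L6 := leq_div x y.
  have L7 : (x <= y : nat) <= 1 by case: (x <= y).
  by case: o => /=; lia.
Qed.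

Lemma bits_expn B s : 1 < B -> bits (B ^ s.+1) <= s.+1 * bits B.
Proof.
move=> HB; rewrite /bits.
have H : B ^ s.+1 < 2 ^ (s.+1 * (trunc_log 2 B).+1).
  by rewrite mulnC expnM ltn_exp2r // trunc_log_ltn.
rewrite -(ltn_exp2l _ _ (ltnSn 1)); apply: leq_ltn_trans H.
by apply: trunc_logP => //; rewrite expn_gt0; apply/orP; left; lia.
Qed.

Lemma leq_bits v w : v <= w -> bits v <= bits w.
Proof. by move=> H; rewrite /bits ltnS; apply: leq_trunc_log. Qed.

(** There are at most [esz e] subexpressions, and each has a value of at most [esz e * bits B] bits;
    hence the square. *)
Lemma expr_cost_bound B m e :
  1 < B -> bnd B m -> expr_cost m e <= esz e ^ 2 * bits B.
Proof.
move=> HB Hm.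
have Hb e1 : bits (eval m e1) <= esz e1 * bits B.
  apply: leq_trans (leq_bits (eval_bound e1 HB Hm)) _.
  by have := esz_gt0 e1; case: (esz e1) => // s _; apply: bits_expn.
elim: e => [c|a e IH|a|o e1 IH1 e2 IH2]; move: (Hb);
  [move/(_ (Const c))|move/(_ (Get a e))|move/(_ (Len a))|move/(_ (Bin o e1 e2))] => /=;
  nia.
Qed.

Lemma exec_frame O c m m' t q a :
  exec O c m m' t q -> a \notin mods c -> m' a = m a.
Proof.
move=> E; elim: E => {c m m' t q} //=.
- by move=> m b i e; rewrite inE /upd => /negPf ->.
- move=> c1 c2 m1 m2 m3 t1 t2 q1 q2 _ IH1 _ IH2.
  by rewrite mem_cat negb_or => /andP[/IH1 <- /IH2 ->].
- move=> e c1 c2 m1 m2 t q _ _ IH.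
  by rewrite mem_cat negb_or => /andP[/IH].
- move=> e c1 c2 m1 m2 t q _ _ IH.
  by rewrite mem_cat negb_or => /andP[_ /IH].
- by move=> e c m1 m2 m3 t1 t2 q1 q2 _ _ IH1 _ IH2 H; rewrite IH2 // IH1.
- by move=> p a' b m m1 t q _ _; rewrite inE /upd => /negPf ->.
- by move=> a' b m; rewrite inE /upd => /negPf ->.
Qed.

Lemma copy_cost_bound B s :
  all (fun v => v <= B) s -> copy_cost s <= size s * bits B + 1.
Proof.
rewrite /copy_cost addn1 ltnS; elim: s => [|v s IH] /=; first by rewrite big_nil.
by move=> /andP[/leq_bits Hv /IH {}IH]; rewrite big_cons mulSn leq_add.
Qed.

(* Derived commands and their proof rules *)
Declare Scope expr_scope.
Delimit Scope expr_scope with X.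
Declare Scope ram_scope.
Delimit Scope ram_scope with ram.
Bind Scope expr_scope with expr.
Bind Scope ram_scope with cmd.

Definition Var x := Get x (Const 0).
Definition SetV x (e : expr) := Assign x (Const 0) e.
Definition Push b (e : expr) := Assign b (Len b) e.
(* Running [Skip] is the only way to shorten an array; array 99 is kept empty
   to make the call cheap. *)
Definition Clear b := Call Skip 99 b.
Definition For x y (body : cmd) :=
  Seq (SetV x (Const 0))
      (While (Bin Leq (Bin Add (Var x) (Const 1)) (Var y))
             (Seq body (SetV x (Bin Add (Var x) (Const 1))))).
Definition Append b x y (e : expr) := For x y (Push b e).

Lemma evalE m : [/\ (forall x, eval m (Var x) = sv m x),
  (forall c, eval m (Const c) = c), (forall a, eval m (Len a) = size (m a)),
  (forall a e, eval m (Get a e) = nth 0 (m a) (eval m e))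
  & (forall o e1 e2, eval m (Bin o e1 e2) = eval_binop o (eval m e1) (eval m e2))].
Proof. by []. Qed.

Definition evE m := let: And5 H1 H2 H3 H4 H5 := evalE m in (H1, H2, H3, H4, H5).

Lemma svE m a s x : sv (upd m a s) x = if x == a then nth 0 s 0 else sv m x.
Proof. by rewrite /sv updE; case: eqP. Qed.

Lemma frame_in (m m1 : Defs.mem) (s s' : seq nat) : all (fun c => c \notin s) s' ->
  (forall a, a \notin s -> m1 a = m a) -> forall a, a \in s' -> m1 a = m a.
Proof. by move=> /allP Hs F a /Hs; apply: F. Qed.

Notation "c1 ;; c2" := (Seq c1 c2) (at level 70, right associativity) : ram_scope.
Notation "a ::= e" := (SetV a e%X) (at level 65) : ram_scope.
Notation "$ x" := (Var x) (at level 2, x at level 0, format "$ x") : expr_scope.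
Notation "# c" := (Const c) (at level 2, c at level 0, format "# c") : expr_scope.
Notation "a .[ e ]" := (Get a e%X) : expr_scope.
Notation "x + y" := (Bin Add x y) : expr_scope.
Notation "x - y" := (Bin Defs.Sub x y) : expr_scope.
Notation "x * y" := (Bin Mul x y) : expr_scope.
Notation "x / y" := (Bin Div x y) : expr_scope.
Notation "x <= y" := (Bin Leq x y) : expr_scope.


Lemma frame_sub (m m1 : Defs.mem) (s s' : seq nat) : all (mem s') s ->
  (forall a, a \notin s -> m1 a = m a) -> forall a, a \notin s' -> m1 a = m a.
Proof.
by move=> /allP Hs F a Ha; apply: F; apply: contra Ha => /Hs.
Qed.

Section Logic.
Variables (O : seq nat -> seq nat) (B : nat) (good : seq nat -> Prop).

(* From memory [m], [c] terminates in a memory satisfying [Q] after at most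
   [k] loop iterations and at most [r] queries, all of them [good]. A query
   also counts as as many iterations as there are words transferred. *)
Definition wp c m k r (Q : Defs.mem -> Prop) : Prop :=
  1 < B -> bnd B m -> exists m' t q,
  [/\ exec O c m m' t q, bnd B m' /\ t <= csz c * k.+1 * bits B,
      size q <= r, (forall s, s \in q -> good s) & Q m'].

Lemma wp_bnd c m k r Q : (1 < B -> bnd B m -> wp c m k r Q) -> wp c m k r Q.
Proof. by move=> H HB Hm; apply: H. Qed.

Lemma wp_conseq k' r' (Q' : Defs.mem -> Prop) c m k r (Q : Defs.mem -> Prop) :
  wp c m k' r' Q' -> k' <= k -> r' <= r ->
  (forall m', (forall a, a \notin mods c -> m' a = m a) -> Q' m' -> Q m') ->
  wp c m k r Q.
Proof.
move=> H Hk Hr HQ B_gt1 Hm; have [m' [t [q [E [Hb Ht] Hq Hg HQ']]]] := H B_gt1 Hm.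
exists m', t, q; split => //.
- split => //; apply: leq_trans Ht _.
  by rewrite leq_mul2r leq_mul2l ltnS Hk !orbT.
- exact: leq_trans Hq Hr.
- by apply: HQ => // a; apply: exec_frame E.
Qed.

Lemma wp_skip m Q : Q m -> wp Skip m 0 0 Q.
Proof.
move=> HQ B_gt1 Hm; exists m, 1, [::]; split => //; first exact: ExecSkip.
Qed.

Lemma wp_assign a i e m (Q : Defs.mem -> Prop) :
  eval m i < B -> eval m e <= B ->
  Q (upd m a (set_nth 0 (m a) (eval m i) (eval m e))) ->
  wp (Assign a i e) m 0 0 Q.
Proof.
move=> Hi He HQ B_gt1 Hm; do 3 eexists; split; [exact: ExecAssign|split|..] => //.
- exact: bnd_set.
- rewrite muln1 /= mulnDl.
  by apply: leq_add; apply: expr_cost_bound.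
Qed.

Lemma wp_seq k1 r1 k2 r2 c1 c2 m (Q : Defs.mem -> Prop) :
  wp c1 m k1 r1 (fun m1 => wp c2 m1 k2 r2 Q) ->
  wp (Seq c1 c2) m (k1 + k2) (r1 + r2) Q.
Proof.
move=> H B_gt1 Hm; have [m1 [t1 [q1 [E1 [Hb1 Ht1] Hq1 Hg1 H2]]]] := H B_gt1 Hm.
have [m2 [t2 [q2 [E2 [Hb2 Ht2] Hq2 Hg2 HQ]]]] := H2 B_gt1 Hb1.
exists m2, (t1 + t2), (q1 ++ q2); split => //.
- exact: ExecSeq E1 E2.
- split => //=; apply: leq_trans (leq_add Ht1 Ht2) _; rewrite -mulnDl leq_mul2r.
  by apply/orP; right; nia.
- by rewrite size_cat leq_add.
- by move=> s; rewrite mem_cat => /orP[/Hg1|/Hg2].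
Qed.

Lemma wp_seq0 k r c1 c2 m (Q : Defs.mem -> Prop) :
  wp c1 m 0 0 (fun m1 => wp c2 m1 k r Q) -> wp (Seq c1 c2) m k r Q.
Proof. exact: wp_seq. Qed.

Lemma wp_seq_noquery k1 k2 r c1 c2 m (Q : Defs.mem -> Prop) :
  wp c1 m k1 r (fun m1 => wp c2 m1 k2 0 Q) -> wp (Seq c1 c2) m (k1 + k2) r Q.
Proof. by rewrite -{2}[r]addn0; exact: wp_seq. Qed.

Lemma wp_seq_last k r c1 c2 m (Q : Defs.mem -> Prop) :
  wp c1 m k r (fun m1 => wp c2 m1 0 0 Q) -> wp (Seq c1 c2) m k r Q.
Proof. by rewrite -{2}[k]addn0 -{2}[r]addn0; exact: wp_seq. Qed.

Lemma wp_if e c1 c2 m k r Q :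
  (eval m e != 0 -> wp c1 m k r Q) -> (eval m e = 0 -> wp c2 m k r Q) ->
  wp (If e c1 c2) m k r Q.
Proof.
move=> H1 H2 B_gt1 Hm; have Hc := expr_cost_bound e B_gt1 Hm.
case: (eqVneq (eval m e) 0) => He.
- have [m' [t [q [E [Hb Ht] Hq Hg HQ]]]] := H2 He B_gt1 Hm.
  exists m', (expr_cost m e + t), q; split => //; first exact: ExecIfF.
  split => //=; apply: leq_trans (leq_add Hc Ht) _; rewrite -mulnDl leq_mul2r.
  by apply/orP; right; nia.
- have [m' [t [q [E [Hb Ht] Hq Hg HQ]]]] := H1 He B_gt1 Hm.
  exists m', (expr_cost m e + t), q; split => //; first exact: ExecIfT.
  split => //=; apply: leq_trans (leq_add Hc Ht) _; rewrite -mulnDl leq_mul2r.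
  by apply/orP; right; nia.
Qed.

Lemma wp_clear b m (Q : Defs.mem -> Prop) :
  m 99 = [::] -> Q (upd m b [::]) -> wp (Clear b) m 0 0 Q.
Proof.
move=> H99 HQ B_gt1 Hm; do 3 eexists; split; [exact: ExecCall (ExecSkip _ _)|split|..] => //=.
- exact: bnd_upd.
- by rewrite H99 /load /upd /copy_cost big_nil /bits; lia.
Qed.

Lemma wp_query a b m (Q : Defs.mem -> Prop) :
  good (m a) -> size (O (m a)) <= B -> all (fun v => v <= B) (O (m a)) ->
  Q (upd m b (O (m a))) ->
  wp (Query a b) m (size (m a) + size (O (m a)) + 1) 1 Q.
Proof.
move=> Hg Hs Ha HQ B_gt1 Hm; do 3 eexists; split; [exact: ExecQuery|split|..] => //=.
- exact: bnd_upd.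
(* Each [copy_cost] is at most the number of words times [bits B], plus one. The two extra units are
   paid by the [+ 1] in the iteration count and by the successor in the time bound of [wp]. *)
- have /andP[_ Hma] := Hm a.
  have := copy_cost_bound Ha; have := copy_cost_bound Hma.
  by have : 0 < bits B by []; nia.
- by move=> s; rewrite inE => /eqP ->.
Qed.

Lemma wp_setv x e m (Q : Defs.mem -> Prop) :
  eval m e <= B -> Q (upd m x (set_nth 0 (m x) 0 (eval m e))) ->
  wp (SetV x e) m 0 0 Q.
Proof.
by move=> He HQ; apply: wp_bnd => B_gt1 _; apply: wp_assign => //=; exact: ltnW.
Qed.

Lemma wp_while x y body k r (I : nat -> Defs.mem -> Prop) n :
  x \notin mods body -> y \notin x :: mods body ->
  forall d i m, i + d = n -> sv m x = i -> sv m y = n -> I i m ->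
  (forall i m1, i < n -> sv m1 x = i ->
     (forall a, a \notin x :: mods body -> m1 a = m a) -> I i m1 ->
     wp body m1 k r (fun m2 => I i.+1 (upd m2 x (set_nth 0 (m2 x) 0 i.+1)))) ->
  wp (While (Bin Leq (Bin Add (Var x) (Const 1)) (Var y))
            (Seq body (SetV x (Bin Add (Var x) (Const 1)))))
     m (d * k.+1) (d * r) (I n).
Proof.
move=> Hx Hy; elim=> [|d IH] i m Hd Hxm Hym HI Hbody B_gt1 Hm.
- rewrite addn0 in Hd; rewrite Hd in Hxm HI.
  have E0 : eval m (Bin Leq (Bin Add (Var x) (Const 1)) (Var y)) = 0.
    by rewrite /= -/(sv m x) -/(sv m y) Hxm Hym addn1 ltnn.
  do 3 eexists; split; [exact: ExecWhileF|split|..] => //.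
  have Hc := expr_cost_bound (Bin Leq (Bin Add (Var x) (Const 1)) (Var y)) B_gt1 Hm.
  rewrite mul0n muln1; apply: leq_trans Hc _.
  by rewrite leq_mul2r leq_addr orbT.
- have Hin : i < n by lia.
  have E0 : eval m (Bin Leq (Bin Add (Var x) (Const 1)) (Var y)) != 0.
    by rewrite /= -/(sv m x) -/(sv m y) Hxm Hym addn1 Hin.
  have Hc := expr_cost_bound (Bin Leq (Bin Add (Var x) (Const 1)) (Var y)) B_gt1 Hm.
  have HnB : n <= B by rewrite -Hym; apply: bnd_nth.
  set c := Seq body _ in Hc *.
  have Hwp : wp c m k r (fun m2 => [/\ sv m2 x = i.+1,
      (forall a, a \notin x :: mods body -> m2 a = m a) & I i.+1 m2]).
    rewrite -[k]addn0 -[r]addn0; apply: wp_seq.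
    apply: (wp_conseq (Hbody _ _ Hin Hxm (fun _ _ => erefl) HI)) => // m2 Fr HI2.
    have Hx2 : sv m2 x = i by rewrite /sv Fr.
    apply: wp_assign; rewrite /= -?/(sv m2 x) ?Hx2 ?addn1; [lia|lia|].
    split => //.
      exact: sv_set.
    move=> a; rewrite inE negb_or => /andP[Ha Hb].
    by rewrite updE (negPf Ha) Fr.
  have [m1 [t1 [q1 [E1 [Hb1 Ht1] Hq1 Hg1 [Hx1 Fr1 HI1]]]]] := Hwp B_gt1 Hm.
  have Hrest :
    wp (While (Bin Leq (Bin Add (Var x) (Const 1)) (Var y)) c)
      m1 (d * k.+1) (d * r) (I n).
    apply: (IH i.+1) => //.
    - lia.
    - by rewrite /sv Fr1.
    - move=> j m2 Hj Hxj Frj HIj; apply: Hbody => // a Ha.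
      by rewrite Frj // Fr1.
  have [m2 [t2 [q2 [E2 [Hb2 Ht2] Hq2 Hg2 HI2]]]] := Hrest B_gt1 Hb1.
  exists m2, (expr_cost m (Bin Leq (Bin Add (Var x) (Const 1)) (Var y)) + t1 + t2), (q1 ++ q2).
  split => //.
  + exact: ExecWhileT E0 E1 E2.
  + split => //; move: Hc Ht1 Ht2; set e := Bin Leq _ _.
    have -> : csz (While e c) = esz e ^ 2 + csz c by [].
    move: (esz _ ^ 2) (csz c) (bits B) (expr_cost _ _) => se sc b ec Hc Ht1 Ht2.
    apply: leq_trans (leq_add (leq_add Hc Ht1) Ht2) _.
    rewrite -!mulnDl leq_mul2r; apply/orP; right.
    rewrite mulSn; move: (d * k.+1) => w; nia.
  + by rewrite size_cat mulSn leq_add.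
  + by move=> s; rewrite mem_cat => /orP[/Hg1|/Hg2].
Qed.

Lemma wp_for (I : nat -> Defs.mem -> Prop) n k r K R x y body m (Q : Defs.mem -> Prop) :
  n * k.+1 <= K -> n * r <= R ->
  x \notin mods body -> y \notin x :: mods body -> sv m y = n ->
  I 0 (upd m x (set_nth 0 (m x) 0 0)) ->
  (forall i m1, i < n -> sv m1 x = i ->
     (forall a, a \notin x :: mods body -> m1 a = m a) -> I i m1 ->
     wp body m1 k r (fun m2 => I i.+1 (upd m2 x (set_nth 0 (m2 x) 0 i.+1)))) ->
  (forall m1, (forall a, a \notin x :: mods body -> m1 a = m a) -> I n m1 -> Q m1) ->
  wp (For x y body) m K R Q.
Proof.
move=> HK HR Hx Hy Hn HI0 Hbody HQ.
apply: (@wp_conseq (n * k.+1) (n * r) (I n)) => //; last first.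
  move=> m1 Fr; apply: HQ => a; rewrite inE negb_or => /andP[H1 H2].
  by apply: Fr; rewrite /= inE mem_cat /= inE !negb_or H1 H2.
apply: wp_seq0; apply: wp_setv => //=.
have Hyx : y != x by move: Hy; rewrite inE negb_or => /andP[].
have HU a : a \notin x :: mods body -> upd m x (set_nth 0 (m x) 0 0) a = m a.
  by rewrite inE negb_or updE => /andP[/negPf -> _].
apply: (@wp_while x y body k r I n Hx Hy n 0) => //.
- exact: sv_set.
- by rewrite /sv HU.
- move=> i m1 Hi Hxi Fr HI; apply: Hbody => // a Ha.
  by rewrite Fr // HU.
Qed.

Lemma wp_push b e m (Q : Defs.mem -> Prop) :
  size (m b) < B -> eval m e <= B -> Q (upd m b (rcons (m b) (eval m e))) ->
  wp (Push b e) m 0 0 Q.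
Proof.
move=> Hs He HQ; apply: wp_assign => //=.
by rewrite set_nthE ltnn subnn /= cats1.
Qed.

(** The expression may read the array that is being extended, which is why its evaluation is allowed
    to depend on the part of [b] written so far. *)
Lemma wp_append n f b x y e m (Q : Defs.mem -> Prop) :
  uniq [:: b; x; y] -> sv m y = n -> size (m b) + n <= B ->
  (forall i m1, i < n -> (forall a, a != x -> a != b -> m1 a = m a) ->
     sv m1 x = i -> m1 b = m b ++ mkseq f i -> eval m1 e = f i /\ f i <= B) ->
  (forall m1, (forall a, a != x -> a != b -> m1 a = m a) ->
     m1 b = m b ++ mkseq f n -> Q m1) ->
  wp (Append b x y e) m n 0 Q.
Proof.
rewrite /= !inE !negb_or andbT => /andP[/andP[Hbx Hby] Hxy] Hn Hs Hf HQ.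
apply: (@wp_for (fun i m' => m' b = m b ++ mkseq f i) n 0 0) => //=.
- by rewrite muln1.
- by rewrite muln0.
- by rewrite inE eq_sym.
- by rewrite !inE !negb_or eq_sym Hxy eq_sym Hby.
- by rewrite updE (negPf Hbx) cats0.
- move=> i m1 Hi Hxi Fr HI.
  have Fr' a : a != x -> a != b -> m1 a = m a.
    by move=> H1 H2; apply: Fr; rewrite !inE negb_or H1.
  have [He Hfi] := Hf _ _ Hi Fr' Hxi HI.
  apply: wp_push; rewrite ?He //.
    by rewrite HI size_cat size_mkseq; lia.
  by rewrite !updE (negPf Hbx) eqxx HI -cats1 -catA cats1 /mkseq -map_rcons -cats1 -[in RHS]addn1 iotaD.
- move=> m1 Fr HI; apply: HQ => // a H1 H2.
  by apply: Fr; rewrite !inE negb_or H1.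
Qed.

End Logic.

#[global] Arguments eval : simpl never.
#[global] Arguments upd : simpl never.
#[global] Arguments set_nth : simpl never.

(** * Edge lists *)

Lemma uniq_map_inj (T U : eqType) (f : T -> U) (s : seq T) :
  uniq (map f s) -> {in s &, injective f}.
Proof.
elim: s => [|x s IH] //= /andP[Hx /IH {}IH] y w.
rewrite !inE => /orP[/eqP->|Hy] /orP[/eqP->|Hw] // E.
- by rewrite E map_f in Hx.
- by rewrite -E map_f in Hx.
- exact: IH.
Qed.

(** Turning every listed pair into increasing order maps the list onto the set counted by [ne G].
    Equal sizes therefore mean that this map is injective on a list without repetitions, that is, no
    edge is listed again in either orientation. *)
Lemma size_edge_list (G : ugraph) (es : seq ('I_(nv G) * 'I_(nv G))) :
  (forall u v, adj u v = ((u, v) \in es) || ((v, u) \in es)) ->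
  size es = ne G <-> uniq es /\ forall u v, (u, v) \in es -> (v, u) \notin es.
Proof.
move=> Hadj.
pose norm (p : 'I_(nv G) * 'I_(nv G)) := if p.1 < p.2 then p else (p.2, p.1).
have irr u v : (u, v) \in es -> u != v.
  by move=> Huv; apply/eqP => E; have := Hadj u v; rewrite Huv E adj_irr.
have normE u v : norm (u, v) = if u < v then (u, v) else (v, u) by [].
have Hmem : enum [set p : 'I_(nv G) * 'I_(nv G) | (p.1 < p.2) && adj p.1 p.2]
    =i map norm es.
  move=> [u v]; rewrite mem_enum inE /=; apply/idP/idP.
  - rewrite Hadj => /andP[Huv /orP[] H]; apply/mapP; eexists; eauto.
      by rewrite normE Huv.
    by rewrite normE ltnNge ltnW.
  - move=> /mapP[[a b] Hab]; rewrite normE; have := irr _ _ Hab => ab.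
    have Aab : adj a b by rewrite Hadj Hab.
    case: ltnP => H [-> ->]; first by rewrite H Aab.
    by rewrite adj_sym Aab andbT ltn_neqAle H andbT eq_sym.
have Hu : uniq (map norm es) = (size es == ne G).
  by rewrite (uniq_size_uniq (enum_uniq _) Hmem) size_map -cardE.
split.
- move/eqP; rewrite -Hu => Hn; split; first exact: map_uniq Hn.
  move=> u v Huv; apply/negP => Hvu; have := irr _ _ Huv.
  suff [->] : (u, v) = (v, u) by rewrite eqxx.
  apply: (uniq_map_inj Hn) => //; rewrite !normE.
  by case: (ltngtP u v) => // /val_inj ->.
- move=> [He Hanti]; apply/eqP; rewrite -Hu map_inj_in_uniq //.
  move=> [u v] [a b] Huv Hab; rewrite !normE.
  case: ltnP => _; case: ltnP => _ [E1 E2]; subst => //.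
  + by have := Hanti _ _ Huv; rewrite Hab.
  + by have := Hanti _ _ Huv; rewrite Hab.
Qed.

(** * The two-layer graph *)

Section TwoLayers.
Variables (G : ugraph) (S : pred 'I_(nv G)).
Notation n := (nv G).

(* The right copy carries [G]; the left copy of [z] is adjacent to the right
   copies of the neighbours of [z] in [S], so that paths from it are walks of
   [G] from [z] whose first hop is in [S]. *)
Definition layer_adj : rel 'I_(n + n) := fun x y =>
  match split x, split y with
  | inl _, inl _ => false
  | inl z, inr a => adj z a && S a
  | inr a, inl z => adj z a && S a
  | inr a, inr b => adj a b
  end.

Lemma layer_adj_sym : symmetric layer_adj.
Proof.
by move=> x y; rewrite /layer_adj; case: (split x) => a; case: (split y) => b //; rewrite adj_sym.
Qed.

Lemma layer_adj_irr : irreflexive layer_adj.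
Proof. by move=> x; rewrite /layer_adj; case: (split x) => a //; rewrite adj_irr. Qed.

Lemma layer_nv_gt0 : 0 < n + n. Proof. by rewrite addn_gt0 nv_gt0. Qed.

Definition layers : ugraph := UGraph layer_nv_gt0 layer_adj_sym layer_adj_irr.

Lemma split_lshift (z : 'I_n) : split (lshift n z) = inl z.
Proof. exact: (unsplitK (inl z)). Qed.

Lemma split_rshift (z : 'I_n) : split (rshift n z) = inr z.
Proof. exact: (unsplitK (inr z)). Qed.

Lemma ord_layerP (x : 'I_(n + n)) :
  (exists z, x = lshift n z) \/ (exists z, x = rshift n z).
Proof.
by rewrite -[x]splitK; case: (split x) => z; [left|right]; exists z.
Qed.

Lemma layer_adj_lr z a : layer_adj (lshift n z) (rshift n a) = adj z a && S a.
Proof. by rewrite /layer_adj split_lshift split_rshift. Qed.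

Lemma layer_adj_ll z a : layer_adj (lshift n z) (lshift n a) = false.
Proof. by rewrite /layer_adj !split_lshift. Qed.

Lemma layer_adj_rr z a : layer_adj (rshift n z) (rshift n a) = adj z a.
Proof. by rewrite /layer_adj !split_rshift. Qed.

(** The second end always lies in the right copy, so an edge between the copies has a single
    orientation in the list. The order is the one in which [build_query] writes the edges. *)
Definition layer_edges_of (p : 'I_n * 'I_n) : seq ('I_(n + n) * 'I_(n + n)) :=
  (rshift n p.1, rshift n p.2)
    :: (if S p.2 then [:: (lshift n p.1, rshift n p.2)] else [::])
    ++ (if S p.1 then [:: (lshift n p.2, rshift n p.1)] else [::]).

Definition layer_edges es := flatten (map layer_edges_of es).

Lemma mem_layer_edges_of x y p : (x, y) \in layer_edges_of p ->
  exists u v, [/\ y = rshift n v, p = (u, v) \/ p = (v, u) &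
    (x = rshift n u /\ p = (u, v)) \/ (x = lshift n u /\ S v)].
Proof.
case: p => u v; rewrite inE mem_cat => /or3P[/eqP[-> ->]||].
- by exists u, v; split; auto.
- by case: ifP => //= Sv; rewrite inE => /eqP[-> ->]; exists u, v; split; auto.
- by case: ifP => //= Su; rewrite inE => /eqP[-> ->]; exists v, u; split; auto.
Qed.

Lemma layer_edges_adj es :
  (forall u v, adj u v = ((u, v) \in es) || ((v, u) \in es)) ->
  forall x y, layer_adj x y =
    ((x, y) \in layer_edges es) || ((y, x) \in layer_edges es).
Proof.
move=> Hadj.
have sub x y : (x, y) \in layer_edges es -> layer_adj x y.
  move=> /flatten_mapP[p Hp] /mem_layer_edges_of[u [v [-> Ep Ex]]].
  have Auv : adj u v by rewrite Hadj; case: Ep => <-; rewrite Hp ?orbT.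
  by case: Ex => [[-> _]|[-> Sv]]; rewrite ?layer_adj_rr // layer_adj_lr Auv Sv.
have rr a b : (a, b) \in es -> (rshift n a, rshift n b) \in layer_edges es.
  by move=> H; apply/flatten_mapP; exists (a, b) => //; rewrite mem_head.
have lr a b : adj a b -> S b -> (lshift n a, rshift n b) \in layer_edges es.
  rewrite Hadj => /orP[] H Sb; apply/flatten_mapP.
    by exists (a, b) => //; rewrite inE mem_cat /= Sb inE eqxx orbT.
  by exists (b, a) => //; rewrite inE !mem_cat /= Sb inE eqxx !orbT.
move=> x y; apply/idP/idP; last by case/orP => /sub //; rewrite layer_adj_sym.
have [[a ->]|[a ->]] := ord_layerP x; have [[b ->]|[b ->]] := ord_layerP y;
  rewrite ?layer_adj_ll ?layer_adj_lr ?layer_adj_rr //.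
- by move=> /andP[Aab Sb]; rewrite lr.
- by rewrite layer_adj_sym layer_adj_lr => /andP[Aab Sb]; rewrite lr ?orbT.
- by rewrite Hadj => /orP[] /rr -> ; rewrite ?orbT.
Qed.

(** A layered edge determines the unordered edge of [G] below it, and [es] lists that edge in one
    orientation only; so distinct entries of [es] contribute disjoint lists. *)
Lemma layer_edges_uniq es :
  uniq es -> (forall u v, (u, v) \in es -> (v, u) \notin es) ->
  uniq (layer_edges es).
Proof.
move=> Hu Hanti.
have self u : (u, u) \notin es by apply/negP => H; move: (Hanti _ _ H); rewrite H.
have inj p q z : p \in es -> q \in es ->
    z \in layer_edges_of p -> z \in layer_edges_of q -> p = q.
  case: z => x y Hp Hq /mem_layer_edges_of[u [v [-> Ep Ex]]].
  move=> /mem_layer_edges_of[u' [v' [/rshift_inj Ev Ep' Ex']]]; subst v'.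
  have Eu : u' = u.
    case: Ex Ex' => [[-> _]|[-> _]] [[E _]|[E _]].
    - by move/rshift_inj: E.
    - by have := eq_rlshift u u'; rewrite E eqxx.
    - by have := eq_lrshift u u'; rewrite E eqxx.
    - by move/lshift_inj: E.
  subst u'; case: Ep Ep' => -> [] -> // in Hp Hq *.
    by have := Hanti _ _ Hp; rewrite Hq.
  by have := Hanti _ _ Hp; rewrite Hq.
have uof p : p \in es -> uniq (layer_edges_of p).
  case: p => u v Hp.
  have uv : (v == u) = false by apply/negP => /eqP E; rewrite E (negPf (self u)) in Hp.
  rewrite /layer_edges_of /=; case: (S v); case: (S u) => //=;
    by rewrite !inE !xpair_eqE ?eq_rlshift /= ?(inj_eq (@rshift_inj _ _)) ?uv ?andbF.
rewrite /layer_edges; elim: es Hu {Hanti self} inj uof => [|p es IH] // /andP[Hp Hu] inj uof.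
have -> : flatten (map layer_edges_of (p :: es)) =
  layer_edges_of p ++ flatten (map layer_edges_of es) by [].
rewrite cat_uniq (uof _ (mem_head _ _)) IH //; first last.
- by move=> q Hq; apply: uof; rewrite inE Hq orbT.
- by move=> q r z Hq Hr; apply: inj; rewrite inE ?Hq ?Hr orbT.
rewrite andbT; apply/hasPn => z /flatten_mapP[q Hq Hz]; apply/negP => Hz'.
have E : p = q by apply: inj Hz' Hz; rewrite inE ?eqxx ?Hq ?orbT.
by rewrite E Hq in Hp.
Qed.

Lemma size_layer_edges es :
  (forall u v, adj u v = ((u, v) \in es) || ((v, u) \in es)) ->
  size es = ne G -> size (layer_edges es) = ne layers.
Proof.
move=> Hadj /(size_edge_list Hadj)[Hu Hanti].
apply/(@size_edge_list layers _ (layer_edges_adj Hadj)); split.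
  exact: layer_edges_uniq.
move=> x y /flatten_mapP[p Hp] /mem_layer_edges_of[u [v [-> Ep Ex]]].
apply/negP => /flatten_mapP[q Hq] /mem_layer_edges_of[u' [v' [E Ep' Ex']]]; subst x.
case: Ex => [[/rshift_inj Eu Ep1]|[E _]]; last first.
  by have := eq_rlshift v' u; rewrite E eqxx.
subst; case: Ex' => [[/rshift_inj E Eq]|[E _]].
  by subst; have := Hanti _ _ Hp; rewrite Hq.
by have := eq_rlshift v u'; rewrite E eqxx.
Qed.

Lemma size_layer_edges_le es : size (layer_edges es) <= 3 * size es.
Proof.
rewrite /layer_edges; elim: es => [|p es IH] //=.
rewrite !size_cat; case: (S p.2); case: (S p.1) => /=; lia.
Qed.

(** * First hops *)

(** The walk [p] may come back to [z]; this is excluded later, by its length. *)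
Definition hop z u l := exists a p,
  [/\ adj z a, S a, path (@adj G) a p, last a p = u & l = (size p).+1].

Definition unlayer (x : 'I_(n + n)) : 'I_n :=
  match split x with inl z => z | inr z => z end.

Lemma unlayer_rshift z : unlayer (rshift n z) = z.
Proof. by rewrite /unlayer split_rshift. Qed.

Lemma path_layer_unlayer x p :
  path layer_adj x p -> path (@adj G) (unlayer x) (map unlayer p).
Proof.
rewrite path_map; apply: sub_path => a b; rewrite /layer_adj /unlayer /=.
case: (split a) => y; case: (split b) => z //; first by case/andP.
by rewrite adj_sym => /andP[].
Qed.

Lemma path_layer_rshift a p :
  path layer_adj (rshift n a) (map (@rshift n n) p) = path (@adj G) a p.
Proof. by rewrite path_map; apply: eq_path => x y; exact: layer_adj_rr. Qed.

(** A path of [layers] may return to the left copy. [unlayer] still projects it to a walk of [G] of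
    the same length, and its first hop is in [S] because the left copies have no other
    neighbours. *)
Lemma hop_path z u l : hop z u l <-> exists p,
  [/\ path layer_adj (lshift n z) p, last (lshift n z) p = rshift n u & size p = l].
Proof.
split.
- move=> [a [p [za Sa Hp Hl ->]]]; exists (rshift n a :: map (@rshift n n) p).
  by rewrite /= layer_adj_lr za Sa path_layer_rshift last_map Hl size_map.
- move=> [[|x p] /= [Hp Hl <-]]; first by have := eq_lrshift z u; rewrite Hl eqxx.
  have [[b E]|[a E]] := ord_layerP x; subst x; move: Hp.
    by rewrite layer_adj_ll.
  rewrite layer_adj_lr => /andP[/andP[za Sa] /path_layer_unlayer].
  rewrite unlayer_rshift => Hp; exists a, (map unlayer p); split => //.
    by rewrite -[X in last X _]unlayer_rshift last_map Hl unlayer_rshift.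
  by rewrite size_map.
Qed.

Lemma hop_distance z u o :
  @is_distance layers (lshift n z) (rshift n u) o ->
  if o is Some d then hop z u d /\ forall l, hop z u l -> d <= l
  else forall l, ~ hop z u l.
Proof.
case: o => [d|] /=.
- move=> [p [Hp Hl Hmin] <-]; split; first by apply/hop_path; exists p.
  by move=> l /hop_path[p' [Hp' Hl' <-]]; apply: Hmin.
- by move=> H l /hop_path[p [Hp Hl _]]; apply: H; exists p.
Qed.

End TwoLayers.

(** * Shortest cycles through a vertex *)

Lemma odd_div_expn2_neq L a b : a < 2 ^ L -> b < 2 ^ L -> a != b ->
  exists2 i, i < L & odd (a %/ 2 ^ i) != odd (b %/ 2 ^ i).
Proof.
elim: L a b => [|L IH] a b; first by rewrite expn0; case: a b => [|a] [|b].
rewrite expnS => Ha Hb ab; case: (eqVneq (odd a) (odd b)) => [E|E]; last first.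
  by exists 0; rewrite // expn0 !divn1.
have Ea := divn_eq a 2; have Eb := divn_eq b 2.
rewrite !modn2 in Ea Eb.
have [|||i Hi Hodd] := IH (a %/ 2) (b %/ 2); first by rewrite ltn_divLR // mulnC.
- by rewrite ltn_divLR // mulnC.
- by apply: contra ab => /eqP E2; rewrite Ea Eb E2 E.
- by exists i.+1; rewrite // expnS !divnMA.
Qed.

Section Cycles.
Variable G : ugraph.
Notation n := (nv G).
Implicit Types (z u v w a b : 'I_n) (p q c : seq 'I_n).

Lemma path_adj_rev x p : path (@adj G) x p ->
  path (@adj G) (last x p) (rev (belast x p)) /\
  last (last x p) (rev (belast x p)) = x.
Proof.
move=> Hp; split.
  rewrite rev_path (eq_path (e' := @adj G)) // => y y'; exact: adj_sym.
by case: p {Hp} => [|y p] //=; rewrite rev_cons last_rcons.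
Qed.

(** Coming back to [z] wastes at least two steps, whereas the walk from [z] through [a :: p] exceeds
    the lower bound [k] on the distance by at most one: the part after the return would be a walk
    from [z] to [u] shorter than [k]. *)
Lemma hop_avoid z u k a p : u != z ->
  (forall q, path (@adj G) z q -> last z q = u -> k <= size q) ->
  adj z a -> path (@adj G) a p -> last a p = u -> size p <= k ->
  z \notin a :: p.
Proof.
move=> Huz Hk za Hp Hl Hs; rewrite inE negb_or; apply/andP; split.
  by apply/negP => /eqP E; rewrite E adj_irr in za.
apply/negP => Hz; case/splitPr: Hz Hp Hl Hs => p1 p2.
rewrite cat_path /= last_cat /= size_cat /= => /and3P[_ _ Hp2] Hl Hs.
by have := Hk _ Hp2 Hl; lia.
Qed.

(** The two walks joined at [u] lead from [a] to [b] without meeting [z]. Shortening them to a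
    simple path and adding [z] gives a cycle; [a != b] makes it have at least three vertices. *)
Lemma glue_cycle z u a b p q : a != b -> adj z a -> adj z b ->
  path (@adj G) a p -> path (@adj G) b q -> last a p = u -> last b q = u ->
  z \notin a :: p -> z \notin b :: q ->
  exists2 c, cycle_through z c & size c <= size p + size q + 2.
Proof.
move=> ab za zb Hp Hq lp lq zp zq.
have [Hr lr] := path_adj_rev Hq; rewrite lq in Hr lr.
pose r := p ++ rev (belast b q).
have Hpr : path (@adj G) a r by rewrite cat_path Hp lp.
have lr' : last a r = b by rewrite last_cat lp.
have zr : z \notin a :: r.
  rewrite -cat_cons mem_cat (negPf zp) mem_rev /=.
  by apply: contra zq => /mem_belast.
have sr : size r = size p + size q by rewrite size_cat size_rev size_belast.
case/shortenP: Hpr lr' => r' Hr' Ur' Sr' lr'.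
exists (z :: a :: r'); last first.
  rewrite /= -sr addn2 !ltnS; apply: uniq_leq_size => //.
  by case/andP: Ur'.
have zr' : z \notin a :: r'.
  apply: contra zr; rewrite !inE => /orP[->//|/Sr' ->]; exact: orbT.
split.
- by case: r' lr' {Hr' Ur' Sr' zr'} => [/= E|//]; rewrite E eqxx in ab.
- by rewrite cons_uniq zr' Ur'.
- by rewrite /= rcons_path za Hr' lr' adj_sym zb.
- exact: mem_head.
Qed.

(** Every first hop lies in [S] or in its complement, so no walk from [z] to [u] is shorter than
    [minn d0 d1]. Lengths differing by at most one are then short enough for [hop_avoid] on both
    sides. *)
Lemma cycle_of_hops (S : pred 'I_n) z u d0 d1 : u != z ->
  hop S z u d0 -> (forall l, hop S z u l -> d0 <= l) ->
  hop (predC S) z u d1 -> (forall l, hop (predC S) z u l -> d1 <= l) ->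
  d0 <= d1.+1 -> d1 <= d0.+1 ->
  exists2 c, cycle_through z c & size c <= d0 + d1.
Proof.
move=> uz [a [p [za Sa Hp lp E0]]] M0 [b [q [zb Sb Hq lq E1]]] M1 L0 L1.
have Hk r : path (@adj G) z r -> last z r = u -> minn d0 d1 <= size r.
  case: r => [/= _ E|x r /= /andP[zx Hr] lr]; first by rewrite E eqxx in uz.
  case Sx: (S x).
    by rewrite geq_min M0 //; exists x, r.
  have CSx : predC S x by rewrite /= Sx.
  by rewrite geq_min (M1 (size r).+1) ?orbT //; exists x, r.
have ab : a != b by apply/negP => /eqP E; rewrite /= -E Sa in Sb.
have zp : z \notin a :: p by apply: (hop_avoid uz Hk za Hp lp); clear -E0 E1 L0 L1; lia.
have zq : z \notin b :: q by apply: (hop_avoid uz Hk zb Hq lq); clear -E0 E1 L0 L1; lia.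
have [c Hc Hs] := glue_cycle ab za zb Hp Hq lp lq zp zq.
by exists c => //; move: Hs; rewrite E0 E1; clear; lia.
Qed.

Lemma shortest_hop z w : w != z -> (exists2 p, path (@adj G) z p & last z p = w) ->
  exists a d, hop (pred1 a) z w d /\
    forall q, path (@adj G) z q -> last z q = w -> d <= size q.
Proof.
move=> wz [p Hp lp].
have [m] := ubnP (size p); elim: m p Hp lp => // m IH p Hp lp Hs.
case: (pselect (exists q, [/\ path (@adj G) z q, last z q = w & size q < size p])).
  by move=> [q [Hq lq Hs']]; apply: IH Hq lq _; lia.
move=> Hmin; case: p Hp lp Hs Hmin => [/= _ E|a p]; first by rewrite E eqxx in wz.
move=> /= /andP[za Hp] lp _ Hmin; exists a, (size p).+1; split.
  by exists a, p; split => //=.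
move=> q Hq lq; rewrite leqNgt; apply/negP => Hlt; apply: Hmin.
by exists q.
Qed.

Lemma path_change (T : Type) (U : eqType) (e : rel T) (f : T -> U) (x : T) (r : seq T) :
  path e x r -> f x != f (last x r) ->
  exists (s1 : seq T) (y1 y2 : T) (s2 : seq T),
    [/\ x :: r = s1 ++ y1 :: y2 :: s2, e y1 y2 & f y1 != f y2].
Proof.
elim: r x => [|b r IH] a /=; first by rewrite eqxx.
move=> /andP[ab Hr] Hne; case: (eqVneq (f a) (f b)) => [E|E].
  rewrite E in Hne; have [s1 [v [w [s2 [-> H1 H2]]]]] := IH _ Hr Hne.
  by exists (a :: s1), v, w, s2.
by exists [::], a, b, r.
Qed.

Lemma hop_rcons (S : pred 'I_n) z w v l :
  hop S z w l -> adj w v -> hop S z v l.+1.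
Proof.
move=> [a [p [za Sa Hp lp ->]]] wv; exists a, (rcons p v).
by rewrite rcons_path Hp lp wv last_rcons size_rcons.
Qed.

(* Walking along the cycle, the first hop of a shortest path from [z] changes
   on some edge; [u] is the end of that edge which is farther from [z]. *)
Lemma hops_of_cycle z c : cycle_through z c ->
  exists u a b d e, [/\ u != z, a != b, hop (pred1 a) z u d /\ hop (pred1 b) z u e,
    forall q, path (@adj G) z q -> last z q = u -> d <= size q
    & e <= d.+1 /\ d + e <= size c].
Proof.
move=> [Hs Hu Hc Hz]; have [i c' Ec] := rot_to Hz.
have Ss : size c = (size c').+1 by rewrite -(size_rot i) Ec.
rewrite -(rot_uniq i) Ec in Hu; rewrite -(rot_cycle i) Ec in Hc.
rewrite {}Ss in Hs *; clear Ec Hz.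
case: c' Hs Hu Hc => [//|a r] Hs /andP[zr /andP[ar _]] Hc.
have Hpr : path (@adj G) z (a :: r) by move: Hc; rewrite /cycle rcons_path => /andP[].
have Hpa : path (@adj G) a r by case/andP: Hpr.
have za : adj z a by case/andP: Hpr.
have zl : adj z (last a r).
  by move: Hc; rewrite /cycle rcons_path adj_sym => /andP[_].
have al : a != last a r.
  apply: contra ar => /eqP ->; case: r Hs {zr Hc Hpr Hpa zl} => // b r _ /=.
  exact: mem_last.
(* Each vertex of the cycle other than [z] is labelled with the first hop and the length of one
   shortest path from [z]; [(z, 0)] is a dummy for all other vertices. *)
have Hex w : exists bd : 'I_n * nat, w \in a :: r -> hop (pred1 bd.1) z w bd.2 /\
    forall q, path (@adj G) z q -> last z q = w -> bd.2 <= size q.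
  case: (boolP (w \in a :: r)) => Hw; last by exists (z, 0).
  have wz : w != z by apply: contra zr => /eqP <-.
  have [|b [d Hd]] := shortest_hop wz; last by exists (b, d).
  case/splitPr: Hw Hpr => p1 p2; rewrite -cat_rcons cat_path => /andP[H _].
  by exists (rcons p1 w); rewrite ?last_rcons.
have [f Hf] := choice Hex.
(* A neighbour of [z] is its own first hop. Hence the two neighbours of [z] on the cycle have
   different labels, and the label changes somewhere between them. *)
have f1 w : w \in a :: r -> adj z w -> (f w).1 = w.
  move=> /Hf[[b [p [zb /eqP <- Hp lp E]]] Hmin] zw.
  have := Hmin [:: w]; rewrite /= zw E => /(_ isT erefl).
  by rewrite ltnS leqn0 size_eq0 => /eqP Ep; rewrite Ep in lp.
have Hne : (f a).1 != (f (last a r)).1.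
  by rewrite !f1 ?mem_last ?mem_head.
have [s1 [v [w [s2 [Er vw Hvw]]]]] := path_change (f := fun x => (f x).1) Hpa Hne.
have [Hv Mv] : hop (pred1 (f v).1) z v (f v).2 /\
    forall q, path (@adj G) z q -> last z q = v -> (f v).2 <= size q.
  by apply: Hf; rewrite Er mem_cat inE eqxx orbT.
have [Hw Mw] : hop (pred1 (f w).1) z w (f w).2 /\
    forall q, path (@adj G) z q -> last z q = w -> (f w).2 <= size q.
  by apply: Hf; rewrite Er mem_cat !inE eqxx !orbT.
have wz : w != z by apply: contra zr => /eqP <-; rewrite Er mem_cat !inE eqxx !orbT.
have vz : v != z by apply: contra zr => /eqP <-; rewrite Er mem_cat !inE eqxx !orbT.
(* Distances are bounded by the arcs of the cycle: one runs from [z] to [v], the other from [w] back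
   to [z], and together with the edge [v w] they make up the whole cycle. *)
have Lv : (f v).2 <= (size s1).+1.
  rewrite -(size_rcons s1 v); apply: Mv; last by rewrite last_rcons.
  by move: Hpr; rewrite Er -cat_rcons cat_path => /andP[].
have Lw : (f w).2 <= (size s2).+1.
  have : path (@adj G) w (rcons s2 z).
    move: Hc; rewrite /cycle Er rcons_cat cat_path => /andP[_] /=.
    by case/and3P.
  move=> /path_adj_rev; rewrite last_rcons => -[H1 H2].
  by have := Mw _ H1 H2; rewrite size_rev size_belast size_rcons.
have Hc' : (size (a :: r)).+1 = (size s1).+1 + (size s2).+1 + 1.
  by rewrite Er size_cat /=; clear; lia.
(* The second walk to [u] passes through the nearer end and then takes the edge, so it exceeds the
   distance of [u] by at most one. *)
rewrite Hc'; have wv : adj w v by rewrite adj_sym.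
case: (leqP (f w).2 (f v).2) => L.
- exists v, (f v).1, (f w).1, (f v).2, (f w).2.+1; split => //; last by clear -L Lv Lw; lia.
  by split => //; apply: hop_rcons Hw wv.
- exists w, (f w).1, (f v).1, (f w).2, (f v).2.+1; split => //; last by clear -L Lv Lw; lia.
    by rewrite eq_sym.
  by split => //; apply: hop_rcons Hv vw.
Qed.

Definition bit i (v : nat) := odd (v %/ 2 ^ i).

(* [E i j z u] is the length of a shortest walk from [z] to [u] whose first
   hop has [i]-th bit [j], plus one, or 0 if there is none. *)
Definition hop_codes (E : nat -> bool -> 'I_n -> 'I_n -> nat) i :=
  forall j z u,
    match E i j z u with
    | 0 => forall l, ~ hop (fun a : 'I_n => bit i a == j) z u l
    | d.+1 => hop (fun a : 'I_n => bit i a == j) z u d /\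
              forall l, hop (fun a : 'I_n => bit i a == j) z u l -> d <= l
    end.

(** The arguments are lengths plus one. The shift cancels in the differences, and [e0 + e1 - 1] is
    again a length plus one, namely for the sum of the two lengths. *)
Definition candidate (e0 e1 : nat) :=
  [&& 0 < e0, 0 < e1, e0 <= e1.+1 & e1 <= e0.+1].

Lemma candidate_sound E i z u : hop_codes E i -> u != z ->
  candidate (E i false z u) (E i true z u) ->
  exists2 c, cycle_through z c & size c < E i false z u + E i true z u - 1.
Proof.
move=> HE uz /and4P[H0 H1 L0 L1].
have := HE false z u; have := HE true z u.
case: (E i false z u) (E i true z u) H0 H1 L0 L1 => [//|d0] [//|d1] _ _ L0 L1.
move=> [h1 m1] [h0 m0].
have E01 : (predC (fun a : 'I_n => bit i a == true)) =1 (fun a => bit i a == false).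
  by move=> a /=; case: (bit i a).
have eqhop S S' x y l : S =1 S' -> hop S x y l -> hop S' x y l.
  by move=> ES [a [p [A1 A2 *]]]; exists a, p; split => //; rewrite -ES.
have [||||c Hc Hs] := @cycle_of_hops _ z u d1 d0 uz h1 m1 => //.
- exact: eqhop (fsym E01) h0.
- by move=> l Hl; apply: m0; apply: eqhop E01 Hl.
by exists c => //; move: Hs; clear; lia.
Qed.

(** Passing from a single first hop to all hops with the same bit can only shorten the walks, but
    never below the distance [d]. So the two codes lie between [d.+1] and [d.+2], which keeps the
    difference test true and the sum small. *)
Lemma candidate_complete E L z c : n <= 2 ^ L ->
  (forall i, i < L -> hop_codes E i) -> cycle_through z c ->
  exists i u, [/\ i < L, u != z, candidate (E i false z u) (E i true z u)
    & E i false z u + E i true z u - 1 <= (size c).+1].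
Proof.
move=> HL HE Hc; have [u [a [b [d [e [uz ab [ha hb] Hd [Le Ls]]]]]]] := hops_of_cycle Hc.
have [|||i Hi Hbit] := @odd_div_expn2_neq L a b; try exact: leq_trans (ltn_ord _) HL.
  by [].
have hopS (S : pred 'I_n) x l : S x -> hop (pred1 x) z u l -> hop S z u l.
  by move=> Sx [y [p [A1 /eqP E' A3 A4 A5]]]; rewrite E' in A1 A3 A4; exists x, p.
have hop_ge (S : pred 'I_n) l : hop S z u l -> d <= l.
  by move=> [y [p [A1 _ A3 A4 ->]]]; apply: (Hd (y :: p)) => //=; rewrite A1.
have HEi x l : hop (pred1 x) z u l -> d < E i (bit i x) z u <= l.+1.
  move=> hx; have := HE i Hi (bit i x) z u.
  have {}hx : hop (fun y : 'I_n => bit i y == bit i x) z u l by apply: hopS hx.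
  case: (E i (bit i x) z u) => [/(_ _ hx)//|d' [/hop_ge hd' /(_ _ hx) Hl]].
  by rewrite !ltnS hd'.
have Ha := HEi _ _ ha; have := HEi _ _ hb.
have -> : bit i b = ~~ bit i a.
  by move: Hbit; rewrite -/(bit i a) -/(bit i b); case: (bit i a); case: (bit i b).
move=> Hb; exists i, u; rewrite /candidate; split => //; move: Ha Hb;
  by case: (bit i a) => /=; clear -Le Ls; lia.
Qed.

End Cycles.

(** * Matrices as arrays *)

Lemma mkseqD (T : Type) (f : nat -> T) a b :
  mkseq f (a + b) = mkseq f a ++ mkseq (fun i => f (a + i)) b.
Proof.
rewrite /mkseq iotaD map_cat add0n -[in X in _ ++ X](addn0 a) iotaDl -map_comp.
by [].
Qed.

Lemma mkseq_mul (T : Type) (f : nat -> T) a n :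
  mkseq f (a * n) = flatten (mkseq (fun i => mkseq (fun j => f (i * n + j)) n) a).
Proof.
elim: a => [|a IH] //.
rewrite mulSn addnC mkseqD IH -[a.+1]addn1 mkseqD flatten_cat /=.
by rewrite addn0 cats0.
Qed.

Lemma rowmajorE (T : Type) n (F : 'I_n -> 'I_n -> T) (g : nat -> T) :
  (forall i j : 'I_n, g (i * n + j) = F i j) -> rowmajor F = mkseq g (n * n).
Proof.
move=> Hg; rewrite mkseq_mul /rowmajor /mkseq -val_enum_ord -map_comp.
congr flatten; apply: eq_map => i /=.
by rewrite -map_comp; apply: eq_map => j /=; rewrite Hg.
Qed.

Lemma rowmajor_nth (T : Type) n (x0 : T) (F : 'I_n -> 'I_n -> T) (i j : 'I_n) :
  nth x0 (rowmajor F) (i * n + j) = F i j.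
Proof.
rewrite (@rowmajorE _ _ _ (fun t => F (insubd i (t %/ n)) (insubd j (t %% n)))).
  have n_gt0 : 0 < n by case: i => ? /=; case: (n).
  have lt : i * n + j < n * n.
    by rewrite -ltn_divLR // divnMDl // divn_small // addn0.
  rewrite nth_mkseq // divnMDl // divn_small // addn0 modnMDl modn_small //.
  by rewrite !valKd.
move=> i' j'; have n_gt0 : 0 < n by case: i => ? /=; case: (n).
by rewrite divnMDl // divn_small // addn0 modnMDl modn_small // !valKd.
Qed.

Lemma size_rowmajor (T : Type) n (F : 'I_n -> 'I_n -> T) : size (rowmajor F) = n * n.
Proof. by rewrite size_allpairs size_enum_ord. Qed.

Lemma all_rowmajor (T : Type) n (F : 'I_n -> 'I_n -> T) (P : pred T) :
  (forall i j, P (F i j)) -> all P (rowmajor F).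
Proof.
move=> H; suff Hr r l : all P [seq F i j | i <- r, j <- l] by exact: Hr.
elim: r => //= i r IH.
by rewrite all_cat IH andbT all_map; elim: l {IH} => //= j l ->; rewrite H.
Qed.

Lemma nat_mulmxE n (X Y : 'M[nat]_n) i j :
  mulmx X Y i j = \sum_(k < n) X i k * Y k j.
Proof. by rewrite mxE. Qed.

(** * Schoolbook matrix multiplication *)

Definition rem_expr x n : expr := ($x - $x / $n * $n)%X.

(** Arrays 2 and 3 hold n and n^2, 6 runs over the entries of the product, 7 over the summation
    index, and 5 accumulates. The offset 1 skips the dimension at the head of the input. *)
Definition school_mm : cmd :=
  (2 ::= 0.[#0] ;;
   3 ::= $2 * $2 ;;
   For 6 3
     (5 ::= #0 ;;
      For 7 2
        (5 ::= $5 + 0.[#1 + $6 / $2 * $2 + $7]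
                   * 0.[#1 + $3 + $7 * $2 + rem_expr 6 2]) ;;
      Push 1 ($5)%X))%ram.

Lemma modn_sub x n : x %% n = x - x %/ n * n.
Proof. by rewrite {2}(divn_eq x n) addKn. Qed.

Lemma wp_school_mm O good s n m B :
  0 < n -> (n + 2) ^ 4 <= B -> nth 0 s 0 = n -> (forall t, nth 0 s t <= n) ->
  m 0 = s -> m 1 = [::] ->
  wp O B good school_mm m (n * n * n.+1) 0 (fun m' => m' 1 =
    mkseq (fun t => \sum_(k < n) nth 0 s (1 + t %/ n * n + k)
                       * nth 0 s (1 + n * n + k * n + t %% n)) (n * n)).
Proof.
move=> n0 HB s0 sn m0 m1.
have B1 : 1 < B by apply: leq_trans HB; clear; nia.
have B3 : n * n * n <= B by apply: leq_trans HB; clear; nia.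
have B2 : n * n <= B by apply: leq_trans HB; clear; nia.
have B4 : n <= B by apply: leq_trans HB; clear; nia.
apply: wp_seq0; apply: wp_setv; rewrite !evE m0 s0 //.
apply: wp_seq0; apply: wp_setv; rewrite !evE !svE /= nth_set_nth //=.
apply: (wp_for (n := n * n) (k := n) (r := 0) (I := fun i m' => m' 1 = mkseq (fun t => \sum_(k < n) nth 0 s (1 + t %/ n * n + k)
                       * nth 0 s (1 + n * n + k * n + t %% n)) i)) => //.
all: rewrite ?svE /= ?nth_set_nth ?muln0 //=.
set g := fun t => _; move=> i m2 Hi i2 F2 I2.
have v0 : m2 0 = s by rewrite F2 // !updE.
have v2 : sv m2 2 = n by rewrite /sv F2 // !updE /= !nth_set_nth.
have v3 : sv m2 3 = n * n by rewrite /sv F2 // !updE /= !nth_set_nth.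
apply: wp_seq0; apply: wp_setv; rewrite !evE //.
apply: wp_seq_last.
apply: (wp_for (n := n) (k := 0) (r := 0) (I := fun j m' => sv m' 5 =
   \sum_(k < j) nth 0 s (1 + i %/ n * n + k) * nth 0 s (1 + n * n + k * n + i %% n))) => //.
all: rewrite ?muln1 ?muln0 ?svE /= ?nth_set_nth ?big_ord0 //=.
- move=> j m3 Hj j3 F3 I3.
  have w0 : m3 0 = s by rewrite F3 // !updE.
  have w2 : sv m3 2 = n by rewrite /sv F3 // !updE.
  have w3 : sv m3 3 = n * n by rewrite /sv F3 // !updE.
  have w6 : sv m3 6 = i by rewrite /sv F3 // !updE.
  have E : eval m3 ($5 + 0.[#1 + $6 / $2 * $2 + $7] * 0.[#1 + $3 + $7 * $2 + rem_expr 6 2])%X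
    = \sum_(k < j.+1) nth 0 s (1 + i %/ n * n + k) * nth 0 s (1 + n * n + k * n + i %% n).
    by rewrite !evE /= w0 w2 w3 w6 j3 -modn_sub I3 big_ord_recr.
  apply: wp_setv; rewrite E; last by rewrite !svE /= nth_set_nth.
  apply: leq_trans B3.
  apply: (@leq_trans (\sum_(k < j.+1) n * n)).
    by apply: leq_sum => k _; apply: leq_mul.
  by rewrite sum_nat_const card_ord -mulnA leq_mul2r Hj orbT.
- move=> m3 F3 I3; have w1 : m3 1 = mkseq g i by rewrite F3 // !updE.
  apply: wp_push; rewrite ?evE ?w1 ?I3 ?size_mkseq.
  + exact: leq_trans Hi B2.
  + apply: leq_trans B3.
    apply: (@leq_trans (\sum_(k < n) n * n)).
      by apply: leq_sum => k _; apply: leq_mul.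
    by rewrite sum_nat_const card_ord mulnA.
  + by rewrite !updE /= -[i.+1]addn1 mkseqD /= cats1 addn0.
Qed.

Lemma school_mm_spec n (X Y : 'M[nat]_n) : 0 < n ->
  (forall i j, X i j <= n) -> (forall i j, Y i j <= n) ->
  exists2 t, runs school_mm (n :: rowmajor X ++ rowmajor Y) (rowmajor (mulmx X Y)) t
    & t <= csz school_mm * (n * n * n.+1).+1 * bits ((n + 2) ^ 4).
Proof.
move=> n0 HX HY; set s := _ :: _.
have Hall : all (fun v => v <= n) s.
  by rewrite /= leqnn all_cat !all_rowmajor.
have Hs t : nth 0 s t <= n.
  case: (ltnP t (size s)) => H; first exact: (allP Hall _ (mem_nth 0 H)).
  by rewrite nth_default.
have [||m' [t [q [E [_ Ht] Hq _ Hm']]]] :=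
  @wp_school_mm (fun=> [::]) (fun=> True) s n (load s) ((n + 2) ^ 4) n0 (leqnn _) erefl Hs erefl erefl.
- by clear -n0; nia.
- move=> a; rewrite /load updE; case: eqP => // _.
  rewrite (sub_all _ Hall); last by move=> v /leq_trans; apply; clear; nia.
  by rewrite andbT /= size_cat !size_rowmajor; clear; nia.
move: Hq; rewrite leqn0 size_eq0 => /eqP Eq; rewrite {}Eq in E.
exists t => //; exists m'; split => //; rewrite Hm'; apply/esym/rowmajorE => i j.
rewrite nat_mulmxE; apply: eq_bigr => k _.
rewrite divnMDl // divn_small // addn0 modnMDl modn_small // -!addnA !add1n /=.
rewrite !nth_cat !size_rowmajor rowmajor_nth.
have -> : i * n + k < n * n.
  by rewrite -ltn_divLR // divnMDl // divn_small // addn0.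
by rewrite ltnNge leq_addr /= addKn rowmajor_nth.
Qed.

(** * Distances by repeated squaring *)

Section Squaring.
Variable n : nat.
Implicit Types (e : rel 'I_n) (x y k : 'I_n) (T : 'I_n -> 'I_n -> nat).

(** Reachability in at most [d] steps replaces a distance function, so that unreachable pairs need
    no infinite value. *)
Fixpoint within e d x y : bool :=
  if d is d'.+1 then within e d' x y || [exists k, within e d' x k && e k y]
  else x == y.

Lemma within_leq e d d' x y : d <= d' -> within e d x y -> within e d' x y.
Proof.
elim: d' => [|d' IH]; first by rewrite leqn0 => /eqP ->.
by rewrite leq_eqVlt => /orP[/eqP -> //|Hd /(IH Hd) /= ->].
Qed.

Lemma within_step e d x k y : within e d x k -> e k y -> within e d.+1 x y.
Proof. by move=> H1 H2 /=; apply/orP; right; apply/existsP; exists k; rewrite H1. Qed.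

Lemma withinP e d x y : within e d x y <->
  exists p, [/\ path e x p, last x p = y & size p <= d].
Proof.
split.
- elim: d y => [|d IH] y /=; first by move/eqP => <-; exists [::].
  move=> /orP[/IH [p [Hp lp Hs]]|/existsP[k /andP[/IH [p [Hp lp Hs]] ky]]].
    by exists p; split => //; exact: leqW.
  by exists (rcons p y); rewrite rcons_path Hp lp last_rcons size_rcons.
- move=> [p [Hp lp Hs]]; apply: within_leq Hs _.
  elim/last_ind: p y Hp lp => [|p k IH] y /=; first by move=> _ ->.
  rewrite rcons_path last_rcons size_rcons => /andP[Hp ky] <-.
  exact: within_step (IH _ Hp erefl) ky.
Qed.

Lemma within_card e d x y : within e d x y -> within e n x y.
Proof.
move/withinP => [p [Hp lp _]]; apply/withinP.
case/shortenP: Hp lp => p' Hp' Up' _ lp'; exists p'; split => //.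
rewrite -[X in _ <= X]card_ord; apply: leq_trans (max_card (mem (x :: p'))).
by rewrite (card_uniqP Up') /=.
Qed.

Definition square e : rel 'I_n := fun x y =>
  (x != y) && (e x y || [exists k, e x k && e k y]).

Lemma square_sym e : symmetric e -> symmetric (square e).
Proof.
move=> He x y; rewrite /square eq_sym He; congr (_ && (_ || _)).
by apply: eq_existsb => k; rewrite andbC He [e x k]He.
Qed.

Lemma square_irr e : irreflexive (square e).
Proof. by move=> x; rewrite /square eqxx. Qed.

(** Two successive steps of [e] become one step of the square, or none if they return to their
    start. Distances in the square are therefore halves rounded up. *)
Lemma within_square e d x y : within (square e) d x y = within e d.*2 x y.
Proof.
elim: d y => [|d IH] y //; apply/idP/idP.
- rewrite doubleS => /= /orP[|/existsP[k /andP[]]].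
    by rewrite IH => ->.
  rewrite IH => Hk /andP[_ /orP[ky|/existsP[j /andP[kj jy]]]].
    by apply/orP; right; apply/existsP; exists k; rewrite Hk ky.
  exact: within_step (within_step Hk kj) jy.
- have step2 k : within e d.*2 x k -> (k == y) || e k y || [exists j, e k j && e j y] ->
      within (square e) d.+1 x y.
    rewrite -IH => Hk; case: (eqVneq k y) => [<- _|ky /= H]; first exact: within_leq Hk.
    by apply: within_step Hk _; rewrite /square ky.
  rewrite doubleS => /= /orP[/orP[H|/existsP[k /andP[H ky]]]|/existsP[j /andP[]]].
  + by apply: (step2 y) => //; rewrite eqxx.
  + by apply: (step2 k) => //; rewrite ky orbT.
  + move=> /orP[H|/existsP[k /andP[H kj]]] jy.
      by apply: (step2 j) => //; rewrite jy orbT.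
    by apply: (step2 k) => //; apply/orP; right; apply/existsP; exists j; rewrite kj.
Qed.

(* Unreachable pairs are coded by 0, as are the diagonal ones. *)
Definition distances e T :=
  (forall x, T x x = 0) /\
  forall x y, x != y -> forall d, within e d x y = (0 < T x y <= d).

(** Seidel's parity test: the correction is 1 when the neighbours of [y] have average value below
    [T x y]. The degree of [y] is written as a diagonal entry of the squared adjacency matrix, which
    the program has already obtained from the oracle. *)
Definition unsquare e T x y :=
  2 * T x y - ((\sum_k T x k * e k y).+1 <= T x y * \sum_k e y k * e k y).

(** Let [t] be the distance in the square, so that the distance in [e] is [2 t - 1] or [2 t]. In the
    odd case no neighbour of [y] has a value above [t], and the predecessor of [y] on a shortest
    path has a smaller one; in the even case every neighbour is at distance at least [2 t - 1],
    hence has value at least [t]. *)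
Lemma unsquare_distances e T : symmetric e -> irreflexive e ->
  distances (square e) T -> distances e (unsquare e T).
Proof.
move=> es ei [T0 HT]; split=> [x|x y xy d]; first by rewrite /unsquare T0.
have W z d' : z != x -> within e d'.*2 x z = (0 < T x z <= d').
  by move=> zx; rewrite -within_square HT // eq_sym.
have yx : y != x by rewrite eq_sym.
have Edeg : \sum_k e y k * e k y = \sum_k e k y.
  by apply: eq_bigr => k _; rewrite es; case: (e k y).
(* A pair unreachable in the square is unreachable in [e], and truncated subtraction keeps its code
   0. *)
rewrite /unsquare Edeg; case: (posnP (T x y)) => [E|Tpos].
  rewrite E mul0n muln0 /=; apply/negP => H.
  have : within e d.*2 x y by apply: within_leq H; rewrite -addnn leq_addr.
  by rewrite W // E.
set t := T x y in Tpos *.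
have Wt : within e t.*2 x y by rewrite W // -/t Tpos leqnn.
have Wt1 : within e t.-1.*2 x y = false by rewrite W // -/t; clear -Tpos; lia.
have Et : t.*2 = t.-1.*2.+2 by clear -Tpos; lia.
case: (boolP (within e t.-1.*2.+1 x y)) => Hodd.
- have lt : \sum_k T x k * e k y < t * \sum_k e k y.
    have [k /andP[Hk ky]] : exists k, within e t.-1.*2 x k && e k y.
      by move: Hodd; rewrite /= Wt1 /= => /existsP.
    rewrite big_distrr /= (bigD1 k) //= [X in _ < X](bigD1 k) //= ky !muln1.
    have Tk : T x k < t.
      case: (eqVneq k x) => [->|kx]; first by rewrite T0.
      by move: Hk; rewrite W // => /andP[_]; clear -Tpos; lia.
    rewrite -addSn leq_add //; apply: leq_sum => j _.
    case jy: (e j y); rewrite ?muln0 // !muln1.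
    case: (eqVneq j x) => [->|jx]; first by rewrite T0.
    have : within e t.*2 x j.
      by rewrite Et; apply: within_step Hodd _; rewrite es.
    by rewrite W // => /andP[].
  rewrite lt; apply/idP/idP => [H|].
    rewrite leqNgt; case: (ltnP d) => Hd; rewrite ?andbF //=; last first.
      by move: Hd; clear -Tpos; lia.
    have : within e t.-1.*2 x y by apply: within_leq H; move: Hd; clear; lia.
    by rewrite Wt1.
  by move=> /andP[_ H]; apply: within_leq Hodd; move: H; clear -Tpos; lia.
- have ge : t * \sum_k e k y <= \sum_k T x k * e k y.
    rewrite big_distrr /=; apply: leq_sum => k _.
    case ky: (e k y); rewrite ?muln0 // !muln1.
    (* The code 0 of [x] itself would spoil the inequality, but if [x] were a neighbour of [y] the
       distance would be 1, at most [2 t - 1]. *)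
    case: (eqVneq k x) => [E|kx].
      case/negP: Hodd; apply: (within_step (k := x)); last by rewrite -E.
      by apply: (@within_leq _ 0) => //=.
    have : within e t.+1.*2 x k.
      apply: (@within_leq _ t.*2.+1); first by clear; lia.
      by apply: within_step Wt _; rewrite es.
    rewrite W // => /andP[Tk _]; rewrite leqNgt; apply/negP => Hlt.
    case/negP: Hodd; apply: (within_step _ ky); rewrite W // Tk.
    by move: Hlt; clear; lia.
  have -> : (\sum_k T x k * e k y < t * \sum_k e k y) = false by rewrite ltnNge ge.
  rewrite subn0; apply/idP/idP => [H|].
    rewrite leqNgt; case: (ltnP d) => Hd; rewrite ?andbF //=; last first.
      by move: Hd; clear -Tpos; lia.
    case/negP: Hodd; apply: within_leq H; move: Hd; clear; lia.
  by move=> /andP[_ H]; apply: within_leq Wt; move: H; clear -Tpos; lia.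
Qed.

Variable e : rel 'I_n.

Definition squares l := iter l square e.

Lemma squares_sym l : symmetric e -> symmetric (squares l).
Proof. by move=> He; elim: l => //= l; apply: square_sym. Qed.

Lemma squares_irr l : irreflexive e -> irreflexive (squares l).
Proof. by move=> He; case: l => //= l; apply: square_irr. Qed.

Lemma within_squares l d x y : within (squares l) d x y = within e (2 ^ l * d) x y.
Proof.
elim: l d => [|l IH] d; first by rewrite mul1n.
by rewrite /= within_square IH expnS -mul2n mulnCA mulnA.
Qed.

(** A simple path has fewer than [n] edges, so after [L] squarings any two connected vertices are
    adjacent, and the adjacency matrix is its own distance matrix. This starts the recursion. *)
Lemma squares_distances L : n <= 2 ^ L -> irreflexive e ->
  distances (squares L) (fun x y => squares L x y).
Proof.
move=> HL He; split=> [x|x y xy d]; first by rewrite squares_irr.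
case: d => [|d]; first by rewrite /= (negPf xy); case: (squares _ _ _).
have -> : (0 < squares L x y <= d.+1) = squares L x y by case: (squares _ _ _).
apply/idP/idP => [H|H].
  have : within (squares L) 1 x y.
    rewrite within_squares; apply: (within_leq (d := n)); first by rewrite muln1.
    by move: H; rewrite within_squares; apply: within_card.
  rewrite /= (negPf xy) /= => /existsP[k /andP[/eqP <-]]; exact.
by apply: (within_leq (d := 1)) => //; apply: (within_step (k := x)) => /=.
Qed.

(** [r] counts the squarings undone: level [r] belongs to [squares (L - r)], and level [L] to the
    graph itself. *)
Fixpoint dist_level (L r : nat) : 'I_n -> 'I_n -> nat :=
  if r is r'.+1 then unsquare (squares (L - r)) (dist_level L r')
  else fun x y => squares L x y.

Lemma dist_levelP L r : n <= 2 ^ L -> symmetric e -> irreflexive e -> r <= L ->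
  distances (squares (L - r)) (dist_level L r).
Proof.
move=> HL es ei; elim: r => [|r IH] Hr.
  by rewrite subn0; apply: squares_distances.
apply: unsquare_distances; [exact: squares_sym|exact: squares_irr|].
have -> : square (squares (L - r.+1)) = squares (L - r).
  by rewrite -[in RHS](@prednK (L - r)) ?subn_gt0 // -subnS.
by apply: IH; apply: ltnW.
Qed.

End Squaring.

(** * Seidel's algorithm *)

Lemma distances_le n (e : rel 'I_n) T x y : distances e T -> T x y <= n.
Proof.
move=> [T0 HT]; case: (eqVneq x y) => [->|xy]; first by rewrite T0.
case: (posnP (T x y)) => [-> //|Tpos].
have /within_card : within e (T x y) x y by rewrite HT // Tpos leqnn.
by rewrite HT // => /andP[].
Qed.

Lemma rowmajor_eq n (s : seq nat) (F : 'I_n -> 'I_n -> nat) :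
  size s = n * n -> (forall i j : 'I_n, nth 0 s (i * n + j) = F i j) -> s = rowmajor F.
Proof. by move=> Hs HF; rewrite (rowmajorE HF) -Hs mkseq_nth. Qed.

Lemma rowmajor_index n t : t < n * n -> exists i j : 'I_n, t = i * n + j.
Proof.
move=> Ht; have n0 : 0 < n by case: n Ht.
have Hi : t %/ n < n by rewrite ltn_divLR.
by exists (Ordinal Hi), (Ordinal (ltn_pmod t n0)); rewrite /= -divn_eq.
Qed.

Lemma rowmajor_div n (i j : 'I_n) : (i * n + j) %/ n = i.
Proof.
have n0 : 0 < n by case: n i {j} => [[]|].
by rewrite divnMDl // divn_small // addn0.
Qed.

Lemma rowmajor_mod n (i j : 'I_n) : (i * n + j) %% n = j.
Proof. by rewrite modnMDl modn_small. Qed.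

Lemma rowmajor_lt n (i j : 'I_n) : i * n + j < n * n.
Proof.
have n0 : 0 < n by case: n i {j} => [[]|].
by rewrite -ltn_divLR // rowmajor_div.
Qed.

Lemma rowmajor_index_eq n (i j k l : 'I_n) :
  (i * n + j == k * n + l) = (i == k) && (j == l).
Proof.
apply/eqP/andP => [E|[/eqP -> /eqP -> //]].
split; apply/eqP/val_inj.
  by have := congr1 (divn^~ n) E; rewrite /= !rowmajor_div.
by have := congr1 (modn^~ n) E; rewrite /= !rowmajor_mod.
Qed.

Definition stack n (F : nat -> 'I_n -> 'I_n -> nat) l :=
  flatten (mkseq (fun l => rowmajor (F l)) l).

Lemma stackS n (F : nat -> 'I_n -> 'I_n -> nat) l :
  stack F l.+1 = stack F l ++ rowmajor (F l).
Proof. by rewrite /stack -addn1 mkseqD flatten_cat /= cats0 addn0. Qed.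

Lemma size_stack n (F : nat -> 'I_n -> 'I_n -> nat) l : size (stack F l) = l * (n * n).
Proof.
elim: l => [|l IH] //; rewrite stackS size_cat IH size_rowmajor mulSn; exact: addnC.
Qed.

Lemma nth_stack n (F : nat -> 'I_n -> 'I_n -> nat) l l' z (i j : 'I_n) : l' < l ->
  nth 0 (stack F l ++ z) (l' * (n * n) + (i * n + j)) = F l' i j.
Proof.
elim: l z => [|l IH] z //; rewrite ltnS leq_eqVlt => /orP[/eqP ->|Hl]; rewrite stackS -catA.
  rewrite nth_cat size_stack ltnNge leq_addr /= addKn nth_cat size_rowmajor.
  by rewrite rowmajor_lt rowmajor_nth.
exact: IH.
Qed.

Lemma nth_flat_pairs (T : Type) (f g : T -> nat) x0 es e : e < size es ->
  nth 0 (flatten [seq [:: f p; g p] | p <- es]) (e * 2) = f (nth x0 es e) /\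
  nth 0 (flatten [seq [:: f p; g p] | p <- es]) (e * 2).+1 = g (nth x0 es e).
Proof. by elim: es e => [|p es IH] [|e] //= He; apply: IH. Qed.

(** Array 5 is doubled until it reaches n. The loop makes n rounds, idle after the first
    [up_log 2 n]; this is harmless beside n^2. *)
Definition lg_prog : cmd :=
  (5 ::= #1 ;; 4 ::= #0 ;;
   For 6 2 (If ($5 + #1 <= $2)%X (5 ::= $5 * #2 ;; 4 ::= $4 + #1) Skip))%ram.

Lemma leq_up_log2 n : up_log 2 n <= n.
Proof. by apply: up_log_min => //; apply: ltnW; apply: ltn_expl. Qed.

Lemma wp_lg_prog O good B n m (Q : Defs.mem -> Prop) : sv m 2 = n -> 2 * n <= B ->
  (forall m1, (forall a, a \notin [:: 4; 5; 6] -> m1 a = m a) ->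
    sv m1 4 = up_log 2 n -> Q m1) ->
  wp O B good lg_prog m n 0 Q.
Proof.
move=> Hn HB HQ; apply: wp_bnd => B1 _.
apply: wp_seq0; apply: wp_setv; rewrite !evE; first exact: ltnW.
apply: wp_seq0; apply: wp_setv; rewrite !evE //.
apply: (wp_for (n := n) (k := 0) (r := 0) (I := fun i m' =>
  sv m' 4 = minn i (up_log 2 n) /\ sv m' 5 = 2 ^ minn i (up_log 2 n))) => //.
all: rewrite ?muln1 ?muln0 ?svE /= ?nth_set_nth ?min0n //=.
- move=> i m1 Hi i1 F1 [H4 H5].
  have H2 : sv m1 2 = n by rewrite /sv F1 // !updE.
  set U := up_log 2 n in H4 H5 *.
  have HU : (2 ^ minn i U < n) = (i < U).
    case: (ltnP i U) => HiU.
      rewrite ltnNge; apply/negP => /(up_log_min (ltnSn 1)).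
      by rewrite leqNgt HiU.
    by rewrite ltnNge up_logP.
  apply: wp_if; rewrite !evE H5 H2 /= addn1 HU; last first.
    move=> /eqP; rewrite eqb0 -leqNgt => HiU; apply: wp_skip.
    rewrite !svE /= H4 H5 (minn_idPr HiU) (minn_idPr _) //.
    exact: leq_trans HiU (leqnSn _).
  case: (ltnP i U) => //= HiU _.
  rewrite HiU (minn_idPl (ltnW HiU)) in HU H4 H5.
  apply: wp_seq0; apply: wp_setv; rewrite !evE /= H5.
    by apply: leq_trans HB; rewrite mulnC leq_mul2l ltnW ?orbT.
  apply: wp_setv; rewrite ?evE ?svE /= H4 addn1.
    by apply: leq_trans HiU _; apply: leq_trans (leq_up_log2 n) _; move: HB; clear; lia.
  by rewrite ?svE /= ?nth_set_nth /= (minn_idPl HiU) expnSr.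
- move=> m1 F1 [H4 _]; apply: HQ; last first.
    by rewrite H4; apply/minn_idPr; apply: leq_up_log2.
  move=> a Ha; rewrite F1; last by move: Ha; rewrite !inE; clear; lia.
  by move: Ha; rewrite !inE !negb_or !updE => /and3P[/negPf -> /negPf -> _].
Qed.

Lemma wp_append_rowmajor O good B n (F : 'I_n -> 'I_n -> nat) b x y e m (Q : Defs.mem -> Prop) :
  uniq [:: b; x; y] -> sv m y = n * n -> size (m b) + n * n <= B ->
  (forall (i j : 'I_n) m1 z, (forall a, a != x -> a != b -> m1 a = m a) ->
     sv m1 x = i * n + j -> m1 b = m b ++ z -> eval m1 e = F i j /\ F i j <= B) ->
  (forall m1, (forall a, a != x -> a != b -> m1 a = m a) ->
     m1 b = m b ++ rowmajor F -> Q m1) ->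
  wp O B good (Append b x y e) m (n * n) 0 Q.
Proof.
move=> Hu Hy Hs He HQ; apply: (@wp_append _ _ _ (n * n) (nth 0 (rowmajor F))) => //.
- move=> t m1 Ht F1 Hx Hb; have [i [j E]] := rowmajor_index Ht.
  by rewrite E rowmajor_nth; apply: He F1 _ Hb; rewrite Hx.
- move=> m1 F1 Hb; apply: HQ => //.
  by rewrite Hb; congr (_ ++ _); rewrite -[RHS](mkseq_nth 0) size_rowmajor.
Qed.

Definition eq_index x n : expr := ((rem_expr x n <= $x / $n) * ($x / $n <= rem_expr x n))%X.

Lemma eval_rem m x n : eval m (rem_expr x n) = sv m x %% sv m n.
Proof. by rewrite modn_sub. Qed.

Lemma eval_eq_index n m x y (i j : 'I_n) : sv m y = n -> sv m x = i * n + j ->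
  eval m (eq_index x y) = (i == j).
Proof.
move=> Hy Hx; rewrite /eq_index !(eval_rem, evE) Hy Hx /= rowmajor_div rowmajor_mod.
by rewrite mulnb -eqn_leq eq_sym.
Qed.

(* Arrays: 2, 3, 4, 8 hold n, n^2, the number of squarings and m; 10, 15 and 16
   are stacks of matrices: the iterated squares of the graph, the products of
   their adjacency matrices with themselves, and their distances, from the last
   square down to the graph itself; 13 is the question, 14 the answer. *)
Definition read_adj : cmd :=
  (Assign 10 ($3 - #1)%X (#0)%X ;;
   For 6 8 (11 ::= 0.[#2 + $6 * #2] ;; 12 ::= 0.[#3 + $6 * #2] ;;
            Assign 10 ($11 * $2 + $12)%X (#1)%X ;;
            Assign 10 ($12 * $2 + $11)%X (#1)%X))%ram.

Definition ask (a b : expr) : cmd :=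
  (Clear 13 ;; Push 13 ($2)%X ;; Append 13 6 3 a ;; Append 13 6 3 b ;; Query 13 14)%ram.

Definition square_prog : cmd :=
  (For 7 4
    (ask (10.[$7 * $3 + $6]) (10.[$7 * $3 + $6]) ;;
     Append 15 6 3 (14.[$6]) ;;
     Append 10 6 3
       ((#1 - eq_index 6 2) * (#1 <= 10.[$7 * $3 + $6] + 14.[$6]))))%ram.

Definition unsquare_prog : cmd :=
  (For 7 4
    (9 ::= $4 - ($7 + #1) ;;
     ask (16.[$7 * $3 + $6]) (10.[$9 * $3 + $6]) ;;
     Append 16 6 3
       (#2 * 16.[$7 * $3 + $6] -
         (14.[$6] + #1 <=
           16.[$7 * $3 + $6] * 15.[$9 * $3 + (rem_expr 6 2 * $2 + rem_expr 6 2)]))))%ram.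

Definition seidel : cmd :=
  (2 ::= 0.[#0] ;; 8 ::= 0.[#1] ;; 3 ::= $2 * $2 ;; lg_prog ;; read_adj ;;
   square_prog ;;
   Append 16 6 3 (10.[$4 * $3 + $6]) ;;
   unsquare_prog ;;
   Append 1 6 3 (eq_index 6 2 + (16.[$4 * $3 + $6] + (#1 <= 16.[$4 * $3 + $6]))))%ram.

Section Seidel.
Variables (G : ugraph) (O : seq nat -> seq nat) (B : nat).
Notation n := (nv G).
Notation L := (up_log 2 n).
Implicit Types (F H : 'I_n -> 'I_n -> nat).
Hypothesis B_big : (n + 2) ^ 4 <= B.
Hypothesis O_mul : forall F H, (forall i j, F i j <= n) -> (forall i j, H i j <= n) ->
  O (n :: rowmajor F ++ rowmajor H) = rowmajor (fun i j => \sum_k F i k * H k j).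

Definition mm_query (q : seq nat) : Prop := exists F H,
  [/\ forall i j, F i j <= n, forall i j, H i j <= n & q = n :: rowmajor F ++ rowmajor H].

Notation wpS := (wp O B mm_query).

Let n_gt0 : 0 < n := nv_gt0 G.
Let L_le : L <= n := leq_up_log2 n.

Definition consts (m : Defs.mem) :=
  [/\ m 99 = [::], sv m 2 = n, sv m 3 = n * n & sv m 4 = L].

Lemma consts_frame m m1 : m1 99 = m 99 -> m1 2 = m 2 -> m1 3 = m 3 -> m1 4 = m 4 ->
  consts m -> consts m1.
Proof. by rewrite /consts /sv => -> -> -> ->. Qed.

(** The largest quantities are cubic: the stacks have at most [n.+1] matrices, and an entry of a
    product is a sum of [n] terms of at most [n * n]. *)
Lemma bound_cube c : c <= n.+1 * (n * n) -> c <= B.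
Proof. by move=> Hc; apply: leq_trans Hc (leq_trans _ B_big); clear; nia. Qed.

Lemma bound_n : n <= B.
Proof. by apply: bound_cube; move: n_gt0; clear; nia. Qed.

Lemma bound_mul F H i j : (forall i j, F i j <= n) -> (forall i j, H i j <= n) ->
  \sum_k F i k * H k j <= B.
Proof.
move=> HF HH; apply: bound_cube; apply: (@leq_trans (\sum_(k < n) n * n)).
  by apply: leq_sum => k _; apply: leq_mul.
by rewrite sum_nat_const card_ord leq_mul2r leqnSn orbT.
Qed.

Lemma wp_ask a b F H m (Q : Defs.mem -> Prop) :
  consts m -> (forall i j, F i j <= n) -> (forall i j, H i j <= n) ->
  (forall (i j : 'I_n) m1, (forall c, c != 6 -> c != 13 -> m1 c = m c) ->
     sv m1 6 = i * n + j -> eval m1 a = F i j /\ eval m1 b = H i j) ->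
  (forall m1, (forall c, c \notin [:: 6; 13; 14] -> m1 c = m c) ->
     m1 14 = rowmajor (fun i j => \sum_k F i k * H k j) -> Q m1) ->
  wpS (ask a b) m (n * n + (n * n + (3 * (n * n) + 2))) 1 Q.
Proof.
move=> [c99 c2 c3 c4] HF HH Hab HQ.
apply: wp_seq0; apply: wp_clear => //.
apply: wp_seq0; apply: wp_push; rewrite ?updE ?evE ?svE //=.
- by apply: bound_cube; move: n_gt0; clear; nia.
- by rewrite c2; exact: bound_n.
have szB : 1 + n * n + n * n <= B by apply: leq_trans B_big; clear; nia.
apply: (wp_seq (k1 := n * n) (r1 := 0)).
apply: (@wp_append_rowmajor _ _ _ n F) => //.
- by rewrite !updE /=; apply: leq_trans szB; rewrite leq_addr.
- move=> i j m1 z F1 Hx _.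
  have [|//|-> _] := Hab i j m1 => //.
    by move=> c H6 H13; rewrite F1 // !updE (negPf H13).
  by split => //; apply: leq_trans (HF i j) bound_n.
move=> m1 F1; rewrite !updE /= c2 => E1.
apply: (wp_seq (k1 := n * n) (r1 := 0)).
apply: (@wp_append_rowmajor _ _ _ n H) => //.
- by rewrite /sv F1 // !updE.
- by rewrite E1 /= size_rowmajor; apply: leq_trans szB; clear; lia.
- move=> i j m2 z F2 Hx _.
  have [|//|_ ->] := Hab i j m2 => //.
    by move=> c H6 H13; rewrite F2 // F1 // !updE (negPf H13).
  by split => //; apply: leq_trans (HH i j) bound_n.
move=> m2 F2; rewrite E1 /= => E2.
have EO := O_mul HF HH.
have -> : 3 * (n * n) + 2 = size (m2 13) + size (O (m2 13)) + 1.
  by rewrite E2 EO /= size_cat !size_rowmajor; clear; lia.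
apply: wp_query; rewrite E2 ?EO.
- by exists F, H.
- by rewrite size_rowmajor; apply: leq_trans szB; clear; lia.
- by apply: all_rowmajor => i j; apply: bound_mul.
apply: HQ; last by rewrite updE.
move=> c; rewrite !inE !negb_or => /and3P[H6 H13 H14].
by rewrite !updE (negPf H14) F2 // F1 // !updE (negPf H13).
Qed.

Lemma wp_read_adj (es : seq ('I_n * 'I_n)) t m (Q : Defs.mem -> Prop) :
  consts m -> m 10 = [::] -> sv m 8 = size es -> size es <= B ->
  m 0 = n :: t :: flatten [seq [:: nat_of_ord p.1; nat_of_ord p.2] | p <- es] ->
  (forall m1, (forall c, c \notin [:: 6; 10; 11; 12] -> m1 c = m c) ->
     m1 10 = rowmajor (fun i j => ((i, j) \in es) || ((j, i) \in es) : nat) -> Q m1) ->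
  wpS read_adj m (size es) 0 Q.
Proof.
move=> [c99 c2 c3 c4] m10 m8 HesB m0 HQ.
have n2B : n * n <= B by apply: bound_cube; clear; nia.
have n2 : 0 < n * n by rewrite muln_gt0 n_gt0.
have B0 : 0 < B by apply: leq_trans B_big; clear; nia.
(* One write in the last cell allocates the whole zero matrix, because [set_nth] pads with zeros. *)
apply: wp_seq0; apply: wp_assign; rewrite !evE //= c3.
  by apply: leq_trans n2B; move: n2; clear; lia.
apply: (wp_for (n := size es) (k := 0) (r := 0) (I := fun e m' =>
  size (m' 10) = n * n /\ forall i j : 'I_n, nth 0 (m' 10) (i * n + j) =
    ((i, j) \in take e es) || ((j, i) \in take e es) :> nat)) => //.
- by rewrite muln1.
- by rewrite muln0.
- rewrite !updE /= m10 size_set_nth; split; first by move: n2; clear; rewrite /=; lia.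
  by move=> i j; rewrite nth_set_nth /= nth_nil take0; case: eqP.
- move=> e m1 He e1 F1 [Hs I1].
  set x0 := (Ordinal n_gt0, Ordinal n_gt0).
  have w0 : m1 0 = m 0 by rewrite F1 // !updE.
  have w2 : sv m1 2 = n by rewrite /sv F1 // !updE.
  have [Eu Ev] := nth_flat_pairs (fun p : 'I_n * 'I_n => p.1 : nat) (fun p => p.2 : nat) x0 He.
  set u := (nth x0 es e).1 in Eu; set v := (nth x0 es e).2 in Ev.
  have ltB (i : 'I_n) : i <= B by apply: leq_trans bound_n; apply: ltnW.
  have ltB2 (i j : 'I_n) : i * n + j < B by apply: leq_trans n2B; apply: rowmajor_lt.
  have E1 : eval m1 (0.[#2 + $6 * #2])%X = u by rewrite !evE e1 w0 m0 /= add0n; exact: Eu.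
  have E2 m2 : m2 0 = m 0 -> sv m2 6 = e -> eval m2 (0.[#3 + $6 * #2])%X = v.
    by move=> h0 h6; rewrite !evE h6 h0 m0 /=; exact: Ev.
  apply: wp_seq0; apply: wp_setv; rewrite E1 //.
  apply: wp_seq0; apply: wp_setv; rewrite E2 ?svE ?updE //.
  apply: wp_seq0; apply: wp_assign; rewrite ?evE ?svE /= ?nth_set_nth /= ?w2 //.
  apply: wp_assign; rewrite ?evE ?svE /= ?nth_set_nth /= ?w2 //.
  rewrite !updE /= !size_set_nth Hs; split.
    have := rowmajor_lt u v; have := rowmajor_lt v u; clear; lia.
  move=> i j; rewrite nth_set_nth /= nth_set_nth /= !rowmajor_index_eq I1 (take_nth x0 He).
  have -> : nth x0 es e = (u, v) by rewrite /u /v; case: (nth x0 es e).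
  rewrite !mem_rcons !inE !xpair_eqE.
  case: (i == v); case: (j == u); case: (i == u); case: (j == v) => //=; by rewrite ?orbT.
- move=> m1 F1 [Hs I1]; apply: HQ; last first.
    by apply: rowmajor_eq => // i j; rewrite I1 take_size.
  move=> c; rewrite !inE !negb_or => /and4P[H6 H10 H11 H12].
  by rewrite F1 ?updE ?(negPf H10) // !inE !negb_or H6 H10 H11 H12.
Qed.

Notation e_ := (squares (@adj G)).

Definition adj_levels l (i j : 'I_n) : nat := e_ l i j.
Definition sqr_levels l (i j : 'I_n) : nat := \sum_k e_ l i k * e_ l k j.

Let adj_levels_le l i j : adj_levels l i j <= n.
Proof. by rewrite /adj_levels; case: (e_ l i j). Qed.

(** The Boolean square is read off an integer product: off the diagonal, a positive entry of the
    adjacency matrix plus its square means a connection by one or two edges. *)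
Lemma adj_levelsS l i j :
  adj_levels l.+1 i j = (1 - (i == j)) * (1 <= adj_levels l i j + sqr_levels l i j).
Proof.
rewrite /adj_levels /sqr_levels /= /square addn_gt0; case: eqP => //= _; rewrite mul1n.
congr (nat_of_bool (_ || _)); first by case: (e_ l i j).
rewrite lt0n sum_nat_eq0 negb_forall; apply: eq_existsb => k.
by case: (e_ l i k); case: (e_ l k j).
Qed.

Lemma wp_square_prog m (Q : Defs.mem -> Prop) :
  consts m -> m 10 = stack adj_levels 1 -> m 15 = [::] ->
  (forall m1, (forall c, c \notin [:: 6; 7; 10; 13; 14; 15] -> m1 c = m c) ->
     m1 10 = stack adj_levels L.+1 -> m1 15 = stack sqr_levels L -> Q m1) ->
  wpS square_prog m (L * (7 * (n * n) + 3)) L Q.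
Proof.
move=> Hc m10 m15 HQ.
apply: (wp_for (n := L) (k := 7 * (n * n) + 2) (r := 1) (I := fun l m' =>
  m' 10 = stack adj_levels l.+1 /\ m' 15 = stack sqr_levels l)) => //.
- by rewrite addn3 addn2.
- by rewrite muln1.
- by case: Hc.
move=> l m1 Hl l1 F1 [I10 I15].
have c1 : consts m1 by apply: consts_frame Hc; apply: F1.
have szB : L.+1 * (n * n) <= B.
  by apply: bound_cube; rewrite leq_mul2r ltnS L_le orbT.
have szl : l.+1 * (n * n) <= L * (n * n) by rewrite leq_mul2r Hl orbT.
have -> : 7 * (n * n) + 2 = n * n + (n * n + (3 * (n * n) + 2)) + (n * n + n * n).
  by clear; lia.
apply: (wp_seq (r1 := 1) (r2 := 0)).
apply: (@wp_ask _ _ (adj_levels l) (adj_levels l)) => //.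
  move=> i j m2 F2 h6.
  have w3 : sv m2 3 = n * n by rewrite /sv F2 //; case: c1.
  have w7 : sv m2 7 = l by rewrite /sv F2.
  have w10 : m2 10 = stack adj_levels l.+1 by rewrite F2.
  by rewrite !evE w10 w3 w7 h6 /= -[stack _ _]cats0 nth_stack.
move=> m2 F2 P2.
have c2 : consts m2 by apply: consts_frame c1; apply: F2.
have w10 : m2 10 = stack adj_levels l.+1 by rewrite F2.
have w15 : m2 15 = stack sqr_levels l by rewrite F2.
have w7 : sv m2 7 = l by rewrite /sv F2.
apply: (wp_seq (k1 := n * n) (r1 := 0)).
apply: (@wp_append_rowmajor _ _ _ n (sqr_levels l)) => //.
- by case: c2.
- rewrite w15 size_stack; apply: leq_trans szB; move: szl; clear; lia.
- move=> i j m3 z F3 h6 _; rewrite !evE h6 F3 // P2 rowmajor_nth; split => //.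
  by apply: (@bound_mul (adj_levels l) (adj_levels l)) => a b; exact: adj_levels_le.
move=> m3 F3; rewrite w15 -stackS => I15'.
apply: (@wp_append_rowmajor _ _ _ n (adj_levels l.+1)) => //.
- by rewrite /sv F3 //; case: c2.
- rewrite F3 // w10 size_stack; apply: leq_trans szB; move: szl; clear; lia.
- move=> i j m4 z F4 h6; rewrite F3 // w10 => h10; split; last first.
    by apply: leq_trans bound_n; exact: adj_levels_le.
  have w3 : sv m4 3 = n * n by rewrite /sv F4 // F3 //; case: c2.
  have w2 : sv m4 2 = n by rewrite /sv F4 // F3 //; case: c2.
  have v7 : sv m4 7 = l by rewrite /sv F4 // F3.
  transitivity ((1 - eval m4 (eq_index 6 2)) *
    (1 <= eval m4 (10.[$7 * $3 + $6])%X + eval m4 (14.[$6])%X)); first by [].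
  rewrite adj_levelsS (eval_eq_index w2 h6).
  rewrite !evE h10 w3 v7 h6 /= nth_stack // F4 // F3 // P2 rowmajor_nth.
  by [].
- move=> m4 F4; rewrite F3 // w10 -stackS => I10'.
  by rewrite !updE /=; split => //; rewrite F4.
- by move=> m1 F1 [I10 I15]; apply: HQ => //; apply: frame_sub F1.
Qed.

Notation D_ := (dist_level (@adj G) L).

Let dist_level_le r i j : r <= L -> D_ r i j <= n.
Proof.
move=> Hr; apply: distances_le (dist_levelP _ (@adj_sym G) (@adj_irr G) Hr).
exact: up_logP.
Qed.

Lemma wp_unsquare_prog m (Q : Defs.mem -> Prop) :
  consts m -> m 10 = stack adj_levels L.+1 -> m 15 = stack sqr_levels L ->
  m 16 = stack D_ 1 ->
  (forall m1, (forall c, c \notin [:: 6; 7; 9; 13; 14; 16] -> m1 c = m c) ->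
     m1 16 = stack D_ L.+1 -> Q m1) ->
  wpS unsquare_prog m (L * (6 * (n * n) + 3)) L Q.
Proof.
move=> Hc m10 m15 m16 HQ.
apply: (wp_for (n := L) (k := 6 * (n * n) + 2) (r := 1) (I := fun r m' =>
  m' 16 = stack D_ r.+1)) => //.
- by rewrite addn3 addn2.
- by rewrite muln1.
- by case: Hc.
move=> r m1 Hr r1 F1 I16.
have c1 : consts m1 by apply: consts_frame Hc; apply: F1.
have szB : L.+1 * (n * n) <= B.
  by apply: bound_cube; rewrite leq_mul2r ltnS L_le orbT.
have szl : r.+1 * (n * n) <= L * (n * n) by rewrite leq_mul2r Hr orbT.
have LrL : L - r.+1 < L.+1 by rewrite ltnS leq_subr.
have LrL' : L - r.+1 < L by move: Hr; clear; lia.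
have L_B : L <= B by apply: leq_trans bound_n.
have [_ _ _ c4] := c1.
apply: wp_seq0; apply: wp_setv; rewrite !evE /= c4 r1 addn1.
  by apply: leq_trans L_B; rewrite leq_subr.
set m2 := upd _ _ _.
have F2 c : c != 9 -> m2 c = m1 c by rewrite /m2 updE => /negPf ->.
have c2 : consts m2 by apply: consts_frame c1; apply: F2.
have w9 : sv m2 9 = L - r.+1 by exact: sv_set.
have w7 : sv m2 7 = r by rewrite /sv F2.
have w10 : m2 10 = stack adj_levels L.+1 by rewrite F2 // F1.
have w15 : m2 15 = stack sqr_levels L by rewrite F2 // F1.
have w16 : m2 16 = stack D_ r.+1 by rewrite F2.
have -> : 6 * (n * n) + 2 = n * n + (n * n + (3 * (n * n) + 2)) + n * n.
  by clear; lia.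
apply: (wp_seq (r1 := 1) (r2 := 0)).
apply: (@wp_ask _ _ (D_ r) (adj_levels (L - r.+1))) => //.
- by move=> i j; apply: dist_level_le; exact: ltnW.
- move=> i j m3 F3 h6.
  have v3 : sv m3 3 = n * n by rewrite /sv F3 //; case: c2.
  have v7 : sv m3 7 = r by rewrite /sv F3.
  have v9 : sv m3 9 = L - r.+1 by rewrite /sv F3.
  rewrite !evE !F3 // w10 w16 v3 v7 v9 h6 /=.
  by rewrite -[stack D_ _]cats0 -[stack adj_levels _]cats0 !nth_stack.
move=> m3 F3 P3.
have c3 : consts m3 by apply: consts_frame c2; apply: F3.
apply: (@wp_append_rowmajor _ _ _ n (D_ r.+1)) => //.
- by case: c3.
- by rewrite F3 // w16 size_stack; apply: leq_trans szB; move: szl; clear; lia.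
- move=> i j m4 z F4 h6; rewrite F3 // w16 => h16; split; last first.
    by apply: leq_trans bound_n; apply: dist_level_le.
  have v3 : sv m4 3 = n * n by rewrite /sv F4 //; case: c3.
  have v2 : sv m4 2 = n by rewrite /sv F4 //; case: c3.
  have v7 : sv m4 7 = r by rewrite /sv F4 // F3.
  have v9 : sv m4 9 = L - r.+1 by rewrite /sv F4 // F3.
  rewrite !(eval_rem, evE) h16 v3 v2 v7 v9 h6 /= rowmajor_mod nth_stack //.
  rewrite F4 // P3 rowmajor_nth F4 // F3 // w15.
  by rewrite -[stack sqr_levels _]cats0 nth_stack // addn1.
- by move=> m4 F4; rewrite F3 // w16 -stackS => I16'; rewrite !updE.
- by move=> m1 F1 I16; apply: HQ => //; apply: frame_sub F1.
Qed.

(** This passes to the convention of [code]: the diagonal gets 1, the code of distance 0;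
    unreachable pairs keep 0; a positive distance goes up by one. *)
Definition dist_code (i j : 'I_n) : nat := (i == j) + (D_ L i j + (1 <= D_ L i j)).

Lemma wp_seidel (es : seq ('I_n * 'I_n)) s : size es = ne G ->
  s = n :: ne G :: flatten [seq [:: nat_of_ord p.1; nat_of_ord p.2] | p <- es] ->
  (forall u v, adj u v = ((u, v) \in es) || ((v, u) \in es)) -> ne G <= n * n ->
  wpS seidel (load s)
    (n + (ne G + (L * (7 * (n * n) + 3) + (n * n + (L * (6 * (n * n) + 3) + n * n)))))
    (L + L) (fun m => m 1 = rowmajor dist_code).
Proof.
move=> Hsize Es Hadj Hne.
have n2B : n * n <= B by apply: bound_cube; clear; nia.
have nB := bound_n.
have szB : L.+1 * (n * n) <= B.
  by apply: bound_cube; rewrite leq_mul2r ltnS L_le orbT.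
apply: wp_seq0; apply: wp_setv; rewrite ?evE ?updE /= ?Es //=.
apply: wp_seq0; apply: wp_setv; rewrite ?evE ?updE /= ?Es /= ?(leq_trans Hne) //=.
apply: wp_seq0; apply: wp_setv; rewrite ?evE ?svE /= ?nth_set_nth //=.
set m0 := upd _ 3 _; rewrite -Es in m0 *.
have v0 : m0 0 = s by [].
have v2 : sv m0 2 = n by rewrite /sv /m0 !updE.
have v3 : sv m0 3 = n * n by rewrite /sv /m0 !updE.
have v8 : sv m0 8 = ne G by rewrite /sv /m0 !updE.
have ve c : c \notin [:: 0; 2; 3; 8] -> m0 c = [::].
  rewrite !inE !negb_or => /and4P[/negPf E0 /negPf E2 /negPf E3 /negPf E8].
  by rewrite /m0 /load !updE E0 E2 E3 E8.
clearbody m0.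
apply: (wp_seq (r1 := 0)); apply: wp_lg_prog => //.
  by apply: leq_trans B_big; clear; nia.
move=> m1 F1 w4.
have c1 : consts m1.
  by split => //; [rewrite F1 // ve|rewrite /sv F1|rewrite /sv F1].
rewrite -Hsize.
apply: (wp_seq (r1 := 0)); apply: (@wp_read_adj es (ne G)) => //.
- by rewrite F1 // ve.
- by rewrite Hsize /sv F1.
- by rewrite Hsize (leq_trans Hne).
- by rewrite F1 // v0.
move=> m2 F2 A2.
have c2 : consts m2 by apply: consts_frame c1; apply: F2.
apply: (wp_seq (r1 := L) (r2 := L)); apply: wp_square_prog => //.
- rewrite A2 /stack /= cats0; congr rowmajor.
  by apply: funext => i; apply: funext => j; rewrite /adj_levels /= Hadj.
- by rewrite F2 // F1 // ve.
move=> m3 F3 A3 P3.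
have c3 : consts m3 by apply: consts_frame c2; apply: F3.
apply: (wp_seq (r1 := 0) (k1 := n * n)); apply: (@wp_append_rowmajor _ _ _ n (D_ 0)) => //.
- by case: c3.
- by rewrite F3 // F2 // F1 // ve // (leq_trans n2B).
- move=> i j m4 z F4 h6 _; split; last by apply: leq_trans nB; apply: dist_level_le.
  rewrite !evE h6 F4 // A3 /sv !F4 // -!/(sv _ _); case: c3 => _ _ -> -> /=.
  by rewrite -[stack _ _]cats0 nth_stack.
move=> m4 F4 D4.
have c4 : consts m4 by apply: consts_frame c3; apply: F4.
apply: wp_seq_noquery; apply: wp_unsquare_prog => //.
- by rewrite F4.
- by rewrite F4.
- by rewrite D4 F3 // F2 // F1 // ve // /stack /= cats0.
move=> m5 F5 D5.
have c5 : consts m5 by apply: consts_frame c4; apply: F5.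
have E1 : m5 1 = [::] by rewrite F5 // F4 // F3 // F2 // F1 // ve.
apply: (@wp_append_rowmajor _ _ _ n dist_code) => //.
- by case: c5.
- by rewrite E1.
- move=> i j m6 z F6 h6 _; split; last first.
    have := dist_level_le i j (leqnn L); rewrite /dist_code.
    have B2 : n + 2 <= B by apply: leq_trans B_big; clear; nia.
    by case: (i == j); case: (0 < _); move: B2; clear; lia.
  have v2' : sv m6 2 = n by rewrite /sv F6 //; case: c5.
  transitivity (eval m6 (eq_index 6 2) + (eval m6 (16.[$4 * $3 + $6])%X +
    (1 <= eval m6 (16.[$4 * $3 + $6])%X))); first by [].
  rewrite (eval_eq_index v2' h6) !evE h6 F6 // D5 /sv !F6 // -!/(sv _ _).
  by case: c5 => _ _ -> -> /=; rewrite -[stack _ _]cats0 nth_stack.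
by move=> m6 _ ->; rewrite E1.
Qed.

End Seidel.

(** * All nodes shortest cycles from distances *)

(** The tail accommodates the matrix of predecessors in an APSP answer. It is bounded in length and
    in its entries because a caller pays for copying it and has to store it. *)
Definition DIST : graph_problem := fun G out =>
  exists (D : 'I_(nv G) -> 'I_(nv G) -> option nat) tl,
  [/\ out = rowmajor (fun x y => code (D x y)) ++ tl, size tl <= nv G * nv G,
      all (fun v => v <= nv G) tl & forall x y, is_distance x y (D x y)].

Lemma APSP_DIST G out : APSP G out -> DIST G out.
Proof.
move=> [D [Last [-> HD HL]]]; eexists; eexists; split; [by []| | |exact: HD].
  by rewrite size_rowmajor.
by apply: all_rowmajor => x y; case: (Last x y) => //= z.
Qed.

Lemma distance_code_le G (x y : 'I_(nv G)) o : is_distance x y o -> code o <= nv G.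
Proof.
case: o => [d|] //= [p [Hp lp Hmin] <-].
case/shortenP: (Hp) lp => p' Hp' Up' _ lp'.
apply: leq_ltn_trans (Hmin p' Hp' lp') _.
rewrite -[X in _ < X]card_ord; apply: leq_trans (max_card (mem (x :: p'))).
by rewrite (card_uniqP Up').
Qed.

Lemma ne_le G : ne G <= nv G * nv G.
Proof. by rewrite -{1 2}[nv G]card_ord -card_prod; apply: max_card. Qed.

Definition flat_edges N (l : seq ('I_N * 'I_N)) : seq nat :=
  flatten [seq [:: nat_of_ord p.1; nat_of_ord p.2] | p <- l].

Lemma size_flat_edges N (l : seq ('I_N * 'I_N)) : size (flat_edges l) = 2 * size l.
Proof. by elim: l => //= p l IH; rewrite -[flatten _]/(flat_edges l) IH; lia. Qed.

Lemma flat_edges_cat N (l1 l2 : seq ('I_N * 'I_N)) :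
  flat_edges (l1 ++ l2) = flat_edges l1 ++ flat_edges l2.
Proof. by rewrite /flat_edges map_cat flatten_cat. Qed.

(* Arrays: 2, 3, 4, 8, 9 hold n, n^2, the number of bits, m and 2n; 5 holds
   [2 ^ i] for the current bit [i]; 13 is the question, 14 and 15 are the
   answers for the vertices with [i]-th bit 0 and 1; the output array 1 holds
   the best values found so far, plus one. *)
Definition bit_expr (e : expr) : expr := (e / $5 - e / $5 / #2 * #2)%X.

Definition test_expr (j : bool) (e : expr) : expr :=
  if j then bit_expr e else (#1 - bit_expr e)%X.

(** The number of edges of the layered graph is known only after they have been written. A 0 holds
    its place and is replaced in the end by a count taken from the array length. *)
Definition build_query (j : bool) : cmd :=
  (Clear 13 ;; Push 13 ($9) ;; Push 13 (#0) ;;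
   For 6 8
     (11 ::= 0.[#2 + $6 * #2] ;; 12 ::= 0.[#3 + $6 * #2] ;;
      Push 13 ($2 + $11) ;; Push 13 ($2 + $12) ;;
      If (test_expr j ($12)) (Push 13 ($11) ;; Push 13 ($2 + $12)) Skip ;;
      If (test_expr j ($11)) (Push 13 ($12) ;; Push 13 ($2 + $11)) Skip) ;;
   Assign 13 (#1) ((Len 13 - #2) / #2))%ram.

(** Only one quarter of each answer is read, rows of left copies [z] against columns [n + u] of
    right copies, in a matrix of width 2n. A 0 in the output array means that no candidate has been
    found. *)
Definition update_best : cmd :=
  (For 6 3
     (10 ::= 14.[$6 / $2 * $9 + ($2 + rem_expr 6 2)] ;;
      11 ::= 15.[$6 / $2 * $9 + ($2 + rem_expr 6 2)] ;;
      If ((#1 - eq_index 6 2) * ((#1 <= $10) * ((#1 <= $11) *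
           (($10 <= $11 + #1) * ($11 <= $10 + #1)))))
         (16 ::= $10 + $11 - #1 ;;
          If ((1.[$6 / $2] <= #0) + ($16 + #1 <= 1.[$6 / $2]))
             (Assign 1 ($6 / $2) ($16)) Skip)
         Skip))%ram.

Definition ask_layer (j : bool) (b : nat) : cmd := (build_query j ;; Query 13 b)%ram.

Definition ansc_prog : cmd :=
  (2 ::= 0.[#0] ;; 8 ::= 0.[#1] ;; 3 ::= $2 * $2 ;; 9 ::= $2 + $2 ;;
   Assign 1 ($2 - #1) (#0) ;;
   lg_prog ;; 5 ::= #1 ;;
   For 7 4
     (ask_layer false 14 ;; ask_layer true 15 ;;
      update_best ;; 5 ::= $5 * #2))%ram.

Section Reduction.
Variables (G : ugraph) (O : seq nat -> seq nat) (B : nat).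
Notation n := (nv G).
Notation L := (up_log 2 n).
Hypothesis B_big : (n + 2) ^ 4 <= B.
Hypothesis O_dist : forall H s, encodes H s -> DIST H (O s).
Variable es : seq ('I_n * 'I_n).
Hypothesis size_es : size es = ne G.
Hypothesis adj_es : forall u v, adj u v = ((u, v) \in es) || ((v, u) \in es).

Definition graph_query (q : seq nat) : Prop :=
  exists H, [/\ encodes H q, nv H <= 2 * n & ne H <= 3 * ne G].

Notation wpM := (wp O B graph_query).

Let n_gt0 : 0 < n := nv_gt0 G.
Let L_le : L <= n := leq_up_log2 n.

Lemma bound_sq c : c <= 8 * (n * n) + 8 -> c <= B.
Proof. by move=> Hc; apply: leq_trans Hc (leq_trans _ B_big); move: n_gt0; clear; nia. Qed.

Definition layer_pred i j : pred 'I_n := fun a => bit i a == j.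

Definition layer_query i j : seq nat :=
  (n + n) :: ne (layers (layer_pred i j)) :: flat_edges (layer_edges (layer_pred i j) es).

Lemma layer_query_encodes i j : encodes (layers (layer_pred i j)) (layer_query i j).
Proof.
exists (layer_edges (layer_pred i j) es); split => //.
  exact: size_layer_edges.
exact: layer_edges_adj.
Qed.

Lemma ne_layers i j : ne (layers (layer_pred i j)) <= 3 * ne G.
Proof. by rewrite -(@size_layer_edges _ _ es) // -size_es size_layer_edges_le. Qed.

Lemma layer_query_good i j : graph_query (layer_query i j).
Proof.
exists (layers (layer_pred i j)); split; first exact: layer_query_encodes.
  by rewrite mul2n -addnn.
exact: ne_layers.
Qed.

Lemma size_layer_query i j : size (layer_query i j) <= 2 + 6 * ne G.
Proof.
rewrite /= size_flat_edges (size_layer_edges _ adj_es size_es).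
by have := ne_layers i j; clear; lia.
Qed.

Definition layer_code i j (z u : 'I_n) : nat :=
  nth 0 (O (layer_query i j)) (z * (n + n) + (n + u)).

(** On 2n vertices the distances fill [4 * (n * n)] words, and the tail at most as many. *)
Lemma layer_answer i j :
  [/\ size (O (layer_query i j)) <= 8 * (n * n),
      all (fun v => v <= n + n) (O (layer_query i j))
    & hop_codes (layer_code) i].
Proof.
have HD j' := O_dist (layer_query_encodes i j').
split.
- have [D [tl [-> Hs Ha HDist]]] := HD j.
  by rewrite size_cat size_rowmajor; move: Hs; rewrite /=; clear; nia.
- have [D [tl [-> Hs Ha HDist]]] := HD j.
  rewrite all_cat Ha andbT; apply: all_rowmajor => x y.
  exact: distance_code_le (HDist x y).
- move=> j' z u; rewrite /layer_code.
  have [D [tl [-> Hs Ha HDist]]] := HD j'.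
  have -> : z * (n + n) + (n + u) = lshift n z * (n + n) + rshift n u by [].
  rewrite nth_cat size_rowmajor rowmajor_lt rowmajor_nth.
  by have := hop_distance (HDist (lshift n z) (rshift n u)); case: (D _ _).
Qed.

Definition mconsts (m : Defs.mem) :=
  [/\ m 99 = [::], sv m 2 = n, sv m 3 = n * n, sv m 4 = L & [/\ sv m 8 = ne G, sv m 9 = n + n
    & m 0 = n :: ne G :: flat_edges es]].

Lemma mconsts_frame m m1 : (forall a, a \in [:: 0; 2; 3; 4; 8; 9; 99] -> m1 a = m a) ->
  mconsts m -> mconsts m1.
Proof. by move=> F; rewrite /mconsts /sv !F. Qed.

Lemma eval_test m j e i (v : nat) : sv m 5 = 2 ^ i -> eval m e = v ->
  eval m (test_expr j e) = (bit i v == j).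
Proof.
move=> H5 He; have E : eval m (bit_expr e) = bit i v.
  by rewrite /bit_expr !evE He H5 /= -modn_sub modn2.
case: j; first by rewrite E; case: (bit i v).
have -> : eval m (test_expr false e) = 1 - eval m (bit_expr e) by [].
by rewrite E; case: (bit i v).
Qed.

Lemma wp_build_query j i m (Q : Defs.mem -> Prop) : mconsts m -> sv m 5 = 2 ^ i ->
  (forall m1, (forall c, c \notin [:: 6; 11; 12; 13] -> m1 c = m c) ->
     m1 13 = layer_query i j -> Q m1) ->
  wpM (build_query j) m (ne G) 0 Q.
Proof.
move=> [c99 c2 c3 c4 [c8 c9 c0]] c5 HQ.
have n2B : n <= B by apply: bound_sq; clear; nia.
have nnB : n + n <= B by apply: bound_sq; clear; nia.
have B1 : 2 < B by apply: leq_trans B_big; clear; nia.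
have Hne := ne_le G.
(* One edge of [G] produces up to three layered edges, that is six further words. *)
have szB e : size ((n + n) :: 0 :: flat_edges (layer_edges (layer_pred i j) (take e es))) + 6 < B.
  rewrite /= size_flat_edges; apply: leq_trans B_big.
  have := size_layer_edges_le (layer_pred i j) (take e es).
  have : size (take e es) <= ne G by rewrite -size_es size_take_min geq_minr.
  by move: Hne n_gt0; clear; nia.
apply: wp_seq0; apply: wp_clear => //.
apply: wp_seq0; apply: wp_push; rewrite ?evE ?updE ?svE /= ?c9 //; first exact: ltnW (ltnW B1).
apply: wp_seq0; apply: wp_push; rewrite ?evE ?updE ?svE /= ?c9 //; first exact: ltnW.
apply: wp_seq_last.
apply: (wp_for (n := ne G) (k := 0) (r := 0) (I := fun e m' =>
  m' 13 = (n + n) :: 0 :: flat_edges (layer_edges (layer_pred i j) (take e es)))) => //.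
- by rewrite muln1.
- by rewrite muln0.
- by rewrite !updE /= take0.
- move=> e m1 He e1 F1 I1; rewrite -size_es in He.
  set x0 := (Ordinal n_gt0, Ordinal n_gt0).
  have w0 : m1 0 = m 0 by rewrite F1 // !updE.
  have w2 : sv m1 2 = n by rewrite /sv F1 // !updE.
  have w5 : sv m1 5 = 2 ^ i by rewrite /sv F1 // !updE.
  have [Eu Ev] := nth_flat_pairs (fun p : 'I_n * 'I_n => p.1 : nat) (fun p => p.2 : nat) x0 He.
  set u := (nth x0 es e).1 in Eu; set v := (nth x0 es e).2 in Ev.
  have ltB (k : 'I_n) : k <= B by apply: leq_trans n2B; apply: ltnW.
  have ltB2 (k : 'I_n) : n + k <= B by apply: leq_trans nnB; rewrite leq_add2l ltnW.
  have E1 : eval m1 (0.[#2 + $6 * #2])%X = u by rewrite !evE e1 w0 c0 /= add0n; exact: Eu.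
  have E2 m2 : m2 0 = m 0 -> sv m2 6 = e -> eval m2 (0.[#3 + $6 * #2])%X = v.
    by move=> h0 h6; rewrite !evE h6 h0 c0 /=; exact: Ev.
  have {}szB := szB e; rewrite -I1 in szB.
  have Etake : flat_edges (layer_edges (layer_pred i j) (take e.+1 es)) =
      flat_edges (layer_edges (layer_pred i j) (take e es)) ++
      flat_edges (layer_edges_of (layer_pred i j) (u, v)).
    rewrite (take_nth x0 He) -cats1 /layer_edges map_cat flatten_cat flat_edges_cat /= cats0.
    by rewrite /u /v; case: (nth x0 es e).
  apply: wp_seq0; apply: wp_setv; rewrite E1 //.
  apply: wp_seq0; apply: wp_setv; rewrite E2 ?svE ?updE //.
  apply: wp_seq0; apply: wp_push; rewrite ?evE ?updE ?svE /= ?nth_set_nth /= ?w2 //.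
    by move: szB; clear; lia.
  apply: wp_seq0; apply: wp_push; rewrite ?evE ?updE ?svE /= ?nth_set_nth /= ?w2 ?size_rcons //.
    by move: szB; clear; lia.
  set m2 := upd _ 13 _.
  have v2 : sv m2 2 = n by rewrite /m2 !svE.
  have v5 : sv m2 5 = 2 ^ i by rewrite /m2 !svE.
  have v11 : sv m2 11 = u by rewrite /m2 !svE /= nth_set_nth.
  have v12 : sv m2 12 = v by rewrite /m2 !svE /= nth_set_nth.
  have v13 : m2 13 = m1 13 ++ [:: n + u; n + v] by rewrite /m2 !updE /= -!cats1 -catA.
  clearbody m2.
  apply: (@wp_seq0 _ _ _ 0 0).
  (* Both branches of the first conditional are summed up in one description of the memory, so that
     the second conditional is treated only once. *)
  apply: (@wp_conseq _ _ _ 0 0 (fun m3 => [/\ forall a, a != 13 -> m3 a = m2 a &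
      m3 13 = m2 13 ++ (if bit i v == j then [:: val u; n + v] else [::])])) => //.
    apply: wp_if; rewrite (@eval_test _ _ _ i v) ?evE //; case Hb: (bit i v == j) => //= _.
      apply: wp_seq0; apply: wp_push; rewrite ?evE ?v11 ?v13 ?size_cat //=.
        by move: szB; clear; lia.
      apply: wp_push; rewrite ?evE ?updE ?svE /= ?v12 ?v2 ?size_rcons ?v13 ?size_cat //=.
        by move: szB; clear; lia.
      split; first by move=> a /negPf Ha; rewrite !updE Ha.
      by rewrite ?Hb ?updE /= -!cats1 -!catA.
    by apply: wp_skip; rewrite ?Hb; split; rewrite ?cats0.
  move=> m3 _ [F3 E3].
  have x2 : sv m3 2 = n by rewrite /sv F3.
  have x5 : sv m3 5 = 2 ^ i by rewrite /sv F3.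
  have x11 : sv m3 11 = u by rewrite /sv F3.
  have x12 : sv m3 12 = v by rewrite /sv F3.
  have sz3 : size (m3 13) <= size (m1 13) + 4.
    by rewrite E3 v13 !size_cat; case: ifP => _ /=; clear; lia.
  have E13 : forall z, z = (if bit i u == j then [:: val v; n + u] else [::]) ->
      m3 13 ++ z = (n + n) :: 0 :: flat_edges (layer_edges (layer_pred i j) (take e.+1 es)).
    move=> z ->; rewrite E3 v13 I1 Etake /= -!catA; congr (_ :: _ :: (_ ++ _)).
    rewrite /layer_edges_of /layer_pred /flat_edges /=; congr (_ :: _ :: _).
    by case: (bit i v == j); case: (bit i u == j).
  apply: wp_if; rewrite (@eval_test _ _ _ i u) ?evE //; case Hb: (bit i u == j) => //= _.
    apply: wp_seq0; apply: wp_push; rewrite ?evE ?x12 //.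
      by move: szB sz3; clear; lia.
    apply: wp_push; rewrite ?evE ?updE ?svE /= ?x11 ?x2 ?size_rcons //.
      by move: szB sz3; clear; lia.
    by rewrite ?updE /= -(E13 [:: val v; n + u]) ?Hb // -!cats1 -!catA.
  by apply: wp_skip; rewrite !updE /= -[m3 13]cats0; apply: E13; rewrite Hb.
- move=> m1 F1; rewrite -size_es take_size => I1.
  have S13 : eval m1 ((Len 13 - #2) / #2)%X = ne (layers (layer_pred i j)).
    rewrite !evE I1 /= size_flat_edges (size_layer_edges _ adj_es size_es).
    by rewrite -addn2 addnK mulKn.
  apply: wp_assign; rewrite ?S13 ?evE //; first exact: ltnW.
    by have := ne_layers i j; move: (ne_le G) => A1 A2; apply: bound_sq; move: A1 A2; clear; nia.
  apply: HQ; last by rewrite !updE /= I1.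
  move=> c Hc; have := Hc; rewrite !inE !negb_or => /and4P[_ _ _ /negPf H13].
  by rewrite updE H13 (@frame_sub _ _ _ [:: 6; 11; 12; 13] _ F1 c Hc) // !updE !H13.
Qed.

(* The candidates for [z] seen after [i] bits and [t] entries of the pair of
   answers for the next bit. *)
Definition seen i t (z : 'I_n) v := exists i' (u : 'I_n),
  [/\ u != z, candidate (layer_code i' false z u) (layer_code i' true z u),
      v = layer_code i' false z u + layer_code i' true z u - 1
    & (i' < i) || ((i' == i) && (z * n + u < t))].

Definition best_of (K : 'I_n -> nat -> Prop) (out : seq nat) := size out = n /\
  forall z : 'I_n, (forall v, K z v -> 0 < nth 0 out z <= v) /\
    (0 < nth 0 out z -> K z (nth 0 out z)).

Lemma best_of_eq K K' out : (forall z v, K z v <-> K' z v) -> best_of K out -> best_of K' out.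
Proof.
move=> E [Hs H]; split=> // z; have [H1 H2] := H z; split=> [v /E|/H2 /E //]; exact: H1.
Qed.

Lemma seenS i (z u : 'I_n) z' v : seen i (z * n + u).+1 z' v <->
  seen i (z * n + u) z' v \/ [/\ z' = z, u != z,
    candidate (layer_code i false z u) (layer_code i true z u)
    & v = layer_code i false z u + layer_code i true z u - 1].
Proof.
split.
- move=> [i' [u' [uz Hc Ev H]]]; move: H.
  rewrite [_ + _ < _]ltnS [_ + _ <= _]leq_eqVlt rowmajor_index_eq andb_orr orbCA => /orP[|H].
    by move=> /and3P[/eqP Ei /eqP Ez /eqP Eu]; subst; right.
  by left; exists i', u'.
- move=> [[i' [u' [uz Hc Ev H]]]|[-> uz Hc Ev]].
    exists i', u'; split => //; case/orP: H => [->//|/andP[-> Ht]] /=.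
    by rewrite (leqW Ht) orbT.
  by exists i, u; split => //; rewrite eqxx ltnSn orbT.
Qed.

Lemma wp_update_best i m (Q : Defs.mem -> Prop) : mconsts m ->
  m 14 = O (layer_query i false) -> m 15 = O (layer_query i true) ->
  best_of (seen i 0) (m 1) ->
  (forall m1, (forall c, c \notin [:: 1; 6; 10; 11; 16] -> m1 c = m c) ->
     best_of (seen i.+1 0) (m1 1) -> Q m1) ->
  wpM update_best m (n * n) 0 Q.
Proof.
move=> [c99 c2 c3 c4 [c8 c9 c0]] m14 m15 m1 HQ.
apply: (wp_for (n := n * n) (k := 0) (r := 0) (I := fun t m' =>
  best_of (seen i t) (m' 1))) => //.
- by rewrite muln1.
- by rewrite muln0.
- move=> t m2 Ht t2 F2 I2; have [z [u Et]] := rowmajor_index Ht.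
  rewrite Et in t2 I2 *.
  have w2 : sv m2 2 = n by rewrite /sv F2.
  have w9 : sv m2 9 = n + n by rewrite /sv F2.
  have code_le j : layer_code i j z u <= n + n.
    rewrite /layer_code; case: (ltnP (z * (n + n) + (n + u)) (size (O (layer_query i j)))) => H.
      by have [_ /allP Ha _] := layer_answer i j; apply: Ha; apply: mem_nth.
    by rewrite nth_default.
  have nnB : n + n + (n + n) <= B by apply: bound_sq; clear; nia.
  have codeB j : layer_code i j z u <= B by apply: leq_trans (code_le j) (leq_trans _ nnB); exact: leq_addr.
  set e0 := layer_code i false z u; set e1 := layer_code i true z u.
  have zi : eval m2 ($6 / $2)%X = z by rewrite !evE w2 t2 /= rowmajor_div.
  have ri : eval m2 (rem_expr 6 2) = u by rewrite eval_rem w2 t2 rowmajor_mod.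
  have E0 : eval m2 (14.[$6 / $2 * $9 + ($2 + rem_expr 6 2)])%X = e0.
    by rewrite !(eval_rem, evE) w2 w9 t2 F2 // m14 /= rowmajor_div rowmajor_mod.
  have E1 m3 : (forall c, c != 10 -> m3 c = m2 c) ->
      eval m3 (15.[$6 / $2 * $9 + ($2 + rem_expr 6 2)])%X = e1.
    move=> F3; rewrite !(eval_rem, evE) /sv !F3 // -!/(sv _ _).
    by rewrite w2 w9 t2 F2 // m15 /= rowmajor_div rowmajor_mod.
  apply: wp_seq0; apply: wp_setv; rewrite E0; first exact: codeB.
  set m2' := upd m2 10 _.
  have F2' c : c != 10 -> m2' c = m2 c by move=> /negPf Hc; rewrite /m2' updE Hc.
  have v10' : sv m2' 10 = e0 by rewrite /m2' sv_set.
  clearbody m2'.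
  apply: wp_seq0; apply: wp_setv; rewrite (E1 _ F2'); first exact: codeB.
  set m3 := upd _ 11 _.
  have F3 c : c != 10 -> c != 11 -> m3 c = m2 c.
    by move=> H1 /negPf H2; rewrite /m3 updE H2 F2'.
  have v10 : sv m3 10 = e0 by rewrite /m3 svE.
  have v11 : sv m3 11 = e1 by rewrite /m3 !svE /= nth_set_nth.
  clearbody m3.
  have v2 : sv m3 2 = n by rewrite /sv F3.
  have v6 : sv m3 6 = z * n + u by rewrite /sv F3.
  have Ecand : eval m3 ((#1 - eq_index 6 2) * ((#1 <= $10) * ((#1 <= $11) *
      (($10 <= $11 + #1) * ($11 <= $10 + #1)))))%X = (z != u) && candidate e0 e1.
    transitivity ((1 - eval m3 (eq_index 6 2)) * eval m3 ((#1 <= $10) * ((#1 <= $11) *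
      (($10 <= $11 + #1) * ($11 <= $10 + #1))))%X); first by [].
    rewrite (eval_eq_index v2 v6) !evE v10 v11 /= !addn1 !mulnb.
    by case: (z == u); rewrite ?mul0n //= mul1n.
  (* An entry may stay as it is for two reasons: the pair gives no candidate, or the value already
     stored is no larger. *)
  have keep : ~~ ((z != u) && candidate e0 e1) \/ (0 < nth 0 (m2 1) z <= e0 + e1 - 1) ->
      best_of (seen i (z * n + u).+1) (m2 1).
    move=> Hk; case: I2 => Hs I2; split=> // z'; have [H1 H2] := I2 z'.
    split=> [v /seenS[|[-> uz Hc ->]]|/H2 Hv]; [exact: H1| |by apply/seenS; left].
    by case: Hk => // /negP[]; rewrite eq_sym uz.
  apply: wp_if; rewrite Ecand; last first.
    move=> /eqP; rewrite eqb0 => Hk; apply: wp_skip; rewrite !updE /= F3 //.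
    by apply: keep; left.
  case Hc: ((z != u) && candidate e0 e1) => // _.
  have [/andP[zu Hcand]] : (z != u) && candidate e0 e1 by [].
  apply: wp_seq0; apply: wp_setv; rewrite !evE v10 v11 /=.
    apply: leq_trans nnB; apply: leq_trans (leq_subr _ _) _.
    by apply: leq_add; apply: code_le.
  set m4 := upd _ 16 _.
  have v16 : sv m4 16 = e0 + e1 - 1 by rewrite /m4 svE /= nth_set_nth.
  have F4 c : c \notin [:: 10; 11; 16] -> m4 c = m2 c.
    rewrite !inE !negb_or => /and3P[H1 H2 /negPf H3]; by rewrite /m4 updE H3 F3.
  clearbody m4.
  have zi4 : eval m4 ($6 / $2)%X = z by rewrite -zi !evE /sv !F4.
  have s1 : size (m2 1) = n by case: I2.
  have cpos : 0 < e0 + e1 - 1 by move: Hcand => /and4P[]; clear; lia.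
  have Econd : eval m4 ((1.[$6 / $2] <= #0) + ($16 + #1 <= 1.[$6 / $2]))%X =
      (nth 0 (m2 1) z <= 0) + (e0 + e1 - 1 < nth 0 (m2 1) z).
    transitivity ((nth 0 (m4 1) (eval m4 ($6 / $2)%X) <= 0) +
      (sv m4 16 + 1 <= nth 0 (m4 1) (eval m4 ($6 / $2)%X))); first by [].
    by rewrite zi4 v16 F4 // addn1.
  apply: wp_if; rewrite Econd => Hcond; last first.
    apply: wp_skip; rewrite !updE /= F4 //; apply: keep; right.
    by move: Hcond; clear; lia.
  have zB : z < B by apply: leq_trans (ltn_ord z) (leq_trans _ nnB); clear; lia.
  apply: wp_assign; rewrite ?zi4 ?evE ?v16 //.
    by apply: leq_trans nnB; apply: leq_trans (leq_subr _ _) _; apply: leq_add; apply: code_le.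
  rewrite !updE /= F4 //; case: I2 => Hs I2; split.
    by rewrite size_set_nth Hs; apply/maxn_idPr; exact: ltn_ord.
  move=> z'; have [H1 H2] := I2 z'; rewrite nth_set_nth /=.
  case: (eqVneq (nat_of_ord z') z) => [/val_inj Ez|zz]; last first.
    split=> [v /seenS[|[Ez]]|/H2 Hv]; [exact: H1| |by apply/seenS; left].
    by rewrite Ez eqxx in zz.
  subst z'; split=> [v /seenS[/H1 Hv|[_ _ _ ->]]|_].
  + by move: Hcond Hv cpos; clear; lia.
  + by rewrite cpos leqnn.
  + by apply/seenS; right; split => //; rewrite eq_sym.
- move=> m2 F2 I2; apply: HQ; first exact: frame_sub F2.
  (* Having seen all [n * n] entries for bit [i] is the same as having seen none for bit [i.+1]. *)
  apply: best_of_eq I2 => z v; split=> [[i' [u [uz Hc Ev H]]]|[i' [u [uz Hc Ev H]]]].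
    exists i', u; split => //; rewrite ltnS leq_eqVlt.
    by case/orP: H => [->|/andP[-> _]]; rewrite ?orbT.
  exists i', u; split => //; move: H; rewrite ltn0 andbF orbF ltnS leq_eqVlt.
  by rewrite rowmajor_lt andbT orbC.
Qed.

(** A single candidate only promises a cycle that is at most as long. For the least candidate
    completeness supplies the reverse inequality, and so the value is exact. *)
Lemma best_ANSC out : best_of (seen L 0) out -> ANSC G out.
Proof.
move=> [Hs H].
have HE i : hop_codes (layer_code) i by case: (layer_answer i false).
pose Len (v : 'I_n) := if nth 0 out v is d.+1 then Some d else None.
have ELen v : code (Len v) = nth 0 out v by rewrite /Len; case: (nth 0 out v).
exists Len; split.
  rewrite (eq_map ELen) (map_comp (nth 0 out) val) val_enum_ord -Hs.
  exact/esym/mkseq_nth.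
have complete z c : cycle_through z c -> exists v, seen L 0 z v /\ v <= (size c).+1.
  move=> Hc; have [i [u [Hi uz Hcand Hle]]] :=
    candidate_complete (up_logP n (ltnSn 1)) (fun i _ => HE i) Hc.
  by eexists; split; [exists i, u; split; [exact: uz|exact: Hcand|by []|rewrite Hi]|].
move=> z; have [H1 H2] := H z; rewrite /Len.
case: (nth 0 out z) H1 H2 => [|d] H1 H2 /=.
  by move=> [c /complete[v [/H1]]].
have [i [u [uz Hcand Ed _]]] := H2 isT.
have [c Hc] := candidate_sound (HE i) uz Hcand; rewrite -Ed ltnS => Hcd.
have Hmin c' : cycle_through z c' -> d <= size c'.
  by move=> /complete[v [/H1 /= Hv Hvc]]; exact: leq_trans Hv Hvc.
by split => //; exists c => //; apply/eqP; rewrite eqn_leq Hcd Hmin.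
Qed.

(** The count covers at most [n * n] rounds of building, a question of at most [2 + 6 * ne G] words
    with [ne G <= n * n], and an answer of at most [8 * (n * n)] words. *)
Lemma wp_ask_layer i j b m (Q : Defs.mem -> Prop) : mconsts m -> sv m 5 = 2 ^ i ->
  b \notin [:: 0; 2; 3; 4; 5; 8; 9; 99] ->
  (forall m1, (forall c, c \notin [:: 6; 11; 12; 13; b] -> m1 c = m c) ->
     m1 b = O (layer_query i j) -> Q m1) ->
  wpM (ask_layer j b) m (16 * (n * n) + 3) 1 Q.
Proof.
move=> Hc H5 Hb HQ; have Hne := ne_le G.
apply: (@wp_conseq _ _ _ (ne G + (15 * (n * n) + 3)) (0 + 1) Q) => //; last by move: Hne; clear; lia.
apply: wp_seq; apply: (@wp_build_query j i) => // m1 F1 E1.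
have [Hs Ha _] := layer_answer i j.
apply: (@wp_conseq _ _ _ (size (m1 13) + size (O (m1 13)) + 1) 1 Q) => //; last first.
  rewrite E1; move: (size_layer_query i j) Hs Hne; clear; lia.
apply: wp_query; rewrite E1.
- exact: layer_query_good.
- by apply: leq_trans Hs _; apply: bound_sq; clear; lia.
- apply: sub_all Ha => v /leq_trans; apply; apply: bound_sq; clear; nia.
apply: HQ; last by rewrite updE eqxx.
move=> c; rewrite !inE !negb_or => /and5P[A1 A2 A3 A4 /negPf A5].
by rewrite updE A5 F1 // !inE !negb_or A1 A2 A3 A4.
Qed.

Lemma wp_ansc_prog s : s = n :: ne G :: flat_edges es ->
  wpM ansc_prog (load s) (n + L * (33 * (n * n) + 7)) (L * 2) (fun m => ANSC G (m 1)).
Proof.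
move=> Es; have Hne := ne_le G.
have nnB : n + n <= B by apply: bound_sq; clear; nia.
have n2B : n * n <= B by apply: bound_sq; clear; nia.
have nB : n <= B by apply: bound_sq; clear; nia.
have B0 : 1 < B by apply: leq_trans B_big; clear; nia.
apply: wp_seq0; apply: wp_setv; rewrite ?evE ?updE /= ?Es //=.
apply: wp_seq0; apply: wp_setv; rewrite ?evE ?updE /= ?Es /= ?(leq_trans Hne) //=.
apply: wp_seq0; apply: wp_setv; rewrite ?evE ?svE /= ?nth_set_nth //=.
apply: wp_seq0; apply: wp_setv; rewrite ?evE ?svE /= ?nth_set_nth //=.
apply: wp_seq0; apply: wp_assign; rewrite ?evE ?svE /= ?nth_set_nth //=.
  by apply: leq_trans nB; move: n_gt0; clear; lia.
set m0 := upd _ 1 _; rewrite -Es in m0 *.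
have v0 : m0 0 = s by [].
have v2 : sv m0 2 = n by rewrite /sv /m0 !updE.
have v3 : sv m0 3 = n * n by rewrite /sv /m0 !updE.
have v8 : sv m0 8 = ne G by rewrite /sv /m0 !updE.
have v9 : sv m0 9 = n + n by rewrite /sv /m0 !updE.
have v99 : m0 99 = [::] by [].
(* The single write at index [n - 1] has filled the output with zeros. *)
have v1 : best_of (seen 0 0) (m0 1).
  rewrite /m0 !updE /=; split; first by rewrite size_set_nth; move: n_gt0; clear; rewrite /=; lia.
  move=> z; rewrite nth_set_nth /= nth_nil; case: eqP => _; split => //;
    by move=> v [i [u [_ _ _]]]; rewrite !ltn0 andbF.
clearbody m0.
apply: (wp_seq (r1 := 0)); apply: wp_lg_prog => //; first by rewrite mul2n -addnn.
move=> m1 F1 w4.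
have c1 : mconsts m1 by split => //; rewrite /sv ?F1 // -/(sv _ _) ?v0 // Es.
apply: wp_seq0; apply: wp_setv; rewrite !evE; first exact: ltnW.
set m2 := upd _ 5 _.
have F2 c : c != 5 -> m2 c = m1 c by move=> /negPf Hc; rewrite /m2 updE Hc.
have c2 : mconsts m2.
  by apply: mconsts_frame c1 => c Hc; apply: F2; apply: contraTneq Hc => ->.
have w5 : sv m2 5 = 1 by rewrite /m2 sv_set.
have w1 : best_of (seen 0 0) (m2 1) by rewrite F2 // F1.
clearbody m2.
(* Two questions at [16 * (n * n) + 3] each and one update at [n * n]. *)
apply: (wp_for (n := L) (k := 33 * (n * n) + 6) (r := 2) (I := fun i m' =>
  best_of (seen i 0) (m' 1) /\ sv m' 5 = 2 ^ i)) => //.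
- by rewrite -addnS.
- by case: c2.
- move=> i m3 Hi i3 F3 [I3 H5].
  have c3 : mconsts m3.
    by apply: mconsts_frame c2; apply: frame_in F3.
  have lt2n : 2 ^ i < n.
    by rewrite ltnNge; apply/negP => /(up_log_min (ltnSn 1)); rewrite leqNgt Hi.
  have -> : 33 * (n * n) + 6 = 16 * (n * n) + 3 + (16 * (n * n) + 3 + n * n) by clear; lia.
  apply: (wp_seq (r1 := 1) (r2 := 1)); apply: (@wp_ask_layer i) => // m4 F4 E4.
  have c4 : mconsts m4 by apply: mconsts_frame c3; apply: frame_in F4.
  have H5' : sv m4 5 = 2 ^ i by rewrite /sv F4.
  apply: (wp_seq (r1 := 1) (r2 := 0)); apply: (@wp_ask_layer i) => // m5 F5 E5.
  have c5 : mconsts m5 by apply: mconsts_frame c4; apply: frame_in F5.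
  apply: wp_seq_last; apply: (@wp_update_best i) => //.
  + by rewrite F5.
  + by rewrite F5 // F4.
  move=> m6 F6 I6; have H6 : sv m6 5 = 2 ^ i by rewrite /sv F6 // F5.
  apply: wp_setv; rewrite !evE H6 /=.
    by apply: leq_trans nnB; rewrite muln2 -addnn leq_add // ltnW.
  by rewrite !updE /= !svE /= nth_set_nth /= expnSr.
- by move=> m3 _ [I3 _]; apply: best_ANSC.
Qed.

End Reduction.

(** * Time bounds *)

Lemma lg_gt0 n : 0 < lg n. Proof. by []. Qed.

Lemma up_log2_lg n : up_log 2 n <= lg n.
Proof. by apply: up_log_min => //; apply: ltnW; apply: trunc_log_ltn. Qed.

Lemma leq_lg a b : a <= b -> lg a <= lg b.
Proof. exact: leq_bits. Qed.

Lemma lg_mul a b : lg (a * b) <= lg a + lg b.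
Proof.
case: (posnP (a * b)) => [->|ab0]; first by rewrite /lg trunc_log0 addSn.
rewrite /lg -(ltn_exp2l _ _ (ltnSn 1)); apply: leq_ltn_trans (trunc_logP (ltnSn 1) ab0) _.
by rewrite expnD; apply: ltn_mul; apply: trunc_log_ltn.
Qed.

Lemma lg_expn a k : 0 < k -> lg (a ^ k) <= k * lg a.
Proof.
case: k => // k _; elim: k => [|k IH]; first by rewrite expn1 mul1n.
by rewrite expnS mulSn; apply: leq_trans (lg_mul _ _) _; rewrite leq_add2l.
Qed.

Lemma lg_le n : 0 < n -> lg n <= n.
Proof.
move=> n0; rewrite /lg; apply: leq_trans (ltn_expl _ (ltnSn 1)) _.
exact: trunc_logP.
Qed.

(** The fourth power contributes a factor 4, and [n + 2 <= 4 * n] another 4, since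
    [lg (4 * n) <= 3 + lg n <= 4 * lg n]. *)
Lemma bits_bound n : 0 < n -> bits ((n + 2) ^ 4) <= 16 * lg n.
Proof.
move=> n0; apply: leq_trans (lg_expn (n + 2) (isT : 0 < 4)) _.
have H : lg (n + 2) <= lg (4 * n) by apply: leq_lg; move: n0; clear; lia.
have := lg_mul 4 n; have -> : lg 4 = 3 by [].
by move: H (lg_gt0 n); clear; lia.
Qed.

(** One logarithm comes from the number of rounds, [L.+1 <= 2 * lg n], and one from the word length,
    [16 * lg n]; this explains 32. *)
Lemma ticks_bound c n L k a t : 0 < n -> L <= lg n ->
  k.+1 <= c * (L.+1 * (n * n)) -> t <= a * k.+1 * bits ((n + 2) ^ 4) ->
  t <= 32 * c * a * (lg n ^ 2 * n ^ 2).
Proof.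
move=> n0 HL Hk Ht; apply: leq_trans Ht _.
have Hb := bits_bound n0; have l0 := lg_gt0 n.
have HL1 : L.+1 <= 2 * lg n by move: HL l0; clear; lia.
have Hk2 : k.+1 <= c * ((2 * lg n) * (n * n)).
  by apply: leq_trans Hk _; rewrite !leq_mul.
apply: leq_trans (leq_mul (leq_mul (leqnn a) Hk2) Hb) _.
by rewrite !expnS !expn0; clear; lia.
Qed.

Lemma load_bnd G (es : seq ('I_(nv G) * 'I_(nv G))) s :
  size es = ne G -> s = nv G :: ne G :: flat_edges es ->
  1 < (nv G + 2) ^ 4 /\ bnd ((nv G + 2) ^ 4) (load s).
Proof.
move=> Hs Es; have Hne := ne_le G; have n0 := nv_gt0 G.
split; first by move: n0; clear; nia.
move=> a; rewrite /load updE; case: eqP => // _.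
rewrite Es /= size_flat_edges Hs; apply/and4P; split.
- by move: Hne n0; clear; nia.
- by clear; nia.
- by apply: leq_trans Hne _; clear; nia.
- have nB : nv G <= (nv G + 2) ^ 4 by clear; nia.
  elim: es {Hs Es} => //= p es IH; rewrite IH andbT.
  by rewrite !(leq_trans (ltnW (ltn_ord _)) nB).
Qed.

Lemma ansc_prog_run : exists c, forall O G s, encodes G s -> (forall H s', encodes H s' -> DIST H (O s')) ->
  exists out t q, [/\ oracle_runs O ansc_prog s out t q, ANSC G out,
    t <= c * (lg (nv G) ^ 2 * nv G ^ 2), size q <= 2 * lg (nv G)
    & forall s', s' \in q -> graph_query G s'].
Proof.
(* A round takes at most [33 * (n * n) + 7 <= 40 * (n * n)]; with 41, the work outside the rounds
   fits into the additional [n * n] terms of [L.+1]. *)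
exists (32 * 41 * csz ansc_prog) => O G s [es [Es Hs Hadj]] HO; have [B1 Hb] := load_bnd Hs Es; have n0 := nv_gt0 G.
have [m [t [q [E [_ Ht] Hq Hg Hm]]]] := wp_ansc_prog (leqnn _) HO Hs Hadj Es B1 Hb.
exists (m 1), t, q; split => //; first by exists m.
- apply: (@ticks_bound 41 _ (up_log 2 (nv G)) _ (csz ansc_prog)) Ht => //.
    exact: up_log2_lg.
  by move: (up_log 2 (nv G)) => L; move: n0; clear; nia.
- by apply: leq_trans Hq _; rewrite mulnC leq_mul2l up_log2_lg.
Qed.

Lemma seidel_run : exists c, forall O G s, encodes G s ->
  (forall F H : 'I_(nv G) -> 'I_(nv G) -> nat,
    (forall i j, F i j <= nv G) -> (forall i j, H i j <= nv G) ->
    O (nv G :: rowmajor F ++ rowmajor H) = rowmajor (fun i j => \sum_k F i k * H k j)) ->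
  exists out t q, [/\ oracle_runs O seidel s out t q, DIST G out,
    t <= c * (lg (nv G) ^ 2 * nv G ^ 2), size q <= 2 * lg (nv G)
    & forall s', s' \in q -> mm_query G s'].
Proof.
exists (32 * 41 * csz seidel) => O G s [es [Es Hs Hadj]] HO; have [B1 Hb] := load_bnd Hs Es; have n0 := nv_gt0 G.
have Hne := ne_le G.
have [m [t [q [E [_ Ht] Hq Hg Hm]]]] := wp_seidel (leqnn _) HO Hs Es Hadj Hne B1 Hb.
exists (m 1), t, q; split => //; first by exists m.
- have [D0 HD] := dist_levelP (up_logP (nv G) (ltnSn 1)) (@adj_sym G) (@adj_irr G) (leqnn _).
  rewrite subnn in HD.
  set D := dist_level _ _ _ in D0 HD *.
  pose Do x y := if x == y then Some 0 else if D x y is d.+1 then Some d.+1 else None.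
  exists Do, [::]; split => //.
    rewrite Hm cats0; congr rowmajor; apply: funext => x; apply: funext => y.
    rewrite /dist_code -/(D x y) /Do; case: eqP => [->|_]; first by rewrite D0.
    by case: (D x y) => //= d; rewrite addn1.
  move=> x y; rewrite /Do; case: (eqVneq x y) => [<-|xy].
    by exists [::] => //; split.
  have W d : within (@adj G) d x y = (0 < D x y <= d) by exact: HD.
  case: (D x y) W => [|d] W /=.
    move=> [p Hp lp]; have := W (size p).
    by have /withinP -> : exists p', [/\ path (@adj G) x p', last x p' = y & size p' <= size p]
      by exists p.
  have /withinP [p [Hp lp Hsp]] : within (@adj G) d.+1 x y by rewrite W leqnn.
  have Hmin p' : path (@adj G) x p' -> last x p' = y -> d.+1 <= size p'.
    move=> Hp' lp'; have : within (@adj G) (size p') x y by apply/withinP; exists p'.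
    by rewrite W.
  exists p; last by apply/eqP; rewrite eqn_leq Hsp Hmin.
  split => // p' Hp' lp'; exact: leq_trans Hsp (Hmin _ Hp' lp').
- apply: (@ticks_bound 41 _ (up_log 2 (nv G)) _ (csz seidel)) Ht => //.
    exact: up_log2_lg.
  by move: (up_log 2 (nv G)) Hne => L; move: n0; clear; nia.
- by apply: leq_trans Hq _; rewrite addnn -mul2n leq_mul2l up_log2_lg.
Qed.

Import Order.TTheory GRing.Theory Num.Theory.
Local Open Scope ring_scope.




(** * Polylogarithmic factors and the running time of an inlined reduction *)

Section Asymptotics.
Variable R : realType.
Implicit Types (f T : nat -> nat -> R) (C tau : R).

Lemma lg_ge1 n : 1 <= (lg n)%:R :> R.
Proof. by rewrite ler1n lg_gt0. Qed.

Lemma lgX_ge1 n k : 1 <= (lg n)%:R ^+ k :> R.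
Proof. by rewrite exprn_ege1 // lg_ge1. Qed.

Lemma lgX_le n k l : (k <= l)%N -> (lg n)%:R ^+ k <= (lg n)%:R ^+ l :> R.
Proof. by move=> kl; apply: ler_weXn2l kl; apply: lg_ge1. Qed.

Lemma le_polylog_norm C k n : polylog C k n <= polylog `|C| k n.
Proof. by rewrite /polylog ler_wpM2r ?ler_norm ?exprn_ge0. Qed.

Lemma polylog_ge0 C k n : 0 <= C -> 0 <= polylog C k n.
Proof. by move=> C0; rewrite /polylog mulr_ge0 ?exprn_ge0. Qed.

Lemma ler_polylog C C' k k' n : 0 <= C -> C <= C' -> (k <= k')%N ->
  polylog C k n <= polylog C' k' n.
Proof.
move=> C0 CC kk; rewrite /polylog ler_pM ?exprn_ge0 //; exact: lgX_le.
Qed.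

Lemma polylogM C C' k k' n : polylog C k n * polylog C' k' n = polylog (C * C') (k + k') n.
Proof. by rewrite /polylog mulrACA -exprD. Qed.

Definition nonneg f := forall m n, 0 <= f m n.

Lemma solves_Otilde_weaken A P T f C k : nonneg T -> nonneg f -> 0 <= C ->
  (forall m n, (0 < n)%N -> T m n <= polylog C k n * f m n) ->
  solves_Otilde A P T -> solves_Otilde A P f.
Proof.
move=> T0 f0 C0 HT [C1 [k1 [HA H]]]; exists (`|C1| * C), (k1 + k)%N; split => // G s HG.
have [out [t [Hr HP Ht]]] := H G s HG; exists out, t; split => //.
apply: le_trans Ht _; apply: le_trans (_ : _ <= polylog `|C1| k1 (nv G) * T (ne G) (nv G)) _.
  by apply: ler_wpM2r; [exact: T0|exact: le_polylog_norm].
rewrite -polylogM -mulrA; apply: ler_wpM2l; first exact: polylog_ge0.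
exact: HT (nv_gt0 G).
Qed.

(* The first half of [sparse_reduces]; it implies the second one. *)
Definition reduces_by M f (P Q : graph_problem) : Prop :=
  exists (C : R) (k : nat), forall O : seq nat -> seq nat,
    (forall G s, encodes G s -> Q G (O s)) ->
    forall G s, encodes G s ->
    exists out t q,
      [/\ oracle_runs O M s out t q, P G out,
          t%:R <= polylog C k (nv G) * f (ne G) (nv G),
          (size q)%:R <= polylog C k (nv G)
        & forall s', s' \in q -> exists H,
            [/\ encodes H s',
                (nv H)%:R <= polylog C k (nv G) * (nv G)%:R
              & (ne H)%:R <= polylog C k (nv G) * (ne G)%:R]].

(** The oracle has to be chosen per sequence, while the solver is specified per graph. By
    determinism the run found for one graph encoded by [s] serves every graph encoded by [s]. *)
Lemma solver_oracle A Q T : solves_within A Q T ->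
  exists (O : seq nat -> seq nat) (tau : seq nat -> nat), forall G s, encodes G s ->
    [/\ runs A s (O s) (tau s), Q G (O s) & (tau s)%:R <= T (ne G) (nv G)].
Proof.
move=> [_ H].
have Hex s : exists ot : seq nat * nat, forall G, encodes G s ->
    [/\ runs A s ot.1 ot.2, Q G ot.1 & ot.2%:R <= T (ne G) (nv G)].
  case: (pselect (exists G, encodes G s)) => [[G HG]|HN]; last first.
    by exists ([::], 0%N) => G HG; case: HN; exists G.
  have [out [t [Hr _ _]]] := H G s HG; exists (out, t) => G' HG'.
  have [out' [t' [Hr' HQ' Ht']]] := H G' s HG'.
  by have [-> ->] := runs_det Hr Hr'.
have [F HF] := choice Hex.
by exists (fun s => (F s).1), (fun s => (F s).2) => G s HG; apply: HF.
Qed.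

Lemma natr_sum_le (I : eqType) (q : seq I) (F : I -> nat) (b : R) :
  (forall s, s \in q -> (F s)%:R <= b) -> (\sum_(s <- q) F s)%N%:R <= (size q)%:R * b.
Proof.
move=> H; rewrite natr_sum; apply: le_trans (_ : _ <= \sum_(s <- q) b) _.
  by rewrite big_seq [leRHS]big_seq; apply: ler_sum.
by rewrite big_const_seq count_predT iter_addr_0 mulr_natl.
Qed.

(** Take the oracle computed by [A]. Polylogarithmically many queries are made, and stability of [T]
    bounds each of them by a polylogarithmic multiple of [T] at the original size. *)
Lemma reduces_by_time M f P Q A T : nonneg f -> reduces_by M f P Q ->
  polylog_stable T -> solves_within A Q T ->
  solves_Otilde (inline A M) P (fun m n => T m n + f m n).
Proof.
move=> f0 [C [k HM]] HT HA; have [O [tau HO]] := solver_oracle HA.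
have [C' [k' HC']] := HT C k.
exists (`|C| * (1 + `|C'|)), (k + k')%N; split.
  by apply: oracle_free_inline; case: HA.
move=> G s HG.
have [out [t [q [Hr HP Ht Hq Hs]]]] := HM O (fun G s HG => let: And3 _ H _ := HO G s HG in H) G s HG.
exists out, (t + \sum_(s' <- q) tau s')%N; split => //.
  apply: oracle_runs_inline Hr _ => s' /Hs[H [HH _ _]].
  by have [] := HO H s' HH.
(* The sign of [T] at this size follows because it bounds the running time of the solver on [s]. *)
have T0 : 0 <= T (ne G) (nv G).
  by have [_ _ Htau] := HO G s HG; apply: le_trans Htau.
set fG := f _ _ in Ht *; set TG := T _ _ in T0 *.
have fG0 : 0 <= fG by exact: f0.
have Hsum : (\sum_(s' <- q) tau s')%N%:R <= (size q)%:R * (polylog `|C'| k' (nv G) * TG).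
  apply: natr_sum_le => s' /Hs[H [HH Hn Hm]].
  have [_ _ Htau] := HO H s' HH; apply: le_trans Htau _.
  apply: le_trans (HC' _ _ _ _ (nv_gt0 G) (nv_gt0 H) Hm Hn) _.
  by apply: ler_wpM2r => //; exact: le_polylog_norm.
rewrite natrD; apply: le_trans (lerD Ht Hsum) _.
set a := polylog `|C| k (nv G); set b := polylog `|C'| k' (nv G) in Hsum *.
have a0 : 0 <= a by exact: polylog_ge0.
have b0 : 0 <= b by exact: polylog_ge0.
apply: le_trans (_ : a * fG + a * (b * TG) <= _).
  apply: lerD; first by apply: ler_wpM2r => //; exact: le_polylog_norm.
  apply: ler_wpM2r; first exact: mulr_ge0.
  exact: le_trans Hq (le_polylog_norm _ _ _).
rewrite -polylogM -/a.
apply: le_trans (_ : a * (polylog (1 + `|C'|) k' (nv G) * (TG + fG)) <= _); last by rewrite mulrA.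
rewrite -mulrDr; apply: ler_wpM2l => //.
have -> : polylog (1 + `|C'|) k' (nv G) = (lg (nv G))%:R ^+ k' + b by rewrite /polylog mulrDl mul1r.
have l1 := lgX_ge1 (nv G) k'.
rewrite mulrDl mulrDr addrAC addrC !mulrDr.
apply: le_trans (_ : fG + b * TG <= (lg (nv G))%:R ^+ k' * fG + b * TG) _.
  by rewrite lerD2r ler_peMl.
have : 0 <= (lg (nv G))%:R ^+ k' * TG by rewrite mulr_ge0 // (le_trans ler01).
have : 0 <= b * fG by rewrite mulr_ge0.
lra.
Qed.

End Asymptotics.

(** * The concrete reduction, the range of the exponents, and the composed algorithms *)

Section MatrixMultiplication.
Variable R : realType.
Implicit Types (C tau : R).

Lemma natr_lg_bound (a n k l t : nat) : (t <= a * (lg n ^ k * n ^ l))%N ->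
  t%:R <= polylog a%:R k n * n%:R ^+ l :> R.
Proof. by move=> H; rewrite /polylog -!natrX -!natrM ler_nat -mulnA. Qed.

Lemma ansc_prog_reduces : reduces_by ansc_prog (fun _ n : nat => n%:R ^+ 2 : R) ANSC DIST.
Proof.
(* The 3 covers the [3 * ne G] edges and 2n vertices of a question, and the [2 * lg n] questions. *)
have [c Hc] := ansc_prog_run; exists (c + 3)%:R, 2 => O HO G s HG.
have [out [t [q [Hr HP Ht Hq Hs]]]] := Hc O G s HG HO.
have n0 := nv_gt0 G; have l0 := lg_gt0 (nv G).
exists out, t, q; split => //.
- apply: natr_lg_bound; apply: leq_trans Ht _.
  by rewrite leq_mul2r leq_addr orbT.
- rewrite /polylog -natrX -natrM ler_nat; apply: leq_trans Hq _.
  by apply: leq_mul; [clear; lia|move: l0; clear; nia].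
- move=> s' /Hs[H [HH Hn Hm]]; exists H; split => //.
    rewrite /polylog -natrX -!natrM ler_nat; apply: leq_trans Hn _.
    rewrite leq_mul2r; apply/orP; right.
    by apply: (@leq_trans ((c + 3) * 1)); [clear; lia|rewrite leq_mul // expn_gt0 l0].
  rewrite /polylog -natrX -!natrM ler_nat; apply: leq_trans Hm _.
  rewrite leq_mul2r; apply/orP; right.
  by apply: (@leq_trans ((c + 3) * 1)); [clear; lia|rewrite leq_mul // expn_gt0 l0].
Qed.

Lemma APSP_reduces M f P : @reduces_by R M f P DIST -> reduces_by M f P APSP.
Proof.
move=> [C [k H]]; exists C, k => O HO; apply: H => G s HG.
by apply: APSP_DIST; apply: HO.
Qed.

Lemma truncn_bound (x : R) : exists N : nat, (0 < N)%N /\ x <= N%:R.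
Proof.
exists (Num.bound `|x|).+1; split => //.
apply: le_trans (ler_norm x) (ltW (lt_le_trans (archi_boundP (normr_ge0 x)) _)).
by rewrite ler_nat.
Qed.

(** The term of degree [k.+1] of the exponential series suffices. The bound on [N] is solved from
    it, with [2 ^ k] coming from [N + 1 <= 2 * N]. *)
Lemma exp_not_polylog (d C : R) (k : nat) : 0 < d ->
  exists2 j : nat, (0 < j)%N & C * (j.+1)%:R ^+ k < expR (d * j%:R).
Proof.
move=> d0.
have [N [N0 HN]] := truncn_bound (`|C| * 2%:R ^+ k * (k.+1)`!%:R / d ^+ k.+1).
exists N => //.
have N1 : 1 <= N%:R :> R by rewrite ler1n.
have dN : 0 <= d * N%:R by rewrite mulr_ge0 // ltW.
apply: lt_le_trans (expR_ge1Dxn k dN).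
have F0 : 0 < ((k.+1)`!)%:R :> R by rewrite ltr0n fact_gt0.
have D0 : 0 < d ^+ k.+1 by rewrite exprn_gt0.
apply: le_lt_trans (_ : `|C| * (2%:R * N%:R) ^+ k < _).
  apply: le_trans (_ : _ <= `|C| * N.+1%:R ^+ k) _.
    by rewrite ler_wpM2r ?exprn_ge0 // ler_norm.
  rewrite ler_wpM2l // lerXn2r ?nnegrE ?mulr_ge0 ?ler0n //.
  by rewrite -natrM ler_nat; move: N0; clear; lia.
apply: le_lt_trans (_ : (d * N%:R) ^+ k.+1 / (k.+1)`!%:R < _); last by rewrite ltrDr ltr01.
rewrite ler_pdivlMr // exprMn [X in _ <= X]exprMn [N%:R ^+ k.+1]exprS.
rewrite ler_pdivrMr // in HN.
have Nk : 0 <= N%:R ^+ k :> R by rewrite exprn_ge0.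
have := ler_wpM2r Nk HN.
by rewrite -!mulrA ![_ * (k.+1)`!%:R]mulrC !mulrA [d ^+ _ * _]mulrC.
Qed.

(* The product of two all-ones matrices has [n ^ 2] nonzero entries to write. *)
Lemma mm_exponent_ge2 tau : mm_Otilde tau -> 2%:R <= tau.
Proof.
move=> [A [C [k [_ HA]]]]; rewrite leNgt; apply/negP => tau2.
have Hn n : (0 < n)%N -> n%:R ^+ 2 <= polylog C k n * n%:R `^ tau.
  move=> n0; have [||t [Hr Ht]] := HA n (const_mx 1) (const_mx 1) n0.
  - by move=> i j; rewrite mxE.
  - by move=> i j; rewrite mxE.
  apply: le_trans Ht; rewrite -natrX ler_nat.
  apply: leq_trans (oracle_runs_count_nonzero Hr).
  have : all (predC1 0%N) (rowmajor ((const_mx 1 : 'M[nat]_n) *m (const_mx 1 : 'M[nat]_n))).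
    apply: (@all_rowmajor nat n _ (predC1 0%N)) => i j; rewrite nat_mulmxE /= (eq_bigr (fun=> 1%N)).
      by rewrite sum_nat_const card_ord muln1 -lt0n.
    by move=> l _; rewrite !mxE.
  by rewrite all_count => /eqP ->; rewrite size_rowmajor.
(* At [n = 2 ^ j] the quotient of [n ^ 2] by the power [tau] of [n] is exponential in [j], with this
   rate, whereas [lg n = j.+1]. *)
have d0 : 0 < (2%:R - tau) * ln 2%:R by rewrite mulr_gt0 ?subr_gt0 ?ln_gt0 ?ltr1n.
have [j j0 Hj] := exp_not_polylog C k d0.
have n0 : (0 < 2 ^ j)%N by rewrite expn_gt0.
have := Hn _ n0; apply/negP; rewrite -ltNge.
have lgj : lg (2 ^ j) = j.+1 by rewrite /lg trunc_expnK.
rewrite /polylog lgj.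
have nn0 : (2 ^ j)%:R != 0 :> R by rewrite pnatr_eq0 -lt0n.
have -> : (2 ^ j)%:R ^+ 2 = (2 ^ j)%:R `^ (2%:R - tau) * (2 ^ j)%:R `^ tau :> R.
  rewrite -powRD; last by rewrite nn0 implybT.
  by rewrite subrK powR_mulrn.
rewrite ltr_pM2r; last by rewrite powR_gt0 // lt_neqAle eq_sym nn0 ler0n.
apply: lt_le_trans Hj _; rewrite /powR (negPf nn0) ler_expR natrX lnXn // -[ln _ *+ j]mulr_natr.
by rewrite mulrA.
Qed.

Lemma rowmajor_ext (U : Type) n (F F' : 'I_n -> 'I_n -> U) :
  (forall i j, F i j = F' i j) -> rowmajor F = rowmajor F'.
Proof. by move=> E; congr rowmajor; apply: funext => i; apply: funext => j. Qed.

Lemma multiplies_arrays A T n (F H : 'I_n -> 'I_n -> nat) :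
  @multiplies_within R A T -> (0 < n)%N ->
  (forall i j, F i j <= n)%N -> (forall i j, H i j <= n)%N ->
  exists t, runs A (n :: rowmajor F ++ rowmajor H)
    (rowmajor (fun i j => \sum_k F i k * H k j)%N) t /\ t%:R <= T n.
Proof.
move=> [_ HA] n0 HF HH.
have [||t [Hr Ht]] := HA n (\matrix_(i, j) F i j) (\matrix_(i, j) H i j) n0.
- by move=> i j; rewrite mxE.
- by move=> i j; rewrite mxE.
have EF : rowmajor (\matrix_(i, j) F i j : 'M[nat]_n) = rowmajor F.
  by apply: rowmajor_ext => i j; rewrite mxE.
have EH : rowmajor (\matrix_(i, j) H i j : 'M[nat]_n) = rowmajor H.
  by apply: rowmajor_ext => i j; rewrite mxE.
rewrite EF EH in Hr; exists t; split => //.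
have -> : rowmajor (fun i j => \sum_k F i k * H k j)%N =
  rowmajor ((\matrix_(i, j) F i j : 'M[nat]_n) *m \matrix_(i, j) H i j); last by [].
apply: rowmajor_ext => i j; rewrite nat_mulmxE; apply: eq_bigr => k _.
by rewrite !mxE.
Qed.

(** One function has to serve all dimensions and all pairs of matrices; determinism again makes the
    choice independent of how [q] is decomposed. *)
Lemma mm_oracle A T : @multiplies_within R A T ->
  exists (O : seq nat -> seq nat) (tau : seq nat -> nat),
  forall n (F H : 'I_n -> 'I_n -> nat), (0 < n)%N -> (forall i j, F i j <= n)%N ->
    (forall i j, H i j <= n)%N ->
    let q := n :: rowmajor F ++ rowmajor H in
    [/\ runs A q (O q) (tau q), O q = rowmajor (fun i j => \sum_k F i k * H k j)%N
      & (tau q)%:R <= T n].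
Proof.
move=> HA.
pose spec q (ot : seq nat * nat) := forall n (F H : 'I_n -> 'I_n -> nat), (0 < n)%N ->
  (forall i j, F i j <= n)%N -> (forall i j, H i j <= n)%N ->
  q = n :: rowmajor F ++ rowmajor H ->
  [/\ runs A q ot.1 ot.2, ot.1 = rowmajor (fun i j => \sum_k F i k * H k j)%N & ot.2%:R <= T n].
have Hex q : exists ot, spec q ot.
  case: (pselect (exists o t, runs A q o t)) => [[o [t Hr]]|HN]; last first.
    exists ([::], 0%N) => n F H n0 HF HH E; case: HN.
    have [t [Hr _]] := multiplies_arrays HA n0 HF HH; rewrite E.
    by exists (rowmajor (fun i j => \sum_k F i k * H k j)%N), t.
  exists (o, t) => n F H n0 HF HH E; have [t' [Hr' Ht']] := multiplies_arrays HA n0 HF HH.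
  by rewrite -E in Hr'; have [-> ->] := runs_det Hr Hr'.
have [F HF] := choice Hex.
exists (fun q => (F q).1), (fun q => (F q).2) => n X Y n0 HX HY q.
exact: HF.
Qed.

(** The [n ^ 2] work of [seidel] is absorbed thanks to [2 <= tau]. It carries two logarithms, while
    the [2 * lg n] products add just one to those of [A]; hence [k + 2]. *)
Lemma seidel_solves A C k tau : 2%:R <= tau ->
  multiplies_within A (fun n => polylog C k n * n%:R `^ tau) ->
  exists C1 k1, 0 <= C1 /\
    solves_within (inline A seidel) DIST (fun _ n => polylog C1 k1 n * n%:R `^ tau).
Proof.
move=> tau2 HA; have [c Hc] := seidel_run; have [O [cost HO]] := mm_oracle HA.
exists (c%:R + 2%:R * `|C|), (k + 2)%N; split; first by rewrite addr_ge0 ?mulr_ge0.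
split; first by apply: oracle_free_inline; case: HA.
move=> G s HG; have n0 := nv_gt0 G.
have [|out [t [q [Hr HP Ht Hq Hs]]]] := Hc O G s HG.
  by move=> F H HF HH; have [] := HO _ F H n0 HF HH.
exists out, (t + \sum_(s' <- q) cost s')%N; split => //.
  apply: oracle_runs_inline Hr _ => s' /Hs[F [H [HF HH ->]]].
  by have [] := HO _ F H n0 HF HH.
set n := nv G in n0 Ht Hq Hs *.
have n1 : 1 <= n%:R :> R by rewrite ler1n.
have p0 : 0 <= n%:R `^ tau :> R by exact: powR_ge0.
have Hsum : (\sum_(s' <- q) cost s')%N%:R <= (size q)%:R * (polylog `|C| k n * n%:R `^ tau).
  apply: natr_sum_le => s' /Hs[F [H [HF HH ->]]].
  have [_ _ Hcost] := HO _ F H n0 HF HH; apply: le_trans Hcost _.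
  by apply: ler_wpM2r => //; exact: le_polylog_norm.
rewrite natrD.
have H1 : t%:R <= polylog c%:R (k + 2) n * n%:R `^ tau.
  apply: le_trans (natr_lg_bound Ht) _; rewrite -powR_mulrn //.
  apply: ler_pM; [exact: polylog_ge0|exact: powR_ge0| |exact: ler_powR].
  by apply: ler_polylog; rewrite // leq_addl.
have H2 : (size q)%:R * (polylog `|C| k n * n%:R `^ tau) <=
    polylog (2%:R * `|C|) (k + 2) n * n%:R `^ tau.
  rewrite mulrA; apply: ler_wpM2r => //.
  apply: le_trans (_ : polylog 2%:R 1 n * polylog `|C| k n <= _).
    apply: ler_wpM2r; first exact: polylog_ge0.
    by rewrite /polylog expr1 -natrM ler_nat.
  by rewrite polylogM; apply: ler_polylog; rewrite ?mulr_ge0 // addnC leq_add2l.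
have -> : polylog (c%:R + 2%:R * `|C|) (k + 2) n =
    polylog c%:R (k + 2) n + polylog (2%:R * `|C|) (k + 2) n by rewrite /polylog mulrDl.
by rewrite mulrDl lerD // (le_trans Hsum).
Qed.

(** By [lg n <= n] the size [n'] is at most [c * n ^ k.+1], and logarithms turn the power into a
    factor. *)
Lemma lg_polylog_bound c k n n' : (0 < c)%N -> (0 < n)%N -> (n' <= c * lg n ^ k * n)%N ->
  (lg n' <= (lg c + k.+1) * lg n)%N.
Proof.
move=> c0 n0 H; have Hn : (n' <= c * n ^ k.+1)%N.
  apply: leq_trans H _; rewrite expnSr mulnA leq_mul2r leq_mul2l.
  by case: k => [|k]; rewrite ?leqnn ?orbT // leq_exp2r // lg_le ?orbT.
apply: leq_trans (leq_lg Hn) _; apply: leq_trans (lg_mul _ _) _.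
rewrite mulnDl leq_add ?lg_expn //.
by rewrite leq_pmulr // lg_gt0.
Qed.

(** Raising [lg n ^ k1] to the real power [tau] leaves the natural exponents of [polylog], so [tau]
    is first rounded up to an integer [e]. *)
Lemma polylog_powR_stable C k tau : 0 <= C -> 0 <= tau ->
  polylog_stable (fun _ n => polylog C k n * n%:R `^ tau : R).
Proof.
move=> C0 tau0 C1 k1; have [c [c0 Hc]] := truncn_bound C1.
have [e [e0 He]] := truncn_bound tau.
set d := (lg c + k1.+1)%N.
exists (d%:R ^+ k * c%:R `^ tau), (k + k1 * e)%N => m n m' n' n0 n'0 _ Hn.
have Hnn : (n' <= c * lg n ^ k1 * n)%N.
  rewrite -(ler_nat R); apply: le_trans Hn _; rewrite /polylog !natrM natrX.
  by rewrite ler_wpM2r // ler_wpM2r ?exprn_ge0.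
have Hlg := lg_polylog_bound c0 n0 Hnn; rewrite -/d in Hlg.
have p0 x : 0 <= x `^ tau by move=> *; exact: powR_ge0.
have l1 := lgX_ge1 R n k1.
have H1 : polylog C k n' <= C * (d%:R ^+ k * (lg n)%:R ^+ k).
  rewrite /polylog ler_wpM2l // -exprMn -natrM lerXn2r ?nnegrE //.
  by rewrite ler_nat.
have H2 : n'%:R `^ tau <= c%:R `^ tau * (lg n)%:R ^+ (k1 * e) * n%:R `^ tau.
  apply: le_trans (_ : (c%:R * (lg n)%:R ^+ k1 * n%:R) `^ tau <= _).
    apply: ge0_ler_powR; rewrite ?nnegrE ?mulr_ge0 ?exprn_ge0 //.
    by rewrite -natrX -!natrM ler_nat.
  rewrite !powRM ?mulr_ge0 ?exprn_ge0 //.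
  rewrite ler_wpM2r // ler_wpM2l // exprM -[leRHS]powR_mulrn ?exprn_ge0 //.
  exact: ler_powR.
apply: le_trans (ler_pM _ _ H1 H2) _; rewrite ?p0 ?polylog_ge0 //.
set a := d%:R ^+ k; set b := c%:R `^ tau; set L := (lg n)%:R; set N := n%:R `^ tau.
have L1 : 1 <= L ^+ k by exact: lgX_ge1.
have -> : polylog (a * b) (k + k1 * e) n * (polylog C k n * N) =
  (C * (a * L ^+ k) * (b * L ^+ (k1 * e) * N)) * L ^+ k.
  by rewrite /polylog exprD -/L; ring.
by apply: ler_peMr => //; rewrite ?mulr_ge0 ?exprn_ge0 ?p0 //; exact: powR_ge0.
Qed.

(** The solver is the multiplier inlined in [seidel], inlined in [ansc_prog]. Its time is that for
    distances plus [n ^ 2], and the latter disappears because [2 <= tau]. *)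
Lemma mm_Otilde_solvable tau : mm_Otilde tau ->
  solvable_Otilde ANSC (fun _ n : nat => n%:R `^ tau : R).
Proof.
move=> Hmm; have tau2 := mm_exponent_ge2 Hmm; have [A [C [k HA]]] := Hmm.
have [C1 [k1 [C10 HS]]] := seidel_solves tau2 HA.
exists (inline (inline A seidel) ansc_prog).
have tau0 : 0 <= tau by apply: le_trans tau2; rewrite ler0n.
have f0 : nonneg (fun _ n : nat => n%:R ^+ 2 : R) by move=> m n; rewrite exprn_ge0.
apply: solves_Otilde_weaken (reduces_by_time f0 ansc_prog_reduces
  (polylog_powR_stable k1 C10 tau0) HS).
- by move=> m n; rewrite addr_ge0 ?mulr_ge0 ?polylog_ge0 ?powR_ge0 ?exprn_ge0.
- by move=> m n; exact: powR_ge0.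
- exact: (addr_ge0 C10 ler01).
move=> m n n0 /=; instantiate (1 := k1).
have -> : polylog (C1 + 1) k1 n * n%:R `^ tau =
    polylog C1 k1 n * n%:R `^ tau + polylog 1 k1 n * n%:R `^ tau :> R.
  by rewrite /polylog -mulrDl -mulrDl.
rewrite lerD2l; apply: le_trans (_ : n%:R `^ tau <= _).
  by rewrite -powR_mulrn // ler_powR // ler1n.
by apply: ler_peMl; rewrite ?powR_ge0 // /polylog mul1r lgX_ge1.
Qed.

(** The exponent is 4 instead of 3 because [mm_exponents] admits no logarithmic factor: the word
    length [16 * lg n] is estimated by [16 * n]. *)
Lemma mm_exponents_nonempty : (@mm_exponents R !=set0)%classic.
Proof.
exists 4%:R, school_mm, (48 * csz school_mm)%:R; split => // n X Y n0 HX HY.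
have [t Hr Ht] := school_mm_spec n0 HX HY; exists t; split => //.
rewrite powR_mulrn // -natrX -natrM ler_nat; apply: leq_trans Ht _.
have H1 : ((n * n * n.+1).+1 <= 3 * n ^ 3)%N by move: n0; clear; nia.
have H2 : (bits ((n + 2) ^ 4) <= 16 * n)%N.
  by apply: leq_trans (bits_bound n0) _; rewrite leq_mul2l lg_le ?orbT.
apply: leq_trans (leq_mul (leq_mul (leqnn _) H1) H2) _.
by move: (csz school_mm) => c; rewrite !expnS; clear; lia.
Qed.

(** An infimum need not be attained, but some admissible exponent lies below [omega R + eps], and
    powers of [n] are monotone in the exponent. *)
Lemma omega_solvable (eps : R) : 0 < eps ->
  solvable_Otilde ANSC (fun _ n : nat => n%:R `^ (omega R + eps) : R).
Proof.
move=> eps0; have [|tau [A [C HA]] Htau] := inf_lt mm_exponents_nonempty (x := omega R + eps).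
  by rewrite ltrDl.
have Hmm : mm_Otilde tau.
  exists A, C, 0%N; case: HA => HA1 HA; split => // n X Y n0 HX HY.
  by rewrite /polylog expr0 mulr1; exact: HA.
have [M HM] := mm_Otilde_solvable Hmm; exists M.
apply: solves_Otilde_weaken HM => [m n|m n||].
- exact: powR_ge0.
- exact: powR_ge0.
- exact: ler01.
move=> m n n0; instantiate (1 := 0%N).
by rewrite /polylog expr0 !mul1r; apply: ler_powR; rewrite ?ler1n // ltW.
Qed.

End MatrixMultiplication.

Theorem theorem2 (R : realType) :
  sparse_reduces (fun _ n : nat => n%:R ^+ 2 : R) ANSC APSP /\
  (forall tau : R, mm_Otilde tau ->
     solvable_Otilde ANSC (fun _ n : nat => n%:R `^ tau : R)) /\
  (forall eps : R, 0 < eps ->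
     solvable_Otilde ANSC (fun _ n : nat => n%:R `^ (omega R + eps) : R)).
Proof.
split; last by split; [exact: mm_Otilde_solvable|exact: omega_solvable].
have HM := APSP_reduces (ansc_prog_reduces R).
exists ansc_prog; split; first exact: HM.
move=> A T; apply: reduces_by_time HM => m n; exact: exprn_ge0.
Qed.
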